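(* Let $\mathcal S,B$ be as in the context. Consider pairs $(f,\mu)$ with $f=I_0\chi_\Omega$, where $I_0>0$ is a constant and $\Omega\subset B$ is a compact domain with smooth boundary which is strictly convex almost everywhere, and $\mu=\sum_{k=1}^m\Phi_k\chi_{\Omega_k}$ as in the context, such that the geometric assumptions (1)--(5) of the context hold and such that there exists $(v,\omega)\in\mathcal S\times S^{n-1}$ with $X_{w_2}f(v,\omega)>0$ and $X_{w_1}\mu(v,\omega)=0$. Then $\mathcal D_{n-2}(f,\mu)$ determines $f$ uniquely; that is, if $(f_1,\mu_1)$ and $(f_2,\mu_2)$ are two such pairs and $\mathcal D_{n-2}(f_1,\mu_1)=\mathcal D_{n-2}(f_2,\mu_2)$ on $\mathcal S\times S^{n-1}$, then $f_1=f_2$.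
   Context: Setting. $n\ge2$; $\mathcal S\subset\mathbb R^n$ is a smooth $(n-1)$-dimensional manifold; $B\subset\mathbb R^n$ is an open, simply connected domain with $B\cap\mathcal S=\emptyset$. $\mu=\sum_{k=1}^m\Phi_k\chi_{\Omega_k}$ with $\Phi_k>0$ smooth functions and $\Omega_k\subset B$ compact domains with smooth boundaries, pairwise disjoint and disjoint from $\Omega$. $\Xi=\partial\Omega\cup\bigcup_{k=1}^m\partial\Omega_k$; $\Omega_c$ is the convex hull of $\Omega$. Transform. For $v\in\mathcal S$, $\omega\in S^{n-1}$, $$\mathcal D_{n-2}(f,\mu)(v,\omega)=\int_0^\infty\rho^{n-2}f(v+\rho\omega)\,e^{-\int_0^\rho\mu(v+r\omega)\,dr}\,d\rho .$$ Strict convexity. A smooth hypersurface $M\subset\mathbb R^n$ is strictly convex near $x\in M$ if its second fundamental form at $x$ is (positive or negative) definite; it is strictly convex almost everywhere if this holds for almost all $x\in M$. Geometric assumptions: (1) $\Xi$ is strictly convex almost everywhere. (2) $\operatorname{supp}(\mu)\cap\Omega_c=\emptyset$. (3) No line is tangent to $\Xi$ at three or more points. (4) Every line through $B$ intersects $\mathcal S$. (5) Any line that is tangent to $\Xi$ at a point where $\Xi$ is not strictly convex is not tangent to $\Xi$ at any other point. The weighted transforms. $X_{w_2}f(v,\omega)=\int_0^\infty\rho^{n-2}f(v+\rho\omega)\,d\rho$. For $v\in\mathcal S$ let $\Lambda_v=\bigcup_{x\in\Omega_c}\{v+t(x-v):t\in[0,1]\}$, let $\Lambda_{v,\epsilon}$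 be the open $\epsilon$-neighbourhood of $\Lambda_v$ for some sufficiently small $\epsilon>0$, and let $\varphi_v\in C_c^\infty(\mathbb R^n)$, $\varphi_v\ge0$, be a cutoff (smooth also in $v$) equal to $1$ on $\Lambda_v$ and supported in $\Lambda_{v,\epsilon}$. Then $X_{w_1}\mu(v,\omega)=\int_0^\infty(\varphi_v\mu)(v+\rho\omega)\,d\rho$. With these choices, under assumption (2), $\mathcal D_{n-2}(f,\mu)(v,\omega)=e^{-X_{w_1}\mu(v,\omega)}X_{w_2}f(v,\omega)$. *)

(* Defs.v *)
From mathcomp Require Import all_boot all_order all_algebra.
From mathcomp Require Import all_classical all_reals all_analysis.
Set Implicit Arguments.
Unset Strict Implicit.
Unset Printing Implicit Defensive.
Import Order.TTheory GRing.Theory Num.Theory.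
Import numFieldNormedType.Exports.
Local Open Scope classical_set_scope.
Local Open Scope ring_scope.

(* The norm that the library puts on 'rV[R]_n is the sup norm; it has the same *)
(* topology as the Euclidean norm [enorm], which is the one used for           *)
(* directions, unit normals and neighbourhoods.                                *)
Definition dotv (R : realType) (n : nat) (x y : 'rV[R]_n) : R :=
  \sum_(i < n) x 0 i * y 0 i.

Definition enorm (R : realType) (n : nat) (x : 'rV[R]_n) : R :=
  Num.sqrt (dotv x x).

Definition grad (R : realType) (n : nat) (g : 'rV[R]_n -> R) (x : 'rV[R]_n) :
  'rV[R]_n := \row_(i < n) 'D_(delta_mx 0 i) g x.

(* Meaningful for open U only: all iterated partial derivatives of g of order  *)
(* at most k exist and are continuous on U.                                    *)
Fixpoint class_C (R : realType) (n k : nat) (U : set 'rV[R]_n)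
    (g : 'rV[R]_n -> R) : Prop :=
  (forall x, U x -> {for x, continuous g}) /\
  (if k is k'.+1 then
     forall i : 'I_n,
       (forall x, U x -> derivable g x (delta_mx 0 i)) /\
       class_C k' U ('D_(delta_mx 0 i) g)
   else True).

Definition smooth_on (R : realType) (n : nat) (U : set 'rV[R]_n)
    (g : 'rV[R]_n -> R) : Prop := forall k, class_C k U g.

Definition boundary (R : realType) (n : nat) (A : set 'rV[R]_n) :
  set 'rV[R]_n := closure A `\` interior A.

Definition supp (R : realType) (n : nat) (g : 'rV[R]_n -> R) : set 'rV[R]_n :=
  closure [set x | g x != 0].

Definition convex_hull (R : realType) (n : nat) (A : set 'rV[R]_n) :
  set 'rV[R]_n := smallest (@convex_set R 'rV[R]_n) A.

Definition simply_connected (R : realType) (n : nat) (B : set 'rV[R]_n) : Prop :=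
  (forall x y, B x -> B y -> exists gamma : R -> 'rV[R]_n,
     [/\ {within `[0, 1], continuous gamma},
         forall t : R, t \in `[0, 1] -> B (gamma t), gamma 0 = x & gamma 1 = y]) /\
  (forall gamma : R -> 'rV[R]_n,
     {within `[0, 1], continuous gamma} ->
     (forall t : R, t \in `[0, 1] -> B (gamma t)) -> gamma 0 = gamma 1 ->
     exists H : R * R -> 'rV[R]_n,
     [/\ {within `[0, 1] `*` `[0, 1], continuous H},
         forall s t : R, s \in `[0, 1] -> t \in `[0, 1] -> B (H (s, t)),
         forall t : R, t \in `[0, 1] -> H (0, t) = gamma t,
         forall t : R, t \in `[0, 1] -> H (1, t) = gamma 0 &
         forall s : R, s \in `[0, 1] -> H (s, 0) = gamma 0 /\ H (s, 1) = gamma 0]).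

(* g is a submersion on the open set U, and M is its zero set there. *)
Definition defining_function (R : realType) (n : nat) (M U : set 'rV[R]_n)
    (g : 'rV[R]_n -> R) : Prop :=
  [/\ open U, smooth_on U g, forall y, U y -> grad g y != 0 &
      forall y, U y -> (M y <-> g y = 0)].

(* Embedded (n-1)-dimensional submanifold, not necessarily closed. *)
Definition smooth_hypersurface (R : realType) (n : nat) (M : set 'rV[R]_n) :
    Prop :=
  forall x, M x -> exists U g, U x /\ defining_function M U g.

(* Closure of a nonempty connected open set, lying locally on one side of its  *)
(* smooth boundary.                                                            *)
Definition compact_smooth_domain (R : realType) (n : nat)
    (Omega : set 'rV[R]_n) : Prop :=
  [/\ compact Omega,
      exists D, [/\ open D, D !=set0, connected D & Omega = closure D] &
      forall x, boundary Omega x -> exists U (g : 'rV[R]_n -> R),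
        [/\ U x, open U, smooth_on U g, forall y, U y -> grad g y != 0 &
            forall y, U y -> (Omega y <-> g y <= 0)]].

Definition tangent_vector (R : realType) (n : nat) (M : set 'rV[R]_n)
    (x u : 'rV[R]_n) : Prop :=
  exists U g, [/\ U x, defining_function M U g & dotv (grad g x) u = 0].

Definition unit_normal (R : realType) (n : nat) (g : 'rV[R]_n -> R)
    (x : 'rV[R]_n) : 'rV[R]_n := (enorm (grad g x))^-1 *: grad g x.

(* Second fundamental form of the hypersurface {g = 0} with respect to the     *)
(* unit normal field of g; for tangent u and w it depends on g only through    *)
(* its sign.                                                                   *)
Definition second_fundamental_form (R : realType) (n : nat)
    (g : 'rV[R]_n -> R) (x u w : 'rV[R]_n) : R :=
  - dotv ('D_u (unit_normal g) x) w.

Definition strictly_convex_near (R : realType) (n : nat) (M : set 'rV[R]_n)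
    (x : 'rV[R]_n) : Prop :=
  exists U g, [/\ U x, defining_function M U g &
    (forall u, tangent_vector M x u -> u != 0 ->
       0 < second_fundamental_form g x u u) \/
    (forall u, tangent_vector M x u -> u != 0 ->
       second_fundamental_form g x u u < 0)].

(* Vanishing (n-1)-dimensional Hausdorff measure; on a smooth hypersurface     *)
(* these are the null sets of the surface measure.                             *)
Definition surface_null (R : realType) (n : nat) (A : set 'rV[R]_n) : Prop :=
  forall e : R, 0 < e -> exists (c : nat -> 'rV[R]_n) (r : nat -> R),
    [/\ forall k, 0 <= r k,
        A `<=` \bigcup_k [set x | enorm (x - c k) <= r k] &
        (\sum_(0 <= k <oo) (r k ^+ n.-1)%:E < e%:E)%E].

Definition strictly_convex_ae (R : realType) (n : nat) (M : set 'rV[R]_n) :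
    Prop :=
  surface_null [set x | M x /\ ~ strictly_convex_near M x].

(* The line p + R u is tangent to M at x. *)
Definition line_tangent_at (R : realType) (n : nat) (M : set 'rV[R]_n)
    (p u x : 'rV[R]_n) : Prop :=
  [/\ M x, exists t : R, x = p + t *: u & tangent_vector M x u].

(* f = intensity * 1_region and mu = sum_k attn_density k * 1_(attn_region k). *)
Record activity_attenuation (R : realType) (n : nat) := ActivityAttenuation {
  intensity : R;
  region : set 'rV[R]_n;
  nattn : nat;
  attn_density : 'I_nattn -> 'rV[R]_n -> R;
  attn_region : 'I_nattn -> set 'rV[R]_n
}.
Arguments attn_density {R n} _ _ _.
Arguments attn_region {R n} _ _ _.

Definition source (R : realType) (n : nat) (p : activity_attenuation R n)
    (x : 'rV[R]_n) : R :=
  intensity p * \1_(region p) x.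

Definition attenuation (R : realType) (n : nat) (p : activity_attenuation R n)
    (x : 'rV[R]_n) : R :=
  \sum_(k < nattn p) attn_density p k x * \1_(attn_region p k) x.

Definition singular_set (R : realType) (n : nat) (p : activity_attenuation R n) :
    set 'rV[R]_n :=
  boundary (region p) `|` \bigcup_k boundary (attn_region p k).

Definition admissible_pair (R : realType) (n : nat) (B : set 'rV[R]_n)
    (p : activity_attenuation R n) : Prop :=
  [/\ 0 < intensity p,
      [/\ compact_smooth_domain (region p), region p `<=` B &
          strictly_convex_ae (boundary (region p))],
      forall k, smooth_on setT (attn_density p k) /\
                forall x, 0 < attn_density p k x,
      forall k, compact_smooth_domain (attn_region p k) /\
                attn_region p k `<=` B &
      (forall k l, k != l ->
         attn_region p k `&` attn_region p l = set0) /\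
      (forall k, attn_region p k `&` region p = set0)].

Definition geometric_assumptions (R : realType) (n : nat)
    (S B : set 'rV[R]_n) (p : activity_attenuation R n) : Prop :=
  let Xi := singular_set p in
  [/\ strictly_convex_ae Xi,
      supp (attenuation p) `&` convex_hull (region p) = set0,
      forall q u, u != 0 -> ~ exists x y z,
        [/\ x != y, y != z & x != z] /\
        [/\ line_tangent_at Xi q u x, line_tangent_at Xi q u y &
            line_tangent_at Xi q u z],
      forall q u, B q -> u != 0 -> exists t : R, S (q + t *: u) &
      forall q u x, u != 0 -> line_tangent_at Xi q u x ->
        ~ strictly_convex_near Xi x ->
        forall y, y != x -> ~ line_tangent_at Xi q u y].

(* [divergent_beam k] is D_k, with weight rho ^ k. *)
Definition divergent_beam (R : realType) (n k : nat) (f mu : 'rV[R]_n -> R)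
    (v w : 'rV[R]_n) : R :=
  \int[lebesgue_measure]_(rho in `[0, +oo[)
    (rho ^+ k * f (v + rho *: w) *
     expR (- \int[lebesgue_measure]_(r in `[0, rho]) mu (v + r *: w))).

Definition X_w2 (R : realType) (n : nat) (f : 'rV[R]_n -> R)
    (v w : 'rV[R]_n) : R :=
  \int[lebesgue_measure]_(rho in `[0, +oo[) (rho ^+ (n - 2) * f (v + rho *: w)).

Definition X_w1 (R : realType) (n : nat) (phi : 'rV[R]_n -> 'rV[R]_n -> R)
    (mu : 'rV[R]_n -> R) (v w : 'rV[R]_n) : R :=
  \int[lebesgue_measure]_(rho in `[0, +oo[)
    (phi v (v + rho *: w) * mu (v + rho *: w)).

Definition Lambda (R : realType) (n : nat) (Omega : set 'rV[R]_n)
    (v : 'rV[R]_n) : set 'rV[R]_n :=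
  [set y | exists x (t : R), [/\ convex_hull Omega x, t \in `[0, 1] &
                                 y = v + t *: (x - v)]].

Definition Lambda_nbhd (R : realType) (n : nat) (Omega : set 'rV[R]_n)
    (v : 'rV[R]_n) (eps : R) : set 'rV[R]_n :=
  [set y | exists z, Lambda Omega v z /\ enorm (y - z) < eps].

(* What "sufficiently small" is for: behind the convex hull of the region, as  *)
(* seen from v, the neighbourhood of Lambda_v does not reach supp mu. This is  *)
(* what makes D_(n-2)(f, mu) = exp(- X_w1 mu) * X_w2 f hold.                    *)
Definition small_width (R : realType) (n : nat) (S : set 'rV[R]_n)
    (p : activity_attenuation R n) (eps : 'rV[R]_n -> R) : Prop :=
  forall v, S v -> 0 < eps v /\
    forall x (t : R), convex_hull (region p) x -> 1 <= t ->
      Lambda_nbhd (region p) v (eps v) (v + t *: (x - v)) ->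
      ~ supp (attenuation p) (v + t *: (x - v)).

(* [phi v] is the cutoff phi_v. Smoothness in v along S means that phi is      *)
(* locally the restriction of a function smooth in (v, x), the pair (v, x)     *)
(* being encoded as a row vector of length n + n.                              *)
Definition cutoff_family (R : realType) (n : nat) (S Omega : set 'rV[R]_n)
    (eps : 'rV[R]_n -> R) (phi : 'rV[R]_n -> 'rV[R]_n -> R) : Prop :=
  (forall v, S v ->
     [/\ smooth_on setT (phi v), compact (supp (phi v)),
         forall x, 0 <= phi v x,
         forall x, Lambda Omega v x -> phi v x = 1 &
         supp (phi v) `<=` Lambda_nbhd Omega v (eps v)]) /\
  (forall v0, S v0 -> exists U (psi : 'rV[R]_(n + n) -> R),
     [/\ open U, U v0,
         smooth_on [set z : 'rV[R]_(n + n) | U (lsubmx z)] psi &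
         forall v x, S v -> U v -> phi v x = psi (row_mx v x)]).

(* Main.v *)
(** Idea.  Suppose that the boundary of the first region has a point outside
    the boundary of the second one.  By assumption (3) this boundary curve or
    surface contains no segments near that point, so pushing a chord outwards
    to its last contact gives a line touching it at an isolated point y, from
    one side.  Turning this line gives a one-parameter family of touching
    lines; a Sard-type estimate shows that all but a null set of them are
    transversal to all the boundaries (of both pairs) away from the contact
    point.  By assumption (4) such a line contains a vertex v in S.  Rotate the
    ray from v by a small angle t: transversal crossings move by O(t), so the
    beam of the second pair is Lipschitz in t, whereas for one sign of t the
    first beam gains or loses a chord of length of order sqrt |t| near y.  Hence
    the two boundaries agree.  (A point of the first region in an attenuating
    region of the second pair lies outside the convex hull of the second region;
    a line near it then misses the second region but crosses the first one.)

    Two domains with the same boundary are equal: otherwise their interiors are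
    disjoint, and one of them rises above the other at the highest point of
    both.  Finally, along the ray where X_w1 of the first attenuation vanishes
    the first beam is not attenuated, which gives I_1 <= I_2, and conversely. *)

(* The obstacle is a second tangency of the chosen line, to a boundary of either pair: it could
   change a beam at the same rate sqrt |t| and hide the first one. So the line must be perturbed
   while it stays tangent near y, although its contact point is not known to move continuously with
   the slope. What is controlled is the height C(t) at which the line of slope t touches: it is a
   maximum of functions that are affine in t, hence Lipschitz, with constant the half-width r of a
   box holding all the contact points. At distance s0 > 2 r from the base point a turn by dt
   outweighs the change of C and displaces the line by at least r |dt|. If two lines of the family
   are tangent to one boundary near that place, at positions s and s', then their slopes differ by
   O((s - s')^2), and sets of slopes with this property are null. The factor 2 r is why r is chosen
   small against the distances to the other tangencies of the initial line, which are finite in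
   number by assumption (3). Locally a boundary enters only through a defining function with
   Lipschitz gradient, that is, through first-order expansions with quadratic error. *)
Require Import Defs.
From mathcomp Require Import all_boot all_order all_algebra.
From mathcomp Require Import all_classical all_reals all_analysis.
From mathcomp Require Import measurable_realfun ring lra.
Set Implicit Arguments.
Unset Strict Implicit.
Import Order.TTheory GRing.Theory Num.Theory.
Import numFieldNormedType.Exports.
Local Open Scope classical_set_scope.
Local Open Scope ring_scope.

(** * Second-order expansions *)

Lemma rV_coord_le (R : realType) (n : nat) (x : 'rV[R]_n) (i : 'I_n) :
  `|x 0 i| <= `|x|.
Proof.
rewrite /Num.norm /= mx_normrE.
exact: (le_bigmax _ (fun ij : 'I_1 * 'I_n => `|x ij.1 ij.2|) (0, i)).
Qed.

Lemma rV_norm_le (R : realType) (n : nat) (x : 'rV[R]_n) (c : R) :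
  0 <= c -> (forall i, `|x 0 i| <= c) -> `|x| <= c.
Proof.
move=> c0 H; rewrite /Num.norm /= mx_normrE.
by apply: bigmax_le => // -[i j] _ /=; rewrite ord1.
Qed.

Lemma is_derive_line (R : realType) (n : nat) (g : 'rV[R]_n -> R)
    (a d : 'rV[R]_n) (s : R) :
  derivable g (a + s *: d) d ->
  is_derive s 1 (fun t => g (a + t *: d)) ('D_d g (a + s *: d)).
Proof.
have E : (fun h : R => h^-1 *: (((fun t => g (a + t *: d)) \o shift s) (h *: 1)
            - g (a + s *: d)))
       = (fun h : R => h^-1 *: ((g \o shift (a + s *: d)) (h *: d)
            - g (a + s *: d))).
  apply/funext => h /=; congr (_ *: (g _ - _)).
  by rewrite scalerDl -[h%:A]/(h * 1) mulr1 addrCA.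
move=> H; split; first by rewrite /derivable E.
by rewrite /derive E.
Qed.

Lemma mvt_line (R : realType) (n : nat) (g : 'rV[R]_n -> R)
    (a d : 'rV[R]_n) (c : R) :
  (forall s, `|s| <= `|c| -> 0 <= s * c -> derivable g (a + s *: d) d) ->
  exists s, [/\ `|s| <= `|c|, 0 <= s * c &
    g (a + c *: d) - g a = 'D_d g (a + s *: d) * c].
Proof.
move=> H.
pose f t := g (a + t *: d).
have Hd s : `|s| <= `|c| -> 0 <= s * c ->
    is_derive s 1 f ('D_d g (a + s *: d)).
  by move=> h1 h2; apply: is_derive_line; exact: H.
have f0 : f 0 = g a by rewrite /f scale0r addr0.
have [c0|c0] := leP 0 c.
- have in0 s : s \in `[0, c] -> `|s| <= `|c| /\ 0 <= s * c.
    rewrite in_itv /= => /andP[s0 sc].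
    by rewrite !ger0_norm// mulr_ge0.
  have [||s sI E] := @MVT_segment R f (fun s => 'D_d g (a + s *: d)) 0 c c0.
  + move=> s sI.
    have [] := in0 s; last exact: Hd.
    by apply: subset_itvW sI.
  + apply: derivable_within_continuous => s /in0[h1 h2].
    by have [] := Hd s h1 h2.
  + have [h1 h2] := in0 _ sI.
    by exists s; split => //; rewrite -f0 -/(f c) E subr0.
- have in0 s : s \in `[c, 0] -> `|s| <= `|c| /\ 0 <= s * c.
    rewrite in_itv /= => /andP[s0 sc].
    by rewrite !ler0_norm// ?(ltW c0)// lerN2 s0 mulr_le0// ltW.
  have [||s sI E] := @MVT_segment R f (fun s => 'D_d g (a + s *: d)) c 0 (ltW c0).
  + move=> s sI.
    have [] := in0 s; last exact: Hd.
    by apply: subset_itvW sI.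
  + apply: derivable_within_continuous => s /in0[h1 h2].
    by have [] := Hd s h1 h2.
  + have [h1 h2] := in0 _ sI.
    exists s; split => //; rewrite -f0 -/(f c).
    by rewrite -opprB E sub0r mulrN opprK.
Qed.

Lemma shift_between (R : realDomainType) (m x y z s : R) :
  `|y - x| <= m -> `|z - x| <= m -> `|s| <= `|z - y| -> 0 <= s * (z - y) ->
  `|y + s - x| <= m.
Proof.
rewrite !ler_norml => /andP[a1 a2] /andP[b1 b2].
have [l|l] := leP 0 (z - y); [rewrite ger0_norm//|rewrite ltr0_norm//];
  move=> /andP[h1 h2] h3.
- have [s0|s0] := leP 0 s; first by apply/andP; split; lra.
  suff : s * (z - y) < 0 by lra.
  by rewrite nmulr_rlt0 //; lra.
- have [s0|s0] := leP s 0; first by apply/andP; split; lra.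
  suff : s * (z - y) < 0 by lra.
  by rewrite pmulr_rlt0 //; lra.
Qed.

(** Only partial derivatives are at hand, so [z] is reached from [y] one coordinate at a time, with
    one intermediate point for each coordinate. In the sup norm this staircase stays in the ball,
    and no farther from [y] than [z] is. *)
Lemma mvt_coordinates (R : realType) (n : nat) (g : 'rV[R]_n -> R)
    (x y z : 'rV[R]_n) (r : R) :
  (forall w, `|w - x| < r ->
     forall i : 'I_n, derivable g w (delta_mx 0 i)) ->
  `|y - x| < r -> `|z - x| < r ->
  exists xi : 'I_n -> 'rV[R]_n,
    (forall i, `|xi i - x| < r /\ `|xi i - y| <= `|z - y|) /\
    g z - g y = \sum_i 'D_(delta_mx 0 i) g (xi i) * (z - y) 0 i.
Proof.
move=> Hd yx zx.
pose w k : 'rV[R]_n := \row_i (if (i < k)%N then z 0 i else y 0 i).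
have wstep (i : 'I_n) s : (w i + s *: delta_mx 0 i) =
    \row_j (if j == i then y 0 i + s else w i 0 j).
  apply/rowP => j; rewrite !mxE /=.
  by have [->|_] := eqVneq j i; rewrite ?ltnn ?mulr1 ?mulr0 ?addr0.
have between (i : 'I_n) s : `|s| <= `|(z - y) 0 i| -> 0 <= s * (z - y) 0 i ->
    `|(w i + s *: delta_mx 0 i) - x| < r /\
    `|(w i + s *: delta_mx 0 i) - y| <= `|z - y|.
  move=> h1 h2; rewrite wstep; split.
    apply: le_lt_trans (_ : Num.max `|y - x| `|z - x| < r); last first.
      by rewrite gt_max yx zx.
    apply: rV_norm_le => [|j]; first by rewrite le_max normr_ge0.
    have := rV_coord_le (y - x) j; have := rV_coord_le (z - x) j.
    rewrite !mxE.
    have m1 : `|z - x| <= Num.max `|y - x| `|z - x| by rewrite le_max lexx orbT.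
    have m2 : `|y - x| <= Num.max `|y - x| `|z - x| by rewrite le_max lexx.
    have [ji|_] := eqVneq j i; last first.
      by case: ifP => _ a b; [exact: le_trans a m1|exact: le_trans b m2].
    rewrite ji => a b.
    apply: shift_between (le_trans b m2) (le_trans a m1) _ _.
      by move: h1; rewrite !mxE.
    by move: h2; rewrite !mxE.
  apply: rV_norm_le => // j.
  have := rV_coord_le (z - y) j; rewrite !mxE.
  have [ji|_] := eqVneq j i; last by case: ifP; rewrite ?subrr ?normr0.
  rewrite ji => a; have -> : y 0 i + s - y 0 i = s by ring.
  by apply: le_trans h1 _; rewrite !mxE.
have key (i : 'I_n) : exists xi, (`|xi - x| < r /\ `|xi - y| <= `|z - y|) /\
   g (w i.+1) - g (w i) = 'D_(delta_mx 0 i) g xi * (z - y) 0 i.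
  have [s h1 h2|s [h1 h2 E]] :=
      @mvt_line R n g (w i) (delta_mx 0 i) ((z - y) 0 i).
    by apply: Hd; have [] := between i s h1 h2.
  exists (w i + s *: delta_mx 0 i); split; first exact: between.
  rewrite -E; congr (g _ - _); rewrite wstep; apply/rowP => j; rewrite !mxE.
  have [->|ji] := eqVneq j i; first by rewrite ltnSn; ring.
  by rewrite ltnS leq_eqVlt -[_ == _ :> nat]/(j == i) (negbTE ji).
have [xi Hxi] := boolp.choice key.
exists xi; split; first by move=> i; have [] := Hxi i.
rewrite -(eq_bigr _ (fun i _ => (Hxi i).2)).
have -> : z = w n by apply/rowP => i; rewrite mxE ltn_ord.
have -> : y = w 0 by apply/rowP => i; rewrite mxE.
by rewrite -(telescope_sumr (g \o w) (leq0n n)) big_mkord.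
Qed.

Lemma near_normP (R : realType) (V : normedModType R) (x : V) (P : V -> Prop) :
  (\forall y \near x, P y) <->
  exists2 d, 0 < d & forall y, `|y - x| < d -> P y.
Proof.
split=> [/nbhs_normP[d /= d0 H]|[d d0 H]].
  by exists d => // y yd; apply: H; rewrite /ball_ /= distrC.
by apply/nbhs_normP; exists d => // y; rewrite /ball_ /= distrC; exact: H.
Qed.

Lemma ler_single_sum (R : numDomainType) (I : finType) (F : I -> R) (i : I) :
  (forall j, 0 <= F j) -> F i <= \sum_j F j.
Proof. by move=> F0; rewrite (bigD1 i)//= lerDl sumr_ge0. Qed.

Lemma dotv_norm (R : realType) (n : nat) (a d : 'rV[R]_n) :
  `|dotv a d| <= n%:R * `|a| * `|d|.
Proof.
rewrite /dotv; apply: le_trans (ler_norm_sum _ _ _) _.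
apply: (@le_trans _ _ (\sum_(i < n) `|a| * `|d|)).
  by apply: ler_sum => i _; rewrite normrM ler_pM// rV_coord_le.
by rewrite sumr_const card_ord -[leLHS]mulr_natl mulrA.
Qed.

Lemma dotvC (R : realType) (n : nat) (a b : 'rV[R]_n) : dotv a b = dotv b a.
Proof. by apply: eq_bigr => i _; rewrite mulrC. Qed.

Lemma dotvDr (R : realType) (n : nat) (a x y : 'rV[R]_n) :
  dotv a (x + y) = dotv a x + dotv a y.
Proof. by rewrite -big_split; apply: eq_bigr => i _; rewrite !mxE mulrDr. Qed.

Lemma dotvZr (R : realType) (n : nat) (a x : 'rV[R]_n) (c : R) :
  dotv a (c *: x) = c * dotv a x.
Proof. by rewrite /dotv mulr_sumr; apply: eq_bigr => i _; rewrite !mxE; ring. Qed.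

Lemma dotvNr (R : realType) (n : nat) (a x : 'rV[R]_n) :
  dotv a (- x) = - dotv a x.
Proof. by rewrite -scaleN1r dotvZr mulN1r. Qed.

Lemma dotvDl (R : realType) (n : nat) (a x y : 'rV[R]_n) :
  dotv (x + y) a = dotv x a + dotv y a.
Proof. by rewrite !(dotvC _ a) dotvDr. Qed.

Lemma dotvZl (R : realType) (n : nat) (a x : 'rV[R]_n) (c : R) :
  dotv (c *: x) a = c * dotv x a.
Proof. by rewrite !(dotvC _ a) dotvZr. Qed.

Lemma dotvNl (R : realType) (n : nat) (a x : 'rV[R]_n) :
  dotv (- x) a = - dotv x a.
Proof. by rewrite !(dotvC _ a) dotvNr. Qed.

Lemma dotv_ge0 (R : realType) (n : nat) (x : 'rV[R]_n) : 0 <= dotv x x.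
Proof. by apply: sumr_ge0 => i _; rewrite -expr2 sqr_ge0. Qed.

Lemma dotv_eq0 (R : realType) (n : nat) (x : 'rV[R]_n) :
  (dotv x x == 0) = (x == 0).
Proof.
apply/idP/eqP => [|->]; last first.
  by rewrite /dotv big1 // => i _; rewrite mxE mul0r.
rewrite psumr_eq0 => [/allP H|i _]; last by rewrite -expr2 sqr_ge0.
apply/rowP => i; rewrite mxE; apply/eqP.
by have := H i; rewrite mem_index_enum mulf_eq0 orbb => /(_ isT).
Qed.

Lemma dotv_gt0 (R : realType) (n : nat) (x : 'rV[R]_n) :
  x != 0 -> 0 < dotv x x.
Proof. by move=> x0; rewrite lt_neqAle dotv_ge0 eq_sym dotv_eq0 x0. Qed.

(* All that is used of the smoothness of g near x, with G its gradient. *)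
Definition quadratic_near (R : realType) (n : nat) (g : 'rV[R]_n -> R)
    (G : 'rV[R]_n -> 'rV[R]_n) (x : 'rV[R]_n) (d L : R) : Prop :=
  [/\ 0 < d, 0 <= L,
      forall y z, `|y - x| < d -> `|z - x| < d ->
        `|g z - g y - dotv (G y) (z - y)| <= L * `|z - y| ^+ 2 &
      forall y z u, `|y - x| < d -> `|z - x| < d ->
        `|dotv (G z) u - dotv (G y) u| <= L * `|z - y| * `|u|].

Lemma smooth_quadratic (R : realType) (n : nat) (U : set 'rV[R]_n)
    (g : 'rV[R]_n -> R) (x : 'rV[R]_n) :
  open U -> smooth_on U g -> U x ->
  exists d L, quadratic_near g (grad g) x d L /\ forall y, `|y - x| < d -> U y.
Proof.
move=> oU sg Ux.
have /= [cg sg2] := sg 2%N.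
pose e i : 'rV[R]_n := delta_mx 0 i.
(* The added 1 makes [C] strictly larger than every second partial derivative at [x], which persists
   near [x] by continuity. *)
pose C : R := 1 + \sum_i \sum_j `|'D_(e j) ('D_(e i) g) x|.
have C0 : 0 <= C.
  by rewrite addr_ge0// sumr_ge0// => i _; rewrite sumr_ge0.
have : \forall y \near x, U y /\
    forall i j, `|'D_(e j) ('D_(e i) g) y| < C.
  have nU : \forall y \near x, U y by apply: open_nbhs_nbhs; split.
  have nC : \forall y \near x,
      forall ij : 'I_n * 'I_n, `|'D_(e ij.2) ('D_(e ij.1) g) y| < C.
    have := @filter_forall _ _ (fun ij y => `|'D_(e ij.2) ('D_(e ij.1) g) y| < C) (nbhs x) _.
    apply => -[i j] /=.
    have [_ [_ /(_ j)[_ [cc _]]]] := sg2 i.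
    apply: (cvgr_norm_lt _ (cc _ Ux)).
    apply: (@le_lt_trans _ _ (\sum_i \sum_j `|'D_(e j) ('D_(e i) g) x|)).
      pose F i j := `|'D_(e j) ('D_(e i) g) x|.
      apply: (@le_trans _ _ (\sum_j F i j)).
        by apply: (@ler_single_sum R _ (F i) j) => ?; exact: normr_ge0.
      apply: (@ler_single_sum R _ (fun i => \sum_j F i j) i) => ?.
      by apply: sumr_ge0 => ? _; exact: normr_ge0.
    by rewrite /C ltrDr.
  by apply: filterS2 nU nC => y Uy H; split=> // i j; exact: (H (i, j)).
move=> /near_normP[d d0 Hd].
(* Each partial derivative has Lipschitz constant [n * C]; the other factor [n] comes from summing
   over the coordinates. *)
pose L := n%:R * (n%:R * C).
have L0 : 0 <= L by rewrite !mulr_ge0.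
have lipD i y z : `|y - x| < d -> `|z - x| < d ->
    `|'D_(e i) g z - 'D_(e i) g y| <= n%:R * C * `|z - y|.
  move=> yd zd.
  have [|xi [xiP ->]] := @mvt_coordinates R n ('D_(e i) g) x y z d _ yd zd.
    move=> w /Hd[Uw _] j.
    by have [_ [_ /(_ j)[+ _]]] := sg2 i; apply.
  apply: le_trans (ler_norm_sum _ _ _) _.
  apply: (@le_trans _ _ (\sum_(i < n) C * `|z - y|)).
    apply: ler_sum => j _; rewrite normrM ler_pM ?rV_coord_le// ltW//.
    have [[xid _]] := xiP j.
    by have [_] := Hd _ xid; apply.
  by rewrite sumr_const card_ord -[leLHS]mulr_natl mulrA.
exists d, L; split; last by move=> y /Hd[].
split=> //.
- move=> y z yd zd.
  have [|xi [xiP ->]] := @mvt_coordinates R n g x y z d _ yd zd.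
    move=> w /Hd[Uw _] j.
    by have [+ _] := sg2 j; apply.
  rewrite /dotv -sumrB.
  apply: le_trans (ler_norm_sum _ _ _) _.
  apply: (@le_trans _ _ (\sum_(i < n) (n%:R * C) * `|z - y| ^+ 2)).
    apply: ler_sum => j _.
    have -> : grad g y 0 j = 'D_(e j) g y by rewrite mxE.
    rewrite -mulrBl normrM expr2 mulrA.
    apply: ler_pM; rewrite ?rV_coord_le//.
    have [xid xiy] := xiP j.
    apply: le_trans (lipD _ _ _ yd xid) _.
    by rewrite ler_wpM2l// mulr_ge0.
  by rewrite sumr_const card_ord -[leLHS]mulr_natl /L !mulrA.
- move=> y z u yd zd.
  rewrite /dotv -sumrB.
  apply: le_trans (ler_norm_sum _ _ _) _.
  apply: (@le_trans _ _ (\sum_(i < n) (n%:R * C) * `|z - y| * `|u|)).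
    apply: ler_sum => j _.
    have E w : grad g w 0 j = 'D_(e j) g w by rewrite mxE.
    rewrite !E -mulrBl normrM.
    by rewrite ler_pM ?rV_coord_le// lipD.
  by rewrite sumr_const card_ord -[leLHS]mulr_natl /L !mulrA.
Qed.

Lemma quadratic_opp (R : realType) (n : nat) (g : 'rV[R]_n -> R) G x d L :
  quadratic_near g G x d L -> quadratic_near (fun y => - g y) (fun y => - G y) x d L.
Proof.
move=> [d0 L0 H1 H2]; split=> //.
- move=> y z yd zd; rewrite dotvNl.
  have -> : - g z - - g y - - dotv (G y) (z - y) =
    - (g z - g y - dotv (G y) (z - y)) by ring.
  by rewrite normrN; exact: H1.
- move=> y z u yd zd; rewrite !dotvNl -opprD normrN; exact: H2.
Qed.

Lemma quadratic_lipschitz (R : realType) (n : nat) (g : 'rV[R]_n -> R) G x d L :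
  quadratic_near g G x d L ->
  exists2 K, 0 <= K & forall y z, `|y - x| < d -> `|z - x| < d ->
    `|g z - g y| <= K * `|z - y|.
Proof.
move=> [d0 L0 H1 H2].
exists (n%:R * `|G x| + L * d + L * (d + d)).
  by rewrite !addr_ge0// !mulr_ge0// ?addr_ge0// ltW.
move=> y z yd zd.
have zy : `|z - y| <= d + d.
  have -> : z - y = (z - x) - (y - x) by rewrite opprB addrA subrK.
  by apply: le_trans (ler_normB _ _) _; rewrite lerD// ltW.
have xd : `|x - x| < d by rewrite subrr normr0.
have A := H1 _ _ yd zd.
have B := H2 _ _ (z - y) xd yd.
have D := dotv_norm (G x) (z - y).
have E : L * `|z - y| ^+ 2 <= L * (d + d) * `|z - y|.
  by rewrite expr2 mulrA ler_wpM2r// ler_wpM2l.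
have F : L * `|y - x| * `|z - y| <= L * d * `|z - y|.
  by rewrite ler_wpM2r// ler_wpM2l// ltW.
have T1 : `|g z - g y| <= `|g z - g y - dotv (G y) (z - y)|
    + (`|dotv (G y) (z - y) - dotv (G x) (z - y)| + `|dotv (G x) (z - y)|).
  rewrite -[X in `|X| <= _](subrK (dotv (G y) (z - y))).
  apply: le_trans (ler_normD _ _) _; rewrite lerD2l.
  rewrite -[X in `|X| <= _](subrK (dotv (G x) (z - y))).
  exact: ler_normD.
apply: le_trans T1 _; rewrite !mulrDl; lra.
Qed.

Lemma quadratic_sub (R : realType) (n : nat) (g : 'rV[R]_n -> R) G x d L y e :
  quadratic_near g G x d L -> 0 < e -> `|y - x| + e <= d ->
  quadratic_near g G y e L.
Proof.
move=> [d0 L0 H1 H2] e0 yxe.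
have S z : `|z - y| < e -> `|z - x| < d.
  move=> zy; rewrite -(subrK y z) -addrA.
  by apply: le_lt_trans (ler_normD _ _) _; lra.
by split=> // [w z /S a /S b|w z u /S a /S b]; [exact: H1|exact: H2].
Qed.

(** Fermat's rule from the quadratic bound alone: if the slope is [c], the step [- c * t] changes
    [g] by at most [- c ^+ 2 * t] up to an error of order [c ^+ 2 * t ^+ 2], which is negative for
    small [t] unless [c = 0]. *)
Lemma quadratic_min (R : realType) (n : nat) (g : 'rV[R]_n -> R) G x d L u :
  quadratic_near g G x d L ->
  (exists2 h, 0 < h & forall s, `|s| < h -> g x <= g (x + s *: u)) ->
  dotv (G x) u = 0.
Proof.
move=> [d0 L0 H _] [h h0 Hs].
apply/eqP/negP => /negP c0; set c := dotv (G x) u in c0.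
(* [M] dominates every quantity to be made small: a bound on [t * M] keeps the step within [d] and
   [h] and the quadratic error below the linear gain. *)
pose M := `|c| * (1 + `|u|) + L * `|u| ^+ 2 + 1.
have M0 : 0 < M by rewrite ltr_wpDl// addr_ge0// mulr_ge0// ?addr_ge0.
pose t := Num.min d (Num.min h 1) / M / 2.
have m0 : 0 < Num.min d (Num.min h 1) by rewrite !lt_min d0 h0 ltr01.
have t0 : 0 < t by rewrite !divr_gt0.
have tM : t * M <= Num.min d (Num.min h 1) / 2.
  by rewrite /t mulrAC divfK// gt_eqF.
have [md mh m1] : [/\ Num.min d (Num.min h 1) <= d,
    Num.min d (Num.min h 1) <= h & Num.min d (Num.min h 1) <= 1].
  by rewrite !ge_min !lexx !orbT.
have tu : `|- c * t| * `|u| < d.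
  rewrite mulNr normrN normrM (gtr0_norm t0).
  apply: le_lt_trans (_ : t * M < d); last by lra.
  rewrite mulrAC mulrC ler_wpM2l ?ltW// /M.
  have : 0 <= `|c| by []; have : 0 <= L * `|u| ^+ 2 by rewrite mulr_ge0.
  by lra.
have th : `|- c * t| < h.
  rewrite mulNr normrN normrM (gtr0_norm t0).
  apply: le_lt_trans (_ : t * M < h); last by lra.
  rewrite mulrC ler_wpM2l ?ltW// /M.
  have : 0 <= `|c| * `|u| by rewrite mulr_ge0.
  have : 0 <= L * `|u| ^+ 2 by rewrite mulr_ge0.
  by lra.
have := Hs _ th.
have := H x (x + (- c * t) *: u).
have E : x + (- c * t) *: u - x = (- c * t) *: u by rewrite addrAC subrr add0r.
rewrite E subrr normr0 normrZ => /(_ d0 tu).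
rewrite dotvZr -/c ler_norml => /andP[_ +] le1.
rewrite exprMn real_normK ?num_real// => le2.
have : c ^+ 2 * (t * (1 - t * (L * `|u| ^+ 2))) <= 0.
  have -> : c ^+ 2 * (t * (1 - t * (L * `|u| ^+ 2))) =
     - ((- c * t * c) + L * ((- c * t) ^+ 2 * `|u| ^+ 2)) by ring.
  by rewrite oppr_le0; lra.
apply/negP; rewrite -ltNge mulr_gt0 ?exprn_even_gt0//= mulr_gt0// subr_gt0.
apply: le_lt_trans (_ : t * M < 1); last by lra.
rewrite ler_wpM2l ?ltW// /M.
have : 0 <= `|c| * `|u| by rewrite mulr_ge0.
have : 0 <= `|c| by [].
by lra.
Qed.

Lemma quadratic_mono (R : realType) (n : nat) (g : 'rV[R]_n -> R) G x d L b :
  quadratic_near g G x d L -> 0 < dotv (G x) b ->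
  exists2 e, 0 < e <= d & forall y s, `|y - x| < e ->
    dotv (G x) b / 2 <= dotv (G y) b /\
    (0 < s -> `|y + s *: b - x| < e -> g y < g (y + s *: b)).
Proof.
move=> [d0 L0 H1 H2]; set m := dotv (G x) b => m0.
(* Two points of the [e]-ball are at most [2 * e] apart, so with [e <= m / K] the quadratic error is
   at most [s * (m / 4)], half of the linear gain [s * (m / 2)]. *)
pose K := 8 * L * `|b| + 1.
have K0 : 0 < K by rewrite ltr_wpDl// !mulr_ge0.
pose e := Num.min d (m / K).
have [ed em] : e <= d /\ e <= m / K by rewrite !ge_min !lexx !orbT.
have e0 : 0 < e by rewrite lt_min d0 divr_gt0.
have eK : 8 * L * `|b| * e <= m.
  move: em; rewrite ler_pdivlMr// => em; apply: le_trans em.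
  rewrite mulrC ler_wpM2l ?(ltW e0)// /K; lra.
exists e; first by rewrite e0.
have xd : `|x - x| < d by rewrite subrr normr0.
move=> y s ye; have yd := lt_le_trans ye ed.
have h : m / 2 <= dotv (G y) b.
  have := H2 _ _ b xd yd; rewrite -/m ler_norml => /andP[+ _].
  have : L * `|y - x| * `|b| <= L * e * `|b|.
    by rewrite ler_wpM2r// ler_wpM2l// ltW.
  lra.
split=> // s0 ze; have zd := lt_le_trans ze ed.
have := H1 _ _ yd zd.
have E : y + s *: b - y = s *: b by rewrite addrAC subrr add0r.
rewrite E dotvZr normrZ (gtr0_norm s0) ler_norml => /andP[+ _].
have sb : s * `|b| <= 2 * e.
  rewrite -[s * _](_ : `|y + s *: b - y| = _); last first.
    by rewrite E normrZ gtr0_norm.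
  have -> : y + s *: b - y = (y + s *: b - x) - (y - x).
    by rewrite opprB addrA subrK.
  by apply: le_trans (ler_normB _ _) _; lra.
have : L * (s * `|b|) ^+ 2 <= s * (m / 4).
  have -> : L * (s * `|b|) ^+ 2 = s * (L * `|b| * (s * `|b|)) by ring.
  rewrite ler_pM2l//.
  apply: (@le_trans _ _ (L * `|b| * (2 * e))); last by lra.
  by rewrite ler_wpM2l// mulr_ge0.
have : s * (m / 2) <= s * dotv (G y) b by rewrite ler_pM2l.
have : 0 < s * m by rewrite mulr_gt0.
lra.
Qed.

(** * Lines touching a level set *)

Definition plane_pt (R : realType) (n : nat) (x u b : 'rV[R]_n) (p q : R) :
  'rV[R]_n := x + p *: u + q *: b.

Lemma plane_pt_dist (R : realType) (n : nat) (x u b : 'rV[R]_n) p q p' q' :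
  `|plane_pt x u b p q - plane_pt x u b p' q'| <=
  `|p - p'| * `|u| + `|q - q'| * `|b|.
Proof.
have -> : plane_pt x u b p q - plane_pt x u b p' q' =
    (p - p') *: u + (q - q') *: b.
  by rewrite /plane_pt; apply/rowP => i; rewrite !mxE; ring.
by rewrite -!normrZ ler_normD.
Qed.

Lemma plane_pt_base (R : realType) (n : nat) (x u b : 'rV[R]_n) p q :
  `|plane_pt x u b p q - x| <= `|p| * `|u| + `|q| * `|b|.
Proof.
have := plane_pt_dist x u b p q 0 0.
by rewrite !subr0 [X in _ - X]/plane_pt !scale0r !addr0.
Qed.

Lemma plane_pt_shift (R : realType) (n : nat) (x u b : 'rV[R]_n) p q s k :
  plane_pt x u b (p + s) (q + k * s) = plane_pt x u b p q + s *: (u + k *: b).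
Proof.
rewrite /plane_pt; apply/rowP => i; rewrite !mxE; ring.
Qed.

(** A linear functional attains its maximum on a compact set. Compactness of [K] is spelled out in
    real coordinates, as containment in the box together with openness of the complement, so that
    callers handle pairs of reals only. *)
Lemma box_argmax (R : realType) (r h k : R) (K : R -> R -> Prop) :
  (forall p q, K p q -> `|p| <= r /\ `|q| <= h) ->
  (forall p q, `|p| <= r -> `|q| <= h -> ~ K p q -> exists2 e, 0 < e &
     forall p' q', `|p' - p| < e -> `|q' - q| < e -> ~ K p' q') ->
  (exists p q, K p q) ->
  exists p q, K p q /\ forall p' q', K p' q' -> q' - k * p' <= q - k * p.
Proof.
move=> Kbox Kcl [p0 [q0 K0]].
pose A : set 'rV[R]_2 := [set z | K (z 0 0) (z 0 1)].
pose box : set 'rV[R]_2 := [set z | forall i : 'I_2,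
   (if i == 0 then `[- r, r]%classic else `[- h, h]%classic) (z ord0 i)].
have boxP z : box z <-> `|z 0 0| <= r /\ `|z 0 1| <= h.
  split=> [H|[H1 H2] i].
    have := H 0; have := H 1; rewrite /= !in_itv /= !ler_norml => -> ->.
    by [].
  case: ifPn => [/eqP ->|i0]; first by rewrite /= in_itv /= -ler_norml.
  have -> : i = 1 by apply/val_inj; case: i i0 => -[|[|[]]].
  by rewrite /= in_itv /= -ler_norml.
have cbox : compact box.
  apply: (@rV_compact R 2 (fun i => if i == 0 then `[- r, r]%classic
     else `[- h, h]%classic)) => i.
  by case: ifP => _; exact: segment_compact.
have clA : closed A.
  move=> z zA.
  have bz : box z.
    have : closed box by apply: compact_closed => //; exact: norm_hausdorff.
    apply; move: zA; apply: closureS => w Aw.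
    by apply/boxP; exact: Kbox Aw.
  apply: contrapT => nA; have [b1 b2] := (boxP z).1 bz.
  have [e e0 He] := Kcl _ _ b1 b2 nA.
  have [w [Aw]] := zA (ball z e) (nbhsx_ballx z e e0).
  rewrite -ball_normE /ball_ /= distrC => zw.
  have H i : `|w 0 i - z 0 i| < e.
    have := rV_coord_le (w - z) i; rewrite !mxE => h1.
    exact: le_lt_trans h1 zw.
  exact: He (H 0) (H 1) Aw.
have cA : compact A.
  by apply: subclosed_compact cbox _ => // z /Kbox ?; apply/boxP.
pose f (z : 'rV[R]_2) := z 0 1 - k * z 0 0.
have ci i : continuous (fun z : 'rV[R]_2 => z 0 i) by exact: coord_continuous.
have cf : continuous f.
  move=> z; apply: (@continuousB _ _ _ (fun z : 'rV[R]_2 => z 0 1)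
    (fun z : 'rV[R]_2 => k * z 0 0) z (ci 1 z)).
  exact: cvgM (cvg_cst k) (ci 0 z).
have [|c /set_mem Ac Hc] := @EVT_max_rV R 2 f A _ cA (continuous_subspaceT cf).
  exists (\row_i if i == 0 then p0 else q0).
  by rewrite /A /= !mxE.
exists (c 0 0), (c 0 1); split => // p' q' K'.
have := Hc (\row_i if i == 0 then p' else q').
by rewrite /f !mxE /= => ->//; rewrite inE /A /= !mxE.
Qed.

(* The contact point maximises q - k p over the part of {g <= 0} in the box; the *)
(* hypotheses keep it off the sides of the box.                                  *)
Lemma touch (R : realType) (n : nat) (g : 'rV[R]_n -> R) G x d L u b r h k c :
  quadratic_near g G x d L ->
  r * `|u| + h * `|b| < d ->
  (forall p, `|p| <= r -> 0 < g (plane_pt x u b p h)) ->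
  (exists p q, [/\ `|p| <= r, `|q| <= h, g (plane_pt x u b p q) <= 0
    & c <= q - k * p]) ->
  (forall p q, `|p| = r -> `|q| <= h -> g (plane_pt x u b p q) <= 0 ->
    q - k * p < c) ->
  (forall p, `|p| <= r -> - h - k * p < c) ->
  exists p q, [/\ `|p| < r, `|q| < h, c <= q - k * p,
    (forall p' q', `|p'| <= r -> `|q'| <= h -> g (plane_pt x u b p' q') <= 0 ->
      q' - k * p' <= q - k * p) &
    [/\ g (plane_pt x u b p q) = 0,
    dotv (G (plane_pt x u b p q)) (u + k *: b) = 0 &
    exists2 e, 0 < e & forall s, `|s| < e ->
      0 <= g (plane_pt x u b p q + s *: (u + k *: b))]].
Proof.
move=> qg rh top [p0 [q0 [p0r q0h g0 c0]]] sides bottom.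
have inb p q : `|p| <= r -> `|q| <= h -> `|plane_pt x u b p q - x| < d.
  move=> pr qh; apply: le_lt_trans (plane_pt_base _ _ _ _ _) _.
  apply: le_lt_trans rh.
  by apply: lerD; rewrite ler_wpM2r.
have [Kl Kl0 lip] := quadratic_lipschitz qg.
pose K p q := [/\ `|p| <= r, `|q| <= h & g (plane_pt x u b p q) <= 0].
have near_pos p q : `|p| <= r -> `|q| <= h -> forall y,
    0 < `|g (plane_pt x u b p q) - y| ->
    exists2 e, 0 < e &
     forall p' q', `|p' - p| < e -> `|q' - q| < e ->
       `|p'| <= r -> `|q'| <= h ->
       `|g (plane_pt x u b p' q') - g (plane_pt x u b p q)|
          < `|g (plane_pt x u b p q) - y|.
  move=> pr qh y gt0.
  pose M := Kl * (`|u| + `|b|) + 1.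
  have M0 : 0 < M by rewrite ltr_wpDl// mulr_ge0// addr_ge0.
  exists (`|g (plane_pt x u b p q) - y| / M); first by rewrite divr_gt0.
  move=> p' q' pp qq pr' qh'.
  apply: le_lt_trans (lip _ _ (inb _ _ pr qh) (inb _ _ pr' qh')) _.
  apply: le_lt_trans (ler_wpM2l Kl0 (plane_pt_dist _ _ _ _ _ _ _)) _.
  set a := `|g _ - y| in gt0 pp qq *.
  apply: le_lt_trans (_ : a / M * (Kl * (`|u| + `|b|)) < a).
    rewrite mulrCA ler_wpM2l// mulrDr.
    by apply: lerD; rewrite ler_wpM2r// ltW.
  rewrite mulrAC ltr_pdivrMr// ltr_pM2l// /M ltrDl//.
have [|p q pr qh nK||p [q [[pr qh gpq] mx]]] := @box_argmax R r h k K.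
- by move=> p q [].
- have gt0 : 0 < g (plane_pt x u b p q) by rewrite ltNge; apply/negP => le; apply: nK.
  have [|e e0 He] := near_pos p q pr qh 0; first by rewrite subr0 normr_gt0 gt_eqF.
  exists e => // p' q' pp qq [pr' qh' le].
  have := He p' q' pp qq pr' qh'.
  by rewrite subr0 (gtr0_norm gt0) ltr_norml => /andP[]; lra.
- by exists p0, q0; split.
have cpq : c <= q - k * p by apply: le_trans c0 _; apply: mx.
have pr1 : `|p| < r.
  rewrite lt_neqAle pr andbT; apply/eqP => pE.
  by have := sides p q pE qh gpq; rewrite ltNge cpq.
have qh1 : `|q| < h.
  rewrite ltr_norml; apply/andP; split.
    by have := bottom p pr; lra.
  rewrite lt_neqAle; apply/andP; split; last by move: qh; rewrite ler_norml => /andP[].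
  by apply/eqP => qE; have := top p pr; rewrite -qE ltNge gpq.
pose e1 := Num.min (r - `|p|) ((h - `|q|) / (1 + `|k|)).
have k1 : 0 < 1 + `|k| by rewrite ltr_wpDr.
have e10 : 0 < e1 by rewrite lt_min subr_gt0 pr1 divr_gt0// subr_gt0.
have line s : `|s| < e1 -> `|p + s| < r /\ `|q + k * s| < h.
  rewrite lt_min => /andP[s1 s2]; split.
    by apply: le_lt_trans (ler_normD _ _) _; lra.
  apply: le_lt_trans (ler_normD _ _) _; rewrite normrM.
  move: s2; rewrite ltr_pdivlMr// mulrDr mulr1 mulrC.
  by have : 0 <= `|s| by []; lra.
(* A point of the line with [g < 0] could be pushed a little in the direction [b] while [g] stays
   negative, and would beat the maximum. *)
have pos s : `|s| < e1 -> 0 <= g (plane_pt x u b p q + s *: (u + k *: b)).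
  move=> /line[h1 h2]; rewrite -plane_pt_shift leNgt; apply/negP => neg.
  have [|e e0 He] := near_pos _ _ (ltW h1) (ltW h2) 0.
    by rewrite subr0 normr_gt0 lt_eqF.
  pose e' := Num.min e (h - `|q + k * s|) / 2.
  have e'0 : 0 < e' by rewrite divr_gt0// lt_min e0 subr_gt0.
  have [m1 m2] : Num.min e (h - `|q + k * s|) <= e /\
     Num.min e (h - `|q + k * s|) <= h - `|q + k * s|.
    by rewrite !ge_min !lexx orbT.
  have q2 : `|q + k * s + e'| <= h.
    apply: le_trans (ler_normD _ _) _; rewrite (gtr0_norm e'0) /e'.
    by rewrite /e' in e'0; lra.
  have := He (p + s) (q + k * s + e').
  rewrite subrr normr0 addrAC subrr add0r (gtr0_norm e'0) subr0 => /(_ e0).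
  have -> : e' < e by rewrite /e' in e'0 *; lra.
  move=> /(_ isT (ltW h1) q2); rewrite (ltr0_norm neg) ltr_norml => /andP[_ gl].
  have := mx (p + s) (q + k * s + e'); rewrite /K => mx'.
  have : q + k * s + e' - k * (p + s) <= q - k * p.
    by apply: mx'; split=> //; [exact: ltW|lra].
  lra.
have g00 : g (plane_pt x u b p q) = 0.
  apply/eqP; rewrite eq_le gpq /=.
  by have := pos 0; rewrite normr0 scale0r addr0; apply.
have db : `|plane_pt x u b p q - x| < d by apply: inb; exact: ltW.
exists p, q; split=> // [p' q' pr' qh' le|]; first by apply: mx; split.
split=> //.
  apply: (@quadratic_min R n g G _ (d - `|plane_pt x u b p q - x|) L).
    by apply: quadratic_sub qg _ _; rewrite ?subr_gt0//; lra.
  by exists e1 => // s s1; rewrite g00 pos.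
by exists e1.
Qed.

Lemma eq_imp_le (R : numDomainType) (x y : R) : x = y -> x <= y.
Proof. by move=> ->. Qed.

Lemma quadratic_continuous (R : realType) (n : nat) (g : 'rV[R]_n -> R) G x d L y :
  quadratic_near g G x d L -> `|y - x| < d -> {for y, continuous g}.
Proof.
move=> qg yd; have [K K0 lip] := quadratic_lipschitz qg.
apply/(@cvgrPdist_lt _ _ _ (nbhs y) _ g) => e e0; apply: (near_normP (y : 'rV[R]_n) _).2.
exists (Num.min (d - `|y - x|) (e / (K + 1))).
  by rewrite lt_min subr_gt0 yd divr_gt0// ltr_wpDl.
move=> z; rewrite lt_min => /andP[zd ze].
have zx : `|z - x| < d.
  rewrite -(subrK y z) -addrA.
  by apply: le_lt_trans (ler_normD _ _) _; lra.
rewrite distrC; apply: le_lt_trans (lip _ _ yd zx) _.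
apply: le_lt_trans (_ : (K + 1) * `|z - y| < e).
  by rewrite ler_wpM2r// lerDl.
by rewrite mulrC -ltr_pdivlMr// ltr_wpDl.
Qed.

Lemma line_continuous (R : realType) (n : nat) (y b : 'rV[R]_n) :
  continuous (fun q : R => y + q *: b).
Proof.
move=> q; apply: cvgD; first exact: cvg_cst.
by apply: cvgZr_tmp; exact: cvg_id.
Qed.

(** In such a box the zero set of [g] is the graph of a function of [p], with {g < 0} below it. This
    is the implicit function theorem reduced to monotonicity and signs. *)
Definition graph_box (R : realType) (n : nat) (g : 'rV[R]_n -> R)
    (G : 'rV[R]_n -> 'rV[R]_n) (x u b : 'rV[R]_n) (e r h : R) : Prop :=
  [/\ 0 < r, 0 < h, r * `|u| + h * `|b| < e,
      forall p, `|p| <= r ->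
        0 < g (plane_pt x u b p h) /\ g (plane_pt x u b p (- h)) < 0 &
      forall p q q', `|p| <= r -> - h <= q -> q < q' -> q' <= h ->
        g (plane_pt x u b p q) < g (plane_pt x u b p q')].

(** The height [h] is fixed before the width, so that [r] can still be shrunk against other
    constraints. The signs at the top and bottom hold over [p = 0] and spread to [|p| <= r] by the
    Lipschitz bound. *)
Lemma graph_box_exists (R : realType) (n : nat) (g : 'rV[R]_n -> R)
    G x d L u b e0 :
  quadratic_near g G x d L -> g x = 0 -> 0 < dotv (G x) b -> 0 < e0 ->
  exists2 h, 0 < h & exists2 r1, 0 < r1 & forall r, 0 < r -> r <= r1 ->
    graph_box g G x u b e0 r h.
Proof.
move=> qg gx Gb e00; have [d0 L0 _ _] := qg.
have [e1 /andP[e10 ed] mono] := quadratic_mono qg Gb.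
have [K K0 lip] := quadratic_lipschitz qg.
pose e := Num.min e1 e0.
have [ee1 ee0] : e <= e1 /\ e <= e0 by rewrite !ge_min !lexx orbT.
have epos : 0 < e by rewrite lt_min e10.
pose h := e / (2 * (`|b| + 1)).
have b1 : 0 < `|b| + 1 by rewrite ltr_wpDl.
have hpos : 0 < h by rewrite divr_gt0// mulr_gt0.
have hb : h * `|b| < e / 2.
  have -> : h * `|b| = e / 2 * (`|b| / (`|b| + 1)).
    by rewrite /h; field; rewrite gt_eqF.
  rewrite gtr_pMr ?divr_gt0// ltr_pdivrMr// mul1r ltrDl//.
have inb p q r : 0 < r -> r * `|u| <= e / 2 -> `|p| <= r -> `|q| <= h ->
    `|plane_pt x u b p q - x| < e.
  move=> r0 ru pr qh; apply: le_lt_trans (plane_pt_base _ _ _ _ _) _.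
  have : `|p| * `|u| <= r * `|u| by rewrite ler_wpM2r.
  have : `|q| * `|b| <= h * `|b| by rewrite ler_wpM2r.
  lra.
have xe : `|x - x| < e by rewrite subrr normr0.
have ptx : plane_pt x u b 0 0 = x by rewrite /plane_pt !scale0r !addr0.
have pos : 0 < g (plane_pt x u b 0 h).
  rewrite /plane_pt scale0r addr0 -[X in X < _]gx.
  apply: (mono x h (lt_le_trans xe ee1)).2 => //.
  by rewrite addrAC subrr add0r normrZ gtr0_norm//; lra.
have neg : g (plane_pt x u b 0 (- h)) < 0.
  rewrite /plane_pt scale0r addr0 scaleNr -[X in _ < X]gx.
  rewrite -[X in _ < g X](subrK (h *: b)); apply: (mono (x - h *: b) h _).2 => //.
    by rewrite addrAC subrr sub0r normrN normrZ gtr0_norm//; lra.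
  by rewrite subrK (lt_le_trans xe ee1).
pose A := Num.min (g (plane_pt x u b 0 h)) (- g (plane_pt x u b 0 (- h))).
have A0 : 0 < A by rewrite lt_min pos oppr_gt0.
have [A1 A2] : A <= g (plane_pt x u b 0 h) /\ A <= - g (plane_pt x u b 0 (- h)).
  by rewrite !ge_min !lexx orbT.
pose r1 := Num.min (e / 2 / (`|u| + 1)) (A / (K * `|u| + 1)).
have u1 : 0 < `|u| + 1 by rewrite ltr_wpDl.
have Ku : 0 <= K * `|u| by rewrite mulr_ge0.
have Ku1 : 0 < K * `|u| + 1 by rewrite ltr_wpDl.
exists h => //; exists r1; first by rewrite lt_min !divr_gt0.
move=> r r0; rewrite le_min => /andP[ra rb].
have ru : r * `|u| <= e / 2.
  move: ra; rewrite ler_pdivlMr// mulrDr; lra.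
have rK : K * (r * `|u|) < A.
  by move: rb; rewrite ler_pdivlMr// mulrDr mulr1 mulrCA; lra.
have hn : `|h| <= h by rewrite gtr0_norm.
have hn' : `|- h| <= h by rewrite normrN gtr0_norm.
have n0 : `|0 : R| <= r by rewrite normr0 ltW.
have lipp p q : `|p| <= r -> `|q| <= h ->
   `|g (plane_pt x u b p q) - g (plane_pt x u b 0 q)| < A.
  move=> pr qh; apply: le_lt_trans rK.
  have i1 := lt_le_trans (inb p q r r0 ru pr qh) (le_trans ee1 ed).
  have i2 := lt_le_trans (inb 0 q r r0 ru n0 qh) (le_trans ee1 ed).
  apply: le_trans (lip _ _ i2 i1) _; rewrite ler_wpM2l//.
  apply: le_trans (plane_pt_dist _ _ _ _ _ _ _) _.
  by rewrite !subr0 subrr normr0 mul0r addr0 ler_wpM2r.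
split=> //.
- by lra.
- move=> p pr; split.
    by have := lipp p h pr hn; rewrite ltr_norml => /andP[]; lra.
  by have := lipp p (- h) pr hn'; rewrite ltr_norml => /andP[_]; lra.
- move=> p q q' pr hq qq qh.
  have E : plane_pt x u b p q' = plane_pt x u b p q + (q' - q) *: b.
    by rewrite /plane_pt; apply/rowP => i; rewrite !mxE; ring.
  rewrite E; apply: (mono (plane_pt x u b p q) (q' - q) _).2.
  + apply: lt_le_trans ee1; apply: inb r0 ru pr _.
    by rewrite ler_norml hq (le_trans (ltW qq)).
  + by rewrite subr_gt0.
  + rewrite -E; apply: lt_le_trans ee1; apply: inb r0 ru pr _.
    by rewrite ler_norml qh (le_trans hq (ltW qq)).
Qed.

Lemma norm_convex_lt (R : realFieldType) (a b x y h : R) :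
  0 <= a -> 0 <= b -> a + b = 1 -> `|x| < h -> `|y| < h ->
  `|a * x + b * y| < h.
Proof.
move=> a0 b0 ab; rewrite !ltr_norml => /andP[x1 x2] /andP[y1 y2].
have -> : b = 1 - a by lra.
have [a1|a1] := ltP 0 a.
  have : 0 < a * (h - x) by rewrite mulr_gt0// subr_gt0.
  have : 0 < a * (x + h) by rewrite mulr_gt0//; lra.
  have : 0 <= b * (h - y) by rewrite mulr_ge0//; lra.
  have : 0 <= b * (y + h) by rewrite mulr_ge0//; lra.
  have -> : b = 1 - a by lra.
  by move=> *; apply/andP; split; lra.
have -> : a = 0 by lra.
by apply/andP; split; lra.
Qed.

(* Where the chord of {g = 0} over [-r, r] enters {g < 0}, translating it to its  *)
(* last contact with {g <= 0} gives a line touching {g = 0} from outside.         *)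
Lemma chord_touch (R : realType) (n : nat) (g : 'rV[R]_n -> R)
    G x d L u b e r h qm qp p0 :
  quadratic_near g G x d L -> graph_box g G x u b e r h -> e <= d ->
  `|qm| < h -> `|qp| < h ->
  g (plane_pt x u b (- r) qm) = 0 -> g (plane_pt x u b r qp) = 0 ->
  let k := (qp - qm) / (2 * r) in
  `|p0| < r -> g (plane_pt x u b p0 ((qp + qm) / 2 + k * p0)) < 0 ->
  exists y, [/\ `|y - x| < e, g y = 0 & exists2 eta, 0 < eta &
    forall s, `|s| < eta -> 0 <= g (y + s *: (u + k *: b))].
Proof.
move=> qg [r0 h0 re signs mono] ed qmh qph gm gp k p0r neg.
pose c0 := (qp + qm) / 2.
have kr : k * r = (qp - qm) / 2 by rewrite /k; field; rewrite gt_eqF.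
have chord p : `|p| <= r -> `|c0 + k * p| < h.
  move=> pr; have [l -> l1] : exists2 l, p = r * l & `|l| <= 1.
    exists (p / r); first by rewrite mulrCA divff ?mulr1// gt_eqF.
    by rewrite normrM normfV (gtr0_norm r0) ler_pdivrMr// mul1r.
  rewrite mulrA kr /c0; have -> : (qp + qm) / 2 + (qp - qm) / 2 * l =
    ((1 + l) / 2) * qp + ((1 - l) / 2) * qm by field.
  by move: l1; rewrite ler_norml => /andP[? ?]; apply: norm_convex_lt; lra.
have inb p q : `|p| <= r -> `|q| <= h -> `|plane_pt x u b p q - x| < e.
  move=> pr qh; apply: le_lt_trans (plane_pt_base _ _ _ _ _) _.
  by apply: le_lt_trans re; apply: lerD; rewrite ler_wpM2r.
(* A point strictly above the chord that still lies in {g <= 0}: its height over the chord is the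
   level that [touch] has to reach, out of reach at the sides of the box. *)
have [e1 e10 He1] : exists2 e1, 0 < e1 & c0 + k * p0 + e1 <= h /\
    g (plane_pt x u b p0 (c0 + k * p0 + e1)) <= 0.
  have ch := chord _ (ltW p0r).
  have cg : {for c0 + k * p0, continuous
      (fun q => g (plane_pt x u b p0 q))}.
    apply: continuous_comp; first exact: line_continuous.
    apply: quadratic_continuous qg _.
    by apply: lt_le_trans ed; apply: inb; exact: ltW.
  have : \forall q \near c0 + k * p0, g (plane_pt x u b p0 q) < 0.
    exact: (cvgr_lt _ cg _ neg).
  move=> /near_normP[e1 e10 He1].
  pose f := Num.min e1 (h - (c0 + k * p0)) / 2.
  have [f1 f2] : Num.min e1 (h - (c0 + k * p0)) <= e1 /\
      Num.min e1 (h - (c0 + k * p0)) <= h - (c0 + k * p0).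
    by rewrite !ge_min !lexx orbT.
  have f0 : 0 < f.
    rewrite divr_gt0// lt_min e10 /= subr_gt0.
    by move: ch; rewrite ltr_norml => /andP[].
  exists f => //; split; first by rewrite /f in f0 *; lra.
  apply: ltW; apply: He1.
  rewrite addrAC subrr add0r gtr0_norm//; move: f0; rewrite /f; lra.
have [| | | | |p [q [pr qh _ _ [gq _ H]]]] :=
    @touch R n g G x d L u b r h k (c0 + e1) qg.
- exact: lt_le_trans re ed.
- by move=> p /signs[].
- exists p0, (c0 + k * p0 + e1).
  have [a1 a2] := He1; split=> //; first exact: ltW.
  + have := chord _ (ltW p0r); rewrite ltr_norml => /andP[b1 _].
    by rewrite ler_norml a1 andbT; lra.
  + by lra.
(* Over either side the chord ends on {g = 0}; as [g] increases with [q], nothing of {g <= 0} there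
   lies above the chord. *)
- move=> p q pr qh gq.
  have qE : q <= c0 + k * p.
    rewrite leNgt; apply/negP => lt.
    suff : 0 < g (plane_pt x u b p q) by rewrite ltNge gq.
    have : g (plane_pt x u b p (c0 + k * p)) = 0.
      have [pE|pE] : p = r \/ p = - r.
        by move: pr; case: (leP 0 p) => z; [rewrite ger0_norm//|rewrite ltr0_norm//]
          => <-; [left|right]; rewrite ?opprK.
      - by rewrite pE kr /c0 -gp; congr (g (plane_pt _ _ _ _ _)); field.
      - by rewrite pE mulrN kr /c0 -gm; congr (g (plane_pt _ _ _ _ _)); field.
    move=> <-; apply: mono => //; first by rewrite pr.
      have : `|c0 + k * p| < h by apply: chord; rewrite pr.
      by rewrite ltr_norml => /andP[/ltW].
    by move: qh; rewrite ler_norml => /andP[].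
  by lra.
- move=> p pr; have := chord _ pr; rewrite ltr_norml => /andP[]; lra.
by exists (plane_pt x u b p q); split=> //; apply: inb; exact: ltW.
Qed.

(** The chord of the graph over the box enters {g < 0}, or enters {g > 0}, or lies in {g = 0}. The
    first case is [chord_touch], the second is the same for [- g] upside down, and in the third the
    chord itself serves. [neg] records the side from which the line touches; the contact may still
    be along a segment. *)
Lemma touching_line (R : realType) (n : nat) (g : 'rV[R]_n -> R)
    G x d L u b e :
  quadratic_near g G x d L -> g x = 0 -> 0 < dotv (G x) b ->
  (forall k, u + k *: b != 0) -> 0 < e ->
  exists (y v : 'rV[R]_n) (neg : bool), [/\ `|y - x| < e, v != 0, g y = 0 &
    exists2 eta, 0 < eta &
      forall s, `|s| < eta -> 0 <= (-1) ^+ neg * g (y + s *: v)].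
Proof.
move=> qg gx Gb ind e0; have [d0 _ _ _] := qg.
have [|h h0 [r r0 /(_ r r0 (lexx r)) gb]] :=
    @graph_box_exists R n g G x d L u b (Num.min e d) qg gx Gb.
  by rewrite lt_min e0.
have [ee ed] : Num.min e d <= e /\ Num.min e d <= d by rewrite !ge_min !lexx orbT.
have [_ _ re signs mono] := gb.
have inb p q : `|p| <= r -> `|q| <= h -> `|plane_pt x u b p q - x| < Num.min e d.
  move=> pr qh; apply: le_lt_trans (plane_pt_base _ _ _ _ _) _.
  by apply: le_lt_trans re; apply: lerD; rewrite ler_wpM2r.
have zero p : `|p| <= r -> exists2 q, `|q| < h & g (plane_pt x u b p q) = 0.
  move=> pr; have [g1 g2] := signs p pr.
  have [|||q] := @IVT R (fun q => g (plane_pt x u b p q)) (- h) h 0.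
  - lra.
  - apply: continuous_in_subspaceT => q; rewrite inE /= in_itv /= => qh.
    apply: continuous_comp; first exact: line_continuous.
    apply: quadratic_continuous qg _; apply: lt_le_trans ed.
    by apply: inb => //; rewrite ler_norml.
  - by rewrite ge_min le_max (ltW g1) (ltW g2) orbT.
  rewrite in_itv /= => /andP[q1 q2] gq; exists q => //.
  rewrite ltr_norml !lt_neqAle q1 q2 !andbT; apply/andP; split.
    by apply/eqP => E; move: g2; rewrite E gq ltxx.
  by apply/eqP => E; move: g1; rewrite -E gq ltxx.
have [qp qph gp] := zero r (eq_imp_le (gtr0_norm r0)).
have [qm qmh gm] : exists2 q, `|q| < h & g (plane_pt x u b (- r) q) = 0.
  by apply: zero; rewrite normrN gtr0_norm.
pose k := (qp - qm) / (2 * r).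
pose c0 := (qp + qm) / 2.
have c0h : `|c0| < h.
  move: qph qmh; rewrite /c0 !ltr_norml => /andP[? ?] /andP[? ?].
  by apply/andP; split; lra.
have [[p0 [p0r neg]]|H1] := pselect (exists p0, `|p0| < r /\
    g (plane_pt x u b p0 (c0 + k * p0)) < 0).
  have [y [yx gy H]] := chord_touch qg gb ed qmh qph gm gp p0r neg.
  exists y, (u + k *: b), false; split=> //; first exact: lt_le_trans yx ee.
  by case: H => eta eta0 H; exists eta => // s /H; rewrite mul1r.
have [[p0 [p0r pos]]|H2] := pselect (exists p0, `|p0| < r /\
    0 < g (plane_pt x u b p0 (c0 + k * p0))).
  have ptE p q : plane_pt x u (- b) p q = plane_pt x u b p (- q).
    by rewrite /plane_pt scalerN scaleNr.
  (* Replacing [g] by [- g] and [b] by [- b] turns the box over and keeps the shape of the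
     hypotheses. *)
  have gb' : graph_box (fun y => - g y) (fun y => - G y) x u (- b) (Num.min e d) r h.
    split=> //; first by rewrite normrN.
      by move=> p /signs[a1 a2]; rewrite !ptE opprK oppr_gt0 oppr_lt0.
    by move=> p q q' pr q1 q2 q3; rewrite !ptE ltrN2; apply: mono => //; lra.
  have kE : (- qp - - qm) / (2 * r) = - k by rewrite /k; field; rewrite gt_eqF.
  have [|||||y [yx gy H]] := @chord_touch R n _ _ x d L u (- b) _ r h (- qm) (- qp)
      p0 (quadratic_opp qg) gb' ed _ _ _ _ p0r.
  - by rewrite normrN.
  - by rewrite normrN.
  - by rewrite ptE opprK gm oppr0.
  - by rewrite ptE opprK gp oppr0.
  - rewrite kE ptE oppr_lt0; move: pos; congr (_ < g (plane_pt _ _ _ _ _)).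
    by rewrite /c0; field.
  exists y, (u + k *: b), true; split=> //.
  - exact: lt_le_trans yx ee.
  - by move/eqP: gy; rewrite oppr_eq0 => /eqP.
  - case: H => eta eta0 H; exists eta => // s /H.
    by rewrite kE scalerN scaleNr opprK expr1 mulN1r.
exists (plane_pt x u b 0 c0), (u + k *: b), false.
have line s : `|s| < r -> g (plane_pt x u b 0 c0 + s *: (u + k *: b)) = 0.
  move=> sr; rewrite -plane_pt_shift add0r.
  apply/eqP; rewrite eq_le !leNgt; apply/andP; split; apply/negP => lt.
    by apply: H2; exists s.
  by apply: H1; exists s.
split=> //.
- by apply: lt_le_trans ee; apply: inb; [rewrite normr0 ltW|exact: ltW].
- by have := line 0; rewrite scale0r addr0 normr0; apply.
- by exists r => // s /line ->; rewrite mulr0.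
Qed.

(* C t is the maximum of q - t p over {g <= 0} in a box of half-width r, whence   *)
(* its Lipschitz constant.                                                        *)
Lemma tangent_family (R : realType) (n : nat) (g : 'rV[R]_n -> R)
    G x d L u b rho e0 :
  quadratic_near g G x d L -> g x = 0 -> 0 < dotv (G x) b -> 0 < rho ->
  (forall s, s != 0 -> `|s| <= rho -> 0 < g (x + s *: u)) -> 0 < e0 ->
  exists r tau (C P : R -> R), [/\ 0 < r < e0, 0 < tau, C 0 = 0,
    (forall t t', `|t| < tau -> `|t'| < tau -> `|C t - C t'| <= r * `|t - t'|) &
    forall t, `|t| < tau -> let y := plane_pt x u b (P t) (C t + t * P t) in
      [/\ `|P t| < r, g y = 0 & dotv (G y) (u + t *: b) = 0]].
Proof.
move=> qg gx Gb rho0 pos e00; have [d0 _ _ _] := qg.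
have [h h0 [r1 r10 box]] := @graph_box_exists R n g G x d L u b d qg gx Gb d0.
pose r := Num.min r1 (Num.min rho e0) / 2.
have m0 : 0 < Num.min r1 (Num.min rho e0) by rewrite !lt_min r10 rho0.
have [m1 m2 m3] : [/\ Num.min r1 (Num.min rho e0) <= r1,
  Num.min r1 (Num.min rho e0) <= rho & Num.min r1 (Num.min rho e0) <= e0].
  by rewrite !ge_min !lexx !orbT.
have r0 : 0 < r by rewrite divr_gt0.
have rr1 : r <= r1 by rewrite /r in r0 *; lra.
have rrho : r <= rho by rewrite /r in r0 *; lra.
have re0 : r < e0 by rewrite /r in r0 *; lra.
have [_ _ re signs mono] := box r r0 rr1.
have inb p q : `|p| <= r -> `|q| <= h -> `|plane_pt x u b p q - x| < d.
  move=> pr qh; apply: le_lt_trans (plane_pt_base _ _ _ _ _) _.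
  by apply: le_lt_trans re; apply: lerD; rewrite ler_wpM2r.
have ge0 p : `|p| <= r -> 0 <= g (plane_pt x u b p 0).
  move=> pr; rewrite /plane_pt scale0r addr0.
  have [->|p0] := eqVneq p 0; first by rewrite scale0r addr0 gx.
  by apply: ltW; apply: pos => //; exact: le_trans rrho.
have below p q : `|p| <= r -> `|q| <= h -> g (plane_pt x u b p q) <= 0 -> q <= 0.
  move=> pr qh gq; rewrite leNgt; apply/negP => q0.
  suff : g (plane_pt x u b p 0) < g (plane_pt x u b p q).
    by have := ge0 p pr; lra.
  apply: mono => //; first by lra.
  by move: qh; rewrite ler_norml => /andP[].
(* At the two sides the base line is strictly outside {g <= 0}, so that {g <= 0} lies below it with
   a margin; this is what survives a small change of slope. *)
have side p : `|p| = r -> exists2 m, 0 < m & forall q, `|q| <= h ->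
    g (plane_pt x u b p q) <= 0 -> q < - m.
  move=> pr.
  have gp : 0 < g (plane_pt x u b p 0).
    rewrite /plane_pt scale0r addr0; apply: pos; last by rewrite pr.
    by apply: contra_eq_neq pr => ->; rewrite normr0 lt_eqF.
  have cg : {for 0, continuous (fun q => g (plane_pt x u b p q))}.
    apply: continuous_comp; first exact: line_continuous.
    by apply: quadratic_continuous qg _; apply: inb; rewrite ?pr// normr0 ltW.
  have : \forall q \near (0 : R), 0 < g (plane_pt x u b p q).
    exact: (cvgr_gt _ cg _ gp).
  move=> /near_normP[m m00 Hm].
  exists (m / 2); first by rewrite divr_gt0.
  move=> q qh gq; rewrite ltNge; apply/negP => mq.
  suff : 0 < g (plane_pt x u b p q) by rewrite ltNge gq.
  apply: Hm; rewrite subr0 ler0_norm; last by apply: below gq; rewrite ?pr.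
  by lra.
have [ma ma0 sa] := side r (gtr0_norm r0).
have [mb mb0 sb] : exists2 m, 0 < m & forall q, `|q| <= h ->
    g (plane_pt x u b (- r) q) <= 0 -> q < - m.
  by apply: side; rewrite normrN gtr0_norm.
(* For [|t| < tau] the term [t * p] stays below the two side margins and below [h]. The base point
   has [q - t * p = 0], so the level 0 is reached, but not on the sides or the bottom. *)
pose tau := Num.min h (Num.min ma mb) / r.
have [t1 t2 t3] : [/\ tau * r <= h, tau * r <= ma & tau * r <= mb].
  by rewrite divfK ?gt_eqF// !ge_min !lexx !orbT.
have tau0 : 0 < tau by rewrite divr_gt0// !lt_min h0 ma0.
have key t : `|t| < tau -> exists pq : R * R,
   [/\ `|pq.1| < r, `|pq.2| < h, 0 <= pq.2 - t * pq.1,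
   (forall p' q', `|p'| <= r -> `|q'| <= h -> g (plane_pt x u b p' q') <= 0 ->
      q' - t * p' <= pq.2 - t * pq.1) &
   g (plane_pt x u b pq.1 pq.2) = 0 /\
   dotv (G (plane_pt x u b pq.1 pq.2)) (u + t *: b) = 0].
  move=> tt.
  have tp p : `|p| <= r -> `|t * p| < tau * r.
    by move=> pr; rewrite normrM; apply: le_lt_trans (_ : `|t| * r < _);
      rewrite ?ler_wpM2l// ltr_pM2r.
  have [| | | |p [q [pr qh c0 mx [gq Gq _]]]] :=
    @touch R n g G x d L u b r h t 0 qg re.
  - by move=> p /signs[].
  - exists 0, 0; rewrite /plane_pt !scale0r !addr0 gx normr0 mulr0 subrr.
    by split=> //; exact: ltW.
  - move=> p q pr qh gq.
    have := tp p; rewrite pr => /(_ (lexx _)); rewrite ltr_norml => /andP[a1 a2].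
    have [pE|pE] : p = r \/ p = - r.
      by move: pr; case: (leP 0 p) => z; [rewrite ger0_norm//|rewrite ltr0_norm//]
          => <-; [left|right]; rewrite ?opprK.
    + by have := sa q qh; rewrite -pE => /(_ gq); lra.
    + by have := sb q qh; rewrite -pE => /(_ gq); lra.
  - by move=> p /tp; rewrite ltr_norml => /andP[]; lra.
  by exists (p, q); split.
have [F HF] : exists F : R -> R * R, forall t, `|t| < tau ->
   [/\ `|(F t).1| < r, `|(F t).2| < h, 0 <= (F t).2 - t * (F t).1,
   (forall p' q', `|p'| <= r -> `|q'| <= h -> g (plane_pt x u b p' q') <= 0 ->
      q' - t * p' <= (F t).2 - t * (F t).1) &
   g (plane_pt x u b (F t).1 (F t).2) = 0 /\
   dotv (G (plane_pt x u b (F t).1 (F t).2)) (u + t *: b) = 0].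
  have key' t : exists pq : R * R, `|t| < tau ->
   [/\ `|pq.1| < r, `|pq.2| < h, 0 <= pq.2 - t * pq.1,
   (forall p' q', `|p'| <= r -> `|q'| <= h -> g (plane_pt x u b p' q') <= 0 ->
      q' - t * p' <= pq.2 - t * pq.1) &
   g (plane_pt x u b pq.1 pq.2) = 0 /\
   dotv (G (plane_pt x u b pq.1 pq.2)) (u + t *: b) = 0].
    have [tt|nt] := pselect (`|t| < tau); last by exists (0, 0).
    by have [pq H] := key t tt; exists pq.
  have [F HF] := boolp.choice key'; exists F; exact: HF.
exists r, tau, (fun t => (F t).2 - t * (F t).1), (fun t => (F t).1).
have lipC t t' : `|t| < tau -> `|t'| < tau ->
    (F t).2 - t * (F t).1 - ((F t').2 - t' * (F t').1) <= r * `|t - t'|.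
  move=> tt tt'; have [pr qh _ _ [gq _]] := HF t tt.
  have [_ _ _ /(_ _ _ (ltW pr) (ltW qh)) mx _] := HF t' tt'.
  have : (t' - t) * (F t).1 <= r * `|t - t'|.
    apply: le_trans (ler_norm _) _.
    by rewrite normrM distrC mulrC ler_wpM2r// ltW.
  by have := mx (eq_imp_le gq); lra.
split=> //.
- by rewrite r0.
- rewrite mul0r subr0.
  have tau00 : `|0 : R| < tau by rewrite normr0.
  have [pr qh + _ [gq _]] := HF 0 tau00.
  rewrite mul0r subr0 => q0; apply/eqP; rewrite eq_le q0 andbT.
  exact: (below _ _ (ltW pr) (ltW qh) (eq_imp_le gq)).
- move=> t t' tt tt'; rewrite ler_norml; apply/andP; split; last exact: lipC.
  by rewrite lerNl opprB distrC; exact: lipC.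
- move=> t tt /=; rewrite subrK.
  by have [? _ _ _ []] := HF t tt.
Qed.

(** * Null sets of slopes *)

(** Compactness of the segment in additive form: the supremum of the [c] with [P a c] is attained
    and cannot lie before [b], since the local hypothesis carries [P] across it. It replaces a
    choice of finite subcover. *)
Lemma segment_gluing (R : realType) (P : R -> R -> Prop) (a b : R) :
  a <= b -> (forall x y z, x <= y -> y <= z -> P x y -> P y z -> P x z) ->
  (forall x, a <= x -> x <= b -> exists2 d, 0 < d & forall y z,
     a <= y -> y <= z -> z <= b -> `|y - x| < d -> `|z - x| < d -> P y z) ->
  P a b.
Proof.
move=> ab glue loc.
pose A := [set c | [/\ a <= c, c <= b & P a c]].
have Aa : A a.
  have [d d0 H] := loc a (lexx a) ab.
  by split=> //; apply: H; rewrite ?subrr ?normr0.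
have ubA : ubound A b by move=> c [].
have supA : has_sup A by split; [exists a|exists b].
set s := sup A.
have as_ : a <= s by apply: ub_le_sup Aa; exists b.
have sb : s <= b by apply: ge_sup => //; exists a.
have [d d0 H] := loc s as_ sb.
have [c [ac cb Pac] sc] := sup_adherent d0 supA.
rewrite -/s in sc.
have cs : c <= s by apply: ub_le_sup; [exists b|split].
pose z := Num.min b (s + d / 2).
have zb : z <= b by rewrite ge_min lexx.
have zs : s <= z by rewrite le_min sb; lra.
have zd : z <= s + d / 2 by rewrite ge_min lexx orbT.
have Paz : P a z.
  apply: (glue a c z) => //; first exact: le_trans cs zs.
  apply: H => //; first exact: le_trans cs zs.
    by rewrite distrC ger0_norm ?subr_ge0//; lra.
  by rewrite ger0_norm ?subr_ge0//; lra.
have : z <= s by apply: ub_le_sup; [exists b|split=> //; exact: le_trans zs].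
rewrite ge_min => /orP[bs|]; last by lra.
have -> : b = z; last exact: Paz.
by apply/eqP; rewrite eq_le zb andbT (le_trans bs zs).
Qed.

(** Zero Jordan content: finite covers by intervals, each given by its centre and its
    half-length. *)
Definition thin (R : realType) (A : set R) : Prop :=
  forall e, 0 < e -> exists l : seq (R * R),
    [/\ forall t, A t -> exists2 i, i \in l & `|t - i.1| <= i.2,
        forall i, i \in l -> 0 <= i.2 & \sum_(i <- l) i.2 <= e].

Lemma thin_set0 (R : realType) : thin (@set0 R).
Proof. by move=> e e0; exists [::]; split=> //; rewrite big_nil ltW. Qed.

Lemma thin_setU (R : realType) (A B : set R) : thin A -> thin B -> thin (A `|` B).
Proof.
move=> tA tB e e0; have e2 : 0 < e / 2 by rewrite divr_gt0.
have [l [l1 l2 l3]] := tA _ e2; have [m [m1 m2 m3]] := tB _ e2.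
exists (l ++ m); split.
- move=> t [/l1|/m1] [i il ti]; exists i => //; rewrite mem_cat il ?orbT//.
- by move=> i; rewrite mem_cat => /orP[/l2|/m2].
- by rewrite big_cat /=; lra.
Qed.

Lemma interval_cover_measure (R : realType) (l : seq (R * R)) :
  (forall i, i \in l -> 0 <= i.2) ->
  let A := [set t | exists2 i, i \in l & `|t - i.1| <= i.2] in
  measurable A /\
  (lebesgue_measure A <= (2 * \sum_(i <- l) i.2)%:E)%E.
Proof.
elim: l => [_|i l IH H].
  have -> : [set t : R | exists2 i, i \in [::] & `|t - i.1| <= i.2] = set0.
    by apply/seteqP; split=> // t [].
  by rewrite /= measure0 big_nil mulr0.
have [|mA lA] := IH; first by move=> j jl; apply: H; rewrite inE jl orbT.
set A := [set t | _] in mA lA.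
have -> : [set t : R | exists2 j, j \in i :: l & `|t - j.1| <= j.2] =
    `[i.1 - i.2, i.1 + i.2] `|` A.
  apply/seteqP; split=> t /=; rewrite in_itv /= -ler_distl.
    by case=> j; rewrite inE => /orP[/eqP->|jl]; [left|right; exists j].
  case=> [ti|[j jl tj]]; first by exists i => //; rewrite mem_head.
  by exists j => //; rewrite inE jl orbT.
split; first exact: measurableU.
have i2 : 0 <= i.2 by apply: H; rewrite mem_head.
apply: le_trans (measureU2 _ _ _) _ => //.
rewrite big_cons mulrDr EFinD leeD//.
change (lebesgue_measure `[(i.1 - i.2)%R, (i.1 + i.2)%R]%classic <= (2 * i.2)%:E)%E.
rewrite lebesgue_measure_itv /=; case: ifPn => _; last first.
  by rewrite lee_fin mulr_ge0.
by rewrite -EFinB lee_fin; lra.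
Qed.

Lemma thin_not_interval (R : realType) (A : set R) (d : R) :
  0 < d -> thin A -> exists2 t, `|t| < d & ~ A t.
Proof.
(* Half-lengths of sum at most [d / 4] give a cover of measure at most [d / 2], too little for an
   interval of length [2 * d]. *)
move=> d0 tA; have d4 : 0 < d / 4 by rewrite divr_gt0.
have [l [l1 l2 l3]] := tA _ d4.
apply: contrapT => H.
have sub : `]- d, d[%classic `<=` [set t | exists2 i, i \in l & `|t - i.1| <= i.2].
  move=> t; rewrite /= in_itv /= -ltr_norml => td; apply: l1.
  by apply: contrapT => nA; apply: H; exists t.
have [mB lB] := interval_cover_measure l2.
have : (lebesgue_measure `](- d)%R, d%R[%classic <= (2 * \sum_(i <- l) i.2)%:E)%E.
  apply: le_trans lB; apply: le_measure => //; rewrite inE//.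
rewrite lebesgue_measure_itv /= lte_fin ifT; last by lra.
by rewrite -EFinB lee_fin; lra.
Qed.

(* Cutting [a, b] into N equal parts covers the set by N intervals of length      *)
(* O(N^-2).                                                                       *)
Lemma thin_quadratic (R : realType) (Bad : R -> R -> Prop) (a b K : R) :
  a < b -> 0 <= K ->
  (forall t s t' s', a <= s <= b -> a <= s' <= b -> Bad t s -> Bad t' s' ->
     `|t - t'| <= K * (s - s') ^+ 2) ->
  thin [set t | exists2 s, a <= s <= b & Bad t s].
Proof.
move=> ab K0 H e e0.
(* The factor 2 absorbs the quotient of [N + 1], the number of intervals, by [N]. *)
pose D := 2 * K * (b - a) ^+ 2.
have D0 : 0 <= D by apply: mulr_ge0; [exact: mulr_ge0|exact: sqr_ge0].
pose N := (Num.truncn (D / e)).+1.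
have NR : D / e < N%:R by apply: truncnS_gt.
have N0 : 0 < N%:R :> R by rewrite ltr0n.
pose w := (b - a) / N%:R.
have w0 : 0 < w by rewrite divr_gt0// subr_gt0.
(* The centre is the slope of any bad point whose position is in the j-th part; a part without bad
   points gets the harmless value 0. *)
have pick j : exists c, forall t s, a + j%:R * w <= s <= a + j.+1%:R * w ->
    a <= s <= b -> Bad t s -> `|t - c| <= K * w ^+ 2.
  have [[t0 [s0 [h1 h2 h3]]]|no] := pselect (exists t s,
      [/\ a + j%:R * w <= s <= a + j.+1%:R * w, a <= s <= b & Bad t s]).
    exists t0 => t s k1 k2 k3; apply: le_trans (H _ _ _ _ k2 h2 k3 h3) _.
    rewrite ler_wpM2l// -[leLHS]real_normK ?num_real//.
    rewrite ler_sqr ?nnegrE ?(ltW w0)//.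
    move: h1 k1; rewrite -natr1 mulrDl mul1r => /andP[? ?] /andP[? ?].
    by rewrite ler_norml; apply/andP; split; lra.
  by exists 0 => t s k1 k2 k3; exfalso; apply: no; exists t, s.
have [c Hc] := boolp.choice pick.
(* One interval more than there are parts: the position [s = b] is assigned the index [N]. *)
exists [seq (c j, K * w ^+ 2) | j <- iota 0 N.+1]; split.
- move=> t [s sab bad].
  have sw : 0 <= (s - a) / w by case/andP: sab => ? _; rewrite divr_ge0 ?(ltW w0)// subr_ge0.
  pose j := Num.truncn ((s - a) / w).
  have /andP[j1 j2] := truncn_itv sw; rewrite -/j in j1 j2.
  exists (c j, K * w ^+ 2).
    apply/mapP; exists j => //; rewrite mem_iota leq0n add0n ltnS.
    rewrite -(ler_nat R); apply: le_trans j1 _.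
    rewrite ler_pdivrMr// /w mulrCA divff ?gt_eqF// mulr1.
    by case/andP: sab => _ ?; lra.
  apply: (Hc j t s) => //.
  move: j1 j2; rewrite ler_pdivlMr// ltr_pdivrMr// => j1 j2.
  by apply/andP; split; lra.
- by move=> i /mapP[j _ ->] /=; rewrite mulr_ge0// sqr_ge0.
- rewrite big_map; under eq_bigr do rewrite /=.
  rewrite big_const_seq count_predT size_iota iter_addr_0.
  rewrite -mulr_natl.
  have -> : N.+1%:R * (K * w ^+ 2) = D / N%:R * (N.+1%:R / (2 * N%:R)).
    by rewrite /D /w; field; rewrite gt_eqF.
  apply: (@le_trans _ _ (D / N%:R)).
    apply: ler_piMr; first by rewrite divr_ge0// ltW.
    rewrite ler_pdivrMr ?mulr_gt0// mul1r -natr1.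
    have : 1 <= N%:R :> R by rewrite ler1n.
    by lra.
  rewrite ler_pdivrMr// mulrC -ler_pdivrMr//; exact: ltW.
Qed.

(** * Charts of the boundary *)

Definition boundary_chart (R : realType) (n : nat) (E : set 'rV[R]_n)
    (g : 'rV[R]_n -> R) (x : 'rV[R]_n) (d L : R) : Prop :=
  [/\ quadratic_near g (grad g) x d L,
      smooth_on [set y | `|y - x| < d] g &
      forall y, `|y - x| < d ->
        [/\ grad g y != 0, (E y <-> g y <= 0) & (boundary E y <-> g y = 0)]].

Lemma class_C_sub (R : realType) (n k : nat) (U V : set 'rV[R]_n) g :
  V `<=` U -> class_C k U g -> class_C k V g.
Proof.
move=> VU; elim: k g => [|k IH] g /= [cg H]; first by split=> // x /VU/cg.
split=> [x /VU/cg //|i].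
by have [H1 H2] := H i; split; [move=> x /VU/H1|exact: IH].
Qed.

Lemma domain_closed (R : realType) (n : nat) (E : set 'rV[R]_n) :
  compact_smooth_domain E -> closed E.
Proof. by move=> [cE _ _]; apply: compact_closed => //; exact: norm_hausdorff. Qed.

Lemma boundary_closed (R : realType) (n : nat) (E : set 'rV[R]_n) :
  closed (boundary E).
Proof.
rewrite /boundary setDE; apply: closedI; first exact: closed_closure.
apply: open_closedC; exact: open_interior.
Qed.

Lemma boundary_sub (R : realType) (n : nat) (E : set 'rV[R]_n) :
  closed E -> boundary E `<=` E.
Proof. by move=> cE x [xE _]; apply: cE. Qed.

Lemma open_norm_ball (R : realType) (n : nat) (x : 'rV[R]_n) (d : R) :
  open [set y | `|y - x| < d].
Proof.
have -> : [set y | `|y - x| < d] = ball x d.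
  by apply/seteqP; split=> y; rewrite -ball_normE /ball_ /= distrC.
exact: ball_open.
Qed.

(** The domain provides only E = {g <= 0} near [x]. That the boundary is {g = 0} follows from
    continuity where [g < 0] and, where [g = 0], from the nonzero gradient, along which one leaves
    [E] at once. *)
Lemma boundary_chart_exists (R : realType) (n : nat) (E : set 'rV[R]_n) x :
  compact_smooth_domain E -> boundary E x ->
  exists g d L, boundary_chart E g x d L.
Proof.
move=> dE bx; have cE := domain_closed dE.
have [_ _ /(_ x bx)[U [g [Ux oU sg gr EU]]]] := dE.
have [d [L [qg dU]]] := smooth_quadratic oU sg Ux.
have [d0 L0 _ _] := qg.
exists g, d, L; split=> //.
  by move=> k; apply: class_C_sub (sg k) => y /=; exact: dU.
move=> y yd; split; [exact: gr (dU _ yd)|exact: EU (dU _ yd)|split].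
- move=> [Ey nE]; have /EU gy := cE _ Ey; have {}gy := gy (dU _ yd).
  apply/eqP; rewrite eq_le gy leNgt; apply/negP => lt; apply: nE.
  have cg : {for y, continuous g} by apply: quadratic_continuous qg yd.
  have n1 : \forall z \near y, g z < 0 by exact: (cvgr_lt _ cg _ lt).
  have n2 : \forall z \near y, U z by apply: open_nbhs_nbhs; split=> //; exact: dU.
  by rewrite /interior; apply: filterS2 n1 n2 => z gz Uz; apply/EU => //; exact: ltW.
- move=> gy; have Ey : E y by apply/EU; [exact: dU|rewrite gy].
  split; first exact: subset_closure.
  move=> /near_normP[e e0 He].
  have e'0 : 0 < d - `|y - x| by rewrite subr_gt0.
  have qy : quadratic_near g (grad g) y (d - `|y - x|) L.
    by apply: quadratic_sub qg _ _ => //; lra.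
  have [f /andP[f0 fd] mono] := quadratic_mono qy (dotv_gt0 (gr _ (dU _ yd))).
  set b := grad g y in mono.
  pose m := Num.min e f; have m0 : 0 < m by rewrite lt_min e0.
  have [me mf] : m <= e /\ m <= f by rewrite !ge_min !lexx orbT.
  pose t := m / (2 * (`|b| + 1)).
  have b1 : 0 < `|b| + 1 by rewrite ltr_wpDl.
  have t0 : 0 < t by rewrite divr_gt0// mulr_gt0.
  have tb : `|y + t *: b - y| < m.
    rewrite addrAC subrr add0r normrZ gtr0_norm//.
    have -> : t * `|b| = m / 2 * (`|b| / (`|b| + 1)).
      by rewrite /t; field; rewrite gt_eqF.
    have : `|b| / (`|b| + 1) <= 1 by rewrite ler_pdivrMr//; lra.
    move=> le1; apply: (@le_lt_trans _ _ (m / 2)); last by lra.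
    by rewrite ler_piMr// divr_ge0// ltW.
  have yf : `|y - y| < f by rewrite subrr normr0.
  have gt := (mono y t yf).2 t0 (lt_le_trans tb mf).
  have /He/EU := lt_le_trans tb me.
  have Uz : U (y + t *: b).
    apply: dU; rewrite -(subrK y (y + _)) -addrA.
    apply: le_lt_trans (ler_normD _ _) _.
    by have := lt_le_trans tb mf; lra.
  by move=> /(_ Uz); rewrite leNgt -gy gt.
Qed.

(** [M] is meant to be the whole singular set, which agrees with the boundary of one piece only near
    [y]; hence the chart is restricted to a smaller ball. *)
Lemma boundary_chart_tangent (R : realType) (n : nat) (E M : set 'rV[R]_n)
    g x d L y u e :
  boundary_chart E g x d L -> `|y - x| < d -> 0 < e ->
  (forall z, `|z - y| < e -> (M z <-> boundary E z)) ->
  dotv (grad g y) u = 0 -> tangent_vector M y u.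
Proof.
move=> [qg sg H] yd e0 HM gu.
have e'0 : 0 < d - `|y - x| by rewrite subr_gt0.
pose f := Num.min e (d - `|y - x|).
have [fe fd] : f <= e /\ f <= d - `|y - x| by rewrite !ge_min !lexx orbT.
have f0 : 0 < f by rewrite lt_min e0.
have S z : `|z - y| < f -> `|z - x| < d.
  move=> zy; rewrite -(subrK y z) -addrA.
  by apply: le_lt_trans (ler_normD _ _) _; lra.
exists [set z | `|z - y| < f], g; split=> //=; first by rewrite subrr normr0.
split; first exact: open_norm_ball.
- by move=> k; apply: class_C_sub (sg k) => z /=; exact: S.
- by move=> z /= /S/H[].
- move=> z /= zf; have [_ _ bz] := H z (S z zf).
  by rewrite -bz; apply: HM; exact: lt_le_trans fe.
Qed.

(** The last point of the segment that belongs to [E] is a boundary point. *)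
Lemma segment_meets_boundary (R : realType) (n : nat) (E : set 'rV[R]_n) y z :
  closed E -> E y -> ~ E z ->
  exists2 t, 0 <= t <= 1 & boundary E (y + t *: (z - y)).
Proof.
move=> cE Ey nEz; set c := fun t : R => y + t *: (z - y).
have cc : continuous c by exact: line_continuous.
pose A := [set t | 0 <= t <= 1 /\ E (c t)].
have A0 : A 0 by rewrite /A /= /c scale0r addr0 lexx ler01.
have ubA : ubound A 1 by move=> t [/andP[]].
have supA : has_sup A by split; [exists 0|exists 1].
set s := sup A.
have s0 : 0 <= s by apply: ub_le_sup A0; exists 1.
have s1 : s <= 1 by apply: ge_sup => //; exists 0.
have Es : E (c s).
  apply: cE => B nB; have : \forall t \near s, B (c t) by exact: cc nB.
  move=> /near_normP[e e0 He].
  have [t At st] := sup_adherent e0 supA.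
  have ts : t <= s by apply: ub_le_sup At; exists 1.
  exists (c t); split; first by case: At.
  by apply: He; rewrite ler0_norm ?subr_le0// -/s in st *; lra.
exists s; first by rewrite s0.
split; first exact: subset_closure.
move=> iE; have : \forall t \near s, E (c t) by exact: cc iE.
move=> /near_normP[e e0 He].
have slt1 : s < 1.
  rewrite lt_neqAle s1 andbT; apply/eqP => E1; apply: nEz.
  by move: Es; rewrite E1 /c scale1r addrC subrK.
pose t := Num.min 1 (s + e / 2).
have [t1 t2] : t <= 1 /\ t <= s + e / 2 by rewrite !ge_min !lexx orbT.
have st : s < t by rewrite lt_min slt1; lra.
have : t <= s.
  apply: ub_le_sup; first by exists 1.
  split; first by apply/andP; split; lra.
  by apply: He; rewrite ger0_norm; lra.
by rewrite leNgt st.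
Qed.

(** * Pieces of a pair and lines tangent to them *)

Definition piece (R : realType) (n : nat) (p : activity_attenuation R n)
    (o : option 'I_(nattn p)) : set 'rV[R]_n :=
  if o is Some k then attn_region p k else region p.

Section pieces.
Context (R : realType) (n : nat) (B : set 'rV[R]_n) (p : activity_attenuation R n).
Context (Hp : admissible_pair B p).

Lemma piece_domain o : compact_smooth_domain (piece (p := p) o).
Proof. by have [_ [H _ _] _ K _] := Hp; case: o => [k|//]; have [] := K k. Qed.

Lemma piece_sub o : piece (p := p) o `<=` B.
Proof. by have [_ [_ H _] _ K _] := Hp; case: o => [k|//]; have [] := K k. Qed.

Lemma piece_disjoint o o' x : piece (p := p) o x -> piece (p := p) o' x -> o = o'.
Proof.
have [_ _ _ _ [H1 H2]] := Hp.
case: o o' => [k|] [l|] //= kx lx.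
- congr Some; apply/eqP/negP => /negP kl; have := H1 k l kl.
  by move=> /seteqP[/(_ x) + _]; apply.
- by have /seteqP[/(_ x) + _] := H2 k; case.
- by have /seteqP[/(_ x) + _] := H2 l; case.
Qed.

Lemma singular_setE x : singular_set p x <-> exists o, boundary (piece (p := p) o) x.
Proof.
split=> [[H|[k _ H]]|[[k|] H]]; [by exists None|by exists (Some k)| |by left].
by right; exists k.
Qed.

(** The pieces are finitely many disjoint closed sets, so only one of them comes near a given point.
    This turns tangency to one piece into tangency to the singular set, the object of assumption
    (3). *)
Lemma piece_isolated o y : piece (p := p) o y ->
  exists2 e, 0 < e & forall z, `|z - y| < e ->
    (singular_set p z <-> boundary (piece (p := p) o) z).
Proof.
move=> oy.
have : \forall z \near y, forall o', o' <> o -> ~ piece (p := p) o' z.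
  have := @filter_forall _ _ (fun o' z => o' <> o -> ~ piece (p := p) o' z) (nbhs y) _.
  apply=> o'; have [->|oo'] := eqVneq o' o; first exact: nearW.
  have no' : ~ piece (p := p) o' y.
    by move=> o'y; move/eqP: oo'; apply; exact: piece_disjoint o'y oy.
  have op : open (~` piece (p := p) o').
    by apply: closed_openC; exact: domain_closed (piece_domain o').
  have : \forall z \near y, (~` piece (p := p) o') z by apply: open_nbhs_nbhs.
  by apply: filterS => z ? _.
move=> /near_normP[e e0 He]; exists e => // z ze.
split=> [/singular_setE [k bz]|bz]; last by apply/singular_setE; exists o.
have [<- //|ok] := pselect (k = o).
by case: (He z ze k ok); apply: boundary_sub bz; exact: domain_closed (piece_domain k).
Qed.

Lemma chart_line_tangent o g x d L y q u :
  boundary_chart (piece (p := p) o) g x d L -> `|y - x| < d -> g y = 0 ->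
  dotv (grad g y) u = 0 -> (exists t : R, y = q + t *: u) ->
  line_tangent_at (singular_set p) q u y.
Proof.
move=> ch yd gy gu line; have [_ _ H] := ch.
have [_ _ [_ /(_ gy) bz]] := H y yd.
have oy : piece (p := p) o y.
  by apply: boundary_sub bz; exact: domain_closed (piece_domain o).
have [e e0 He] := piece_isolated oy.
split=> //; first by apply/singular_setE; exists o.
exact: boundary_chart_tangent ch yd e0 He gu.
Qed.

End pieces.

(** Assumption (3) as a list of two candidates. When there are fewer tangencies the list is padded,
    with [q] or with a repetition of [a]. *)
Lemma two_tangents (R : realType) (n : nat) (S B : set 'rV[R]_n) p q u :
  geometric_assumptions S B p -> u != 0 ->
  exists a b, forall y, line_tangent_at (singular_set p) q u y -> y = a \/ y = b.
Proof.
move=> [_ _ no3 _ _] u0; pose T := line_tangent_at (singular_set p) q u.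
have [[a Ta]|na] := pselect (exists a, T a); last first.
  by exists q, q => y Ty; case: na; exists y.
have [[b [Tb ab]]|nb] := pselect (exists b, T b /\ a <> b); last first.
  exists a, a => y Ty; left; apply: contrapT => ya; apply: nb.
  by exists y; split=> // ay; apply: ya.
exists a, b => y Ty; apply: contrapT => /not_orP[ya yb].
apply: (no3 q u u0); exists a, b, y; split; split=> //; apply/eqP => //.
- by move=> by_; apply: yb.
- by move=> ay; apply: ya.
Qed.

Lemma quadratic_sign (R : realType) (n : nat) (g : 'rV[R]_n -> R) G x d L (neg : bool) :
  quadratic_near g G x d L ->
  quadratic_near (fun y => (-1) ^+ neg * g y) (fun y => (-1) ^+ neg *: G y) x d L.
Proof.
case: neg => /=; last first.
  have -> : (fun y => (-1) ^+ 0 * g y) = g by apply/funext => y; rewrite mul1r.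
  by have -> : (fun y => (-1) ^+ 0 *: G y) = G
    by apply/funext => y; rewrite scale1r.
have -> : (fun y => (-1) ^+ 1 * g y) = fun y => - g y.
  by apply/funext => y; rewrite mulN1r.
have -> : (fun y => (-1) ^+ 1 *: G y) = fun y => - G y.
  by apply/funext => y; rewrite scaleN1r.
exact: quadratic_opp.
Qed.

Lemma dotv_sign_eq0 (R : realType) (n : nat) (a u : 'rV[R]_n) (neg : bool) :
  dotv ((-1) ^+ neg *: a) u = 0 -> dotv a u = 0.
Proof.
by rewrite dotvZl => /eqP; rewrite mulf_eq0 signr_eq0 /= => /eqP.
Qed.

(** A coordinate vector whose index differs from that of some nonzero entry of [b]; this needs two
    coordinates. *)
Lemma independent_direction (R : realType) (n : nat) (b : 'rV[R]_n) :
  (2 <= n)%N -> b != 0 -> exists u : 'rV[R]_n, forall k, u + k *: b != 0.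
Proof.
move=> n2 b0; have [i bi] : exists i, b 0 i != 0.
  apply: contrapT => H; move/eqP: b0; apply; apply/rowP => i; rewrite mxE.
  by apply/eqP/negP => /negP bi; apply: H; exists i.
have [j ji] : exists j : 'I_n, j != i.
  case: n n2 b i bi {b0} => [|[|n]] // _ b i _.
  by have [->|i0] := eqVneq i 0; [exists 1|exists 0; rewrite eq_sym].
exists (delta_mx 0 j) => k; apply/eqP => /rowP E.
have := E i; rewrite !mxE /= eq_sym (negbTE ji) add0r => /eqP.
rewrite mulf_eq0 (negbTE bi) orbF => /eqP k0.
by have := E j; rewrite !mxE /= eqxx k0 mul0r addr0 => /eqP; rewrite oner_eq0.
Qed.

(** The line of [touching_line] lies on one side of the boundary near the contact, so each zero of
    [g] on it is a minimum and thus a tangency. Assumption (3) allows two of these, hence the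
    contact is isolated. *)
Lemma isolated_tangent (R : realType) (n : nat) (S B : set 'rV[R]_n) p g x0 d L e :
  (2 <= n)%N -> admissible_pair B p -> geometric_assumptions S B p ->
  boundary (region p) x0 -> boundary_chart (region p) g x0 d L -> 0 < e ->
  exists (y u : 'rV[R]_n) (neg : bool) (r : R),
    [/\ `|y - x0| < e, u != 0, g y = 0, 0 < r &
      forall s, s != 0 -> `|s| <= r -> 0 < (-1) ^+ neg * g (y + s *: u)].
Proof.
move=> n2 Hp geo bx ch e0; have [qg _ H] := ch; have [d0 L0 _ _] := qg.
have xd : `|x0 - x0| < d by rewrite subrr normr0.
have [gr0 _ bE] := H x0 xd; have gx0 := bE.1 bx.
have [u0 ind] := independent_direction n2 gr0.
have e'0 : 0 < Num.min e d by rewrite lt_min e0.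
have [y [u [neg [yx un gy [eta eta0 Heta]]]]] :=
  touching_line qg gx0 (dotv_gt0 gr0) ind e'0.
have [ye yd] : `|y - x0| < e /\ `|y - x0| < d.
  by move: yx; rewrite lt_min => /andP[].
pose f := Num.min eta ((d - `|y - x0|) / (`|u| + 1)).
have u1 : 0 < `|u| + 1 by rewrite ltr_wpDl.
have [f1 f2] : f <= eta /\ f <= (d - `|y - x0|) / (`|u| + 1).
  by rewrite !ge_min !lexx orbT.
have f0 : 0 < f by rewrite lt_min eta0 divr_gt0// subr_gt0.
have inb s : `|s| < f -> `|y + s *: u - x0| < d.
  move=> sf; rewrite addrAC; apply: le_lt_trans (ler_normD _ _) _.
  rewrite normrZ; have : `|s| * (`|u| + 1) < d - `|y - x0|.
    by rewrite -ltr_pdivlMr//; exact: lt_le_trans f2.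
  by rewrite mulrDr mulr1; have := normr_ge0 s; lra.
have tang s : `|s| < f -> g (y + s *: u) = 0 ->
    line_tangent_at (singular_set p) y u (y + s *: u).
  move=> sf gs; have zd := inb s sf.
  apply: (@chart_line_tangent R n B p Hp None g x0 d L) => //; last by exists s.
  apply: (@dotv_sign_eq0 _ _ _ _ neg).
  apply: (@quadratic_min R n (fun y => (-1) ^+ neg * g y)
    (fun y => (-1) ^+ neg *: grad g y) _ (d - `|y + s *: u - x0|) L).
    apply: quadratic_sub (quadratic_sign neg qg) _ _; first by rewrite subr_gt0.
    by lra.
  exists (f - `|s|); first by rewrite subr_gt0.
  move=> t tf; rewrite gs mulr0 -addrA -scalerDl; apply: Heta.
  apply: le_lt_trans (ler_normD _ _) _; lra.
have [a [b Hab]] := two_tangents y geo un.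
have avoid c : exists2 r, 0 < r & forall s, s != 0 -> `|s| <= r -> y + s *: u <> c.
  have [[s [s0 sc]]|no] := pselect (exists s, s != 0 /\ y + s *: u = c); last first.
    by exists 1 => // s s0 _ sc; apply: no; exists s.
  exists (`|s| / 2); first by rewrite divr_gt0// normr_gt0.
  move=> t t0 ts tc; move: tc; rewrite -sc => /addrI/eqP.
  rewrite -subr_eq0 -scalerBl scaler_eq0 (negbTE un) orbF subr_eq0 => /eqP E.
  have : 0 < `|s| by rewrite normr_gt0.
  by move: ts; rewrite E; lra.
have [ra ra0 Ha] := avoid a; have [rb rb0 Hb] := avoid b.
pose r := Num.min (f / 2) (Num.min ra rb).
have [r1 r2 r3] : [/\ r <= f / 2, r <= ra & r <= rb].
  by rewrite !ge_min !lexx !orbT.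
exists y, u, neg, r; split=> //; first by rewrite !lt_min divr_gt0// ra0.
move=> s s0 sr.
have sf : `|s| < f by lra.
rewrite lt_neqAle Heta ?andbT; last exact: lt_le_trans f1.
rewrite eq_sym mulf_eq0 signr_eq0 /=; apply/eqP => gs.
by case: (Hab _ (tang s sf gs)); [apply: Ha|apply: Hb] => //; exact: le_trans sr _.
Qed.

(** * A line with a single tangency *)

Lemma small_pos (R : realFieldType) (l : seq R) :
  all (fun a => 0 < a) l -> exists2 d, 0 < d & all (fun a => d <= a) l.
Proof.
elim: l => [_|a l IH /= /andP[a0 /IH[d d0 dl]]]; first by exists 1.
exists (Num.min a d); first by rewrite lt_min a0.
rewrite ge_min lexx /=; apply: sub_all dl => b db.
by rewrite ge_min db orbT.
Qed.

Lemma generic_direction (R : realType) (n : nat) (l : seq 'rV[R]_n) :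
  (forall N, N \in l -> N != 0) ->
  exists b : 'rV[R]_n, forall N, N \in l -> dotv N b != 0.
Proof.
elim: l => [_|N l IH Hl]; first by exists 0.
have [|b Hb] := IH; first by move=> M Ml; apply: Hl; rewrite inE Ml orbT.
have [Nb|Nb] := eqVneq (dotv N b) 0; last first.
  by exists b => M; rewrite inE => /orP[/eqP ->|/Hb].
have N0 : N != 0 by apply: Hl; rewrite mem_head.
(* Adding [e *: N] to [b] repairs the product with [N]. The product with an earlier [M] could vanish
   only if [e] were one of these ratios in absolute value, and [e] exceeds their sum. *)
pose e := 1 + \sum_(M <- l) `|dotv M b / dotv M N|.
have e1 : 1 <= e by rewrite /e lerDl sumr_ge0.
exists (b + e *: N) => M; rewrite inE dotvDr dotvZr => /orP[/eqP ->|Ml].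
  by rewrite Nb add0r mulf_neq0 ?gt_eqF ?dotv_gt0//; lra.
apply/eqP => E; have Mb := Hb M Ml.
have MN : dotv M N != 0.
  by apply: contra_neq Mb => MN; move: E; rewrite MN mulr0 addr0.
have eE : e = `|dotv M b / dotv M N|.
  rewrite -(ger0_norm (le_trans ler01 e1)) -normrN; congr `|_|.
  by apply: (mulIf MN); rewrite mulNr -mulrA mulVf// mulr1; lra.
have : `|dotv M b / dotv M N| <= \sum_(M <- l) `|dotv M b / dotv M N|.
  by rewrite (big_rem M)//= lerDl sumr_ge0.
by rewrite -eE /e; lra.
Qed.

Definition transversal (R : realType) (n : nat) (E : set 'rV[R]_n)
    (y w : 'rV[R]_n) : Prop :=
  exists g d L, boundary_chart E g y d L /\ dotv (grad g y) w != 0.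

Lemma boundary_chart_recenter (R : realType) (n : nat) (E : set 'rV[R]_n) g x d L y :
  boundary_chart E g x d L -> `|y - x| < d ->
  boundary_chart E g y (d - `|y - x|) L.
Proof.
move=> [qg sg H] yd.
have S z : `|z - y| < d - `|y - x| -> `|z - x| < d.
  move=> zy; rewrite -(subrK y z) -addrA.
  by apply: le_lt_trans (ler_normD _ _) _; lra.
split.
- by apply: quadratic_sub qg _ _; rewrite ?subr_gt0//; lra.
- by move=> k; apply: class_C_sub (sg k) => z /= /S.
- by move=> z /S/H.
Qed.

Section generic_tangency.
Context (R : realType) (n : nat) (x u b : 'rV[R]_n) (C : R -> R) (r tau : R).
Context (r0 : 0 < r) (tau0 : 0 < tau) (C0 : C 0 = 0).
Context (lipC : forall t t', `|t| < tau -> `|t'| < tau ->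
  `|C t - C t'| <= r * `|t - t'|).

(** The family of lines: for fixed [t] this runs along the line of direction [u + t *: b] as [s]
    varies, and [Y 0 s] is the base line because [C 0 = 0]. *)
Let Y t s := plane_pt x u b s (C t + t * s).

Let Y_dist s0 t s d : d <= 1 -> `|t| < tau -> `|t| <= d -> `|s - s0| <= d ->
  `|Y t s - (x + s0 *: u)| <= d * (`|u| + (r + `|s0| + 1) * `|b|).
Proof.
move=> d1 tt td sd.
have d0 : 0 <= d by apply: le_trans td.
have -> : x + s0 *: u = plane_pt x u b s0 0 by rewrite /plane_pt scale0r addr0.
apply: le_trans (plane_pt_dist _ _ _ _ _ _ _) _.
rewrite subr0 mulrDr mulrA; apply: lerD; first by rewrite ler_wpM2r.
rewrite ler_wpM2r//; apply: le_trans (ler_normD _ _) _.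
have Ct : `|C t| <= r * `|t|.
  by have := lipC tt (_ : `|0| < tau); rewrite normr0 C0 !subr0; apply.
have ss : `|s| <= `|s0| + 1.
  by rewrite -(subrK s0 s); apply: le_trans (ler_normD _ _) _; lra.
rewrite normrM.
have : `|t| * `|s| <= d * (`|s0| + 1) by rewrite ler_pM.
have : r * `|t| <= r * d by rewrite ler_wpM2l// ltW.
lra.
Qed.

Let Y_shift t s s' : Y t s' = Y t s + (s' - s) *: (u + t *: b).
Proof. by rewrite /Y /plane_pt; apply/rowP => i; rewrite !mxE; ring. Qed.

Let Y_turn t t' s : Y t' s = Y t s + (C t' - C t + (t' - t) * s) *: b.
Proof. by rewrite /Y /plane_pt; apply/rowP => i; rewrite !mxE; ring. Qed.

(* At a tangency both g and its derivative along the line vanish, so that the     *)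
(* slope varies quadratically with the position of the tangency: Sard's argument. *)
Lemma tangency_quadratic g G (s0 d L : R) :
  quadratic_near g G (x + s0 *: u) d L ->
  dotv (G (x + s0 *: u)) b != 0 -> 2 * r < `|s0| ->
  exists de K, [/\ 0 < de, 0 <= K & forall t s t' s',
    `|t| < de -> `|t'| < de -> `|s - s0| <= de -> `|s' - s0| <= de ->
    g (Y t s) = 0 -> g (Y t' s') = 0 -> dotv (G (Y t s)) (u + t *: b) = 0 ->
    `|t - t'| <= K * (s - s') ^+ 2].
Proof.
move=> [d0 L0 H1 H2] Nb s0r; set y0 := x + s0 *: u in H1 H2 Nb *.
set m := `|dotv (G y0) b|.
have m0 : 0 < m by rewrite normr_gt0.
pose M := `|u| + (r + `|s0| + 1) * `|b|.
have rs : 0 < r + `|s0| + 1 by rewrite ltr_wpDl// addr_ge0// ltW.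
have M0 : 0 <= M by rewrite addr_ge0// mulr_ge0// ltW.
have LMb : 0 <= L * M * `|b| by rewrite !mulr_ge0.
have rLb : 0 <= (r + `|s0| + 1) * L * `|b| ^+ 2.
  by rewrite mulr_ge0 ?exprn_ge0// mulr_ge0// ltW.
have [|de de0 /=] := @small_pos R [:: 1; tau; `|s0| - 2 * r; d / (2 * (M + 1));
  m / (2 * (L * M * `|b| + 1)); m / (8 * ((r + `|s0| + 1) * L * `|b| ^+ 2 + 1))].
  by rewrite /= ltr01 tau0 subr_gt0 s0r !divr_gt0 ?mulr_gt0 ?ltr_wpDl.
move=> /and5P[de1 det des ded] /and3P[dem dec _].
(* From [|c| * (m / 4) <= L * (|u| + |b|)^2 * (s - s')^2] and [r * |t - t'| <= |c|], with [c] the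
   displacement along [b] introduced below. *)
pose K := 4 * L * (`|u| + `|b|) ^+ 2 / (r * m).
have K0 : 0 <= K.
  by rewrite divr_ge0 ?mulr_ge0 ?exprn_ge0 ?addr_ge0// ltW.
exists de, K; split=> // t s t' s' td td' sd sd' gy gy' Gy.
have tt : `|t| < tau by exact: lt_le_trans det.
have tt' : `|t'| < tau by exact: lt_le_trans det.
have deM : de * M < d.
  move: ded; rewrite ler_pdivlMr ?mulr_gt0 ?ltr_wpDl// => ded.
  have : 0 <= de * M by rewrite mulr_ge0// ltW.
  by lra.
have yd z : `|z - y0| <= de * M -> `|z - y0| < d by move=> h; apply: le_lt_trans deM.
have y1 := Y_dist de1 tt (ltW td) sd.
have y2 := Y_dist de1 tt (ltW td) sd'.
have y3 := Y_dist de1 tt' (ltW td') sd'.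
have A1 := H1 _ _ (yd _ y1) (yd _ y2).
have A2 := H1 _ _ (yd _ y2) (yd _ y3).
have B := H2 _ _ b (_ : `|y0 - y0| < d) (yd _ y2).
rewrite subrr normr0 in B; have {}B := B d0.
have E1 : Y t s' - Y t s = (s' - s) *: (u + t *: b).
  by rewrite (Y_shift t s s') addrAC subrr add0r.
(* The passage from the first tangency to the second zero is split: along the line [t] to the
   position [s'], where [g] changes only quadratically, and then by [c] in the direction [b],
   transversal to the level set. *)
set c := C t' - C t + (t' - t) * s'.
have E2 : Y t' s' - Y t s' = c *: b by rewrite (Y_turn t t' s') addrAC subrr add0r.
rewrite E1 gy subr0 dotvZr Gy mulr0 subr0 normrZ exprMn in A1.
rewrite E2 gy' dotvZr normrZ exprMn in A2.
have ut : `|u + t *: b| <= `|u| + `|b|.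
  apply: le_trans (ler_normD _ _) _; rewrite lerD2l normrZ ler_piMl//.
  by apply: le_trans (ltW td) _.
have A1' : `|g (Y t s')| <= L * (`|u| + `|b|) ^+ 2 * (s - s') ^+ 2.
  apply: le_trans A1 _; rewrite -mulrA ler_wpM2l// mulrC.
  rewrite real_normK ?num_real// -[X in _ * X <= _]sqrrN opprB ler_wpM2r ?sqr_ge0//.
  by rewrite ler_sqr ?nnegrE ?addr_ge0.
have Bm : m / 2 <= `|dotv (G (Y t s')) b|.
  have : L * `|Y t s' - y0| * `|b| <= m / 2.
    apply: (@le_trans _ _ (L * (de * M) * `|b|)).
      by rewrite ler_wpM2r// ler_wpM2l.
    move: dem; rewrite ler_pdivlMr; last by rewrite mulr_gt0// ltr_wpDl.
    by move: de0; clear -r0 tau0 C0 lipC x u b; lra.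
  move: B; rewrite -/m => B1 B2.
  have := ler_normB (dotv (G (Y t s')) b) (dotv (G (Y t s')) b - dotv (G y0) b).
  by rewrite opprB addrC subrK -/m; move: B1 B2; clear -r0 tau0 C0 lipC x u b; lra.
have cb : `|c| <= 2 * (r + `|s0| + 1) * de.
  have ss : `|s'| <= `|s0| + 1.
    rewrite -(subrK s0 s'); apply: le_trans (ler_normD _ _) _.
    by move: sd' de1; clear -r0 tau0 C0 lipC x u b; lra.
  have ttd : `|t' - t| <= 2 * de by apply: le_trans (ler_normB _ _) _; move: td td'; clear -r0 tau0 C0 lipC x u b; lra.
  apply: le_trans (ler_normD _ _) _; rewrite normrM.
  have := lipC tt' tt.
  have : `|t' - t| * `|s'| <= 2 * de * (`|s0| + 1) by rewrite ler_pM.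
  have : r * `|t' - t| <= r * (2 * de) by rewrite ler_wpM2l// ltW.
  by clear -r0 tau0 C0 lipC x u b; lra.
have cm : L * (`|c| ^+ 2 * `|b| ^+ 2) <= `|c| * (m / 4).
  rewrite expr2 -mulrA mulrCA ler_wpM2l// mulrCA.
  apply: (@le_trans _ _ (2 * (r + `|s0| + 1) * de * (L * `|b| ^+ 2))).
    by rewrite ler_wpM2r// mulr_ge0// exprn_ge0.
  move: dec; rewrite ler_pdivlMr; last by rewrite mulr_gt0// ltr_wpDl.
  by move: de0; clear -r0 tau0 C0 lipC x u b; lra.
(* Here [2 * r < |s0|] is used: the turn contributes at least [2 * r * |t - t'|] to [c], and the
   variation of [C] takes back at most half of it. *)
have cl : r * `|t - t'| <= `|c|.
  have s2 : 2 * r <= `|s'|.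
    have := ler_normB (s' - s0) s'; rewrite addrAC subrr sub0r normrN.
    by move: sd' des; clear -r0 tau0 C0 lipC x u b; lra.
  have := ler_normB c (C t' - C t).
  rewrite /c addrAC subrr add0r normrM.
  have := lipC tt' tt; rewrite [`|t - t'|]distrC.
  have : `|t' - t| * (2 * r) <= `|t' - t| * `|s'| by rewrite ler_wpM2l.
  by clear -r0 tau0 C0 lipC x u b; lra.
have fin : `|c| * (m / 4) <= L * (`|u| + `|b|) ^+ 2 * (s - s') ^+ 2.
  have h1 : `|c| * (m / 2) <= `|c * dotv (G (Y t s')) b|.
    by rewrite normrM ler_wpM2l.
  have h2 : `|c * dotv (G (Y t s')) b| <= `|g (Y t s')| + L * (`|c| ^+ 2 * `|b| ^+ 2).
    have := ler_normB (- g (Y t s')) (0 - g (Y t s') - c * dotv (G (Y t s')) b).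
    rewrite normrN sub0r opprB addrC.
    have -> : c * dotv (G (Y t s')) b - - g (Y t s') + - g (Y t s') =
      c * dotv (G (Y t s')) b by ring.
    by rewrite sub0r in A2; move: A2; clear -r0 tau0 C0 lipC x u b; lra.
  by move: h1 h2 cm A1'; clear -r0 tau0 C0 lipC x u b; lra.
rewrite /K mulrAC ler_pdivlMr ?mulr_gt0//.
have : r * `|t - t'| * (m / 4) <= `|c| * (m / 4) by rewrite ler_wpM2r// divr_ge0// ltW.
by move: fin; clear -r0 tau0 C0 lipC x u b; lra.
Qed.

(** If the base line is off the boundary or crosses it transversally at [s0], nearby lines behave
    alike and no slope is excluded. If it is tangent there, the slopes of nearby tangent lines form
    a thin set by [tangency_quadratic] and [thin_quadratic]. *)
Lemma generic_tangency_local E s0 :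
  (boundary E (x + s0 *: u) -> exists g d L,
     boundary_chart E g (x + s0 *: u) d L /\
     (dotv (grad g (x + s0 *: u)) u != 0 \/
      dotv (grad g (x + s0 *: u)) b != 0 /\ 2 * r < `|s0|)) ->
  exists de (A : set R), [/\ 0 < de, thin A & forall t s, `|t| < de ->
    `|s - s0| < de -> ~ A t -> boundary E (Y t s) ->
    transversal E (Y t s) (u + t *: b)].
Proof.
move=> H; set y0 := x + s0 *: u in H.
pose M := `|u| + (r + `|s0| + 1) * `|b|.
have M0 : 0 <= M.
  by rewrite addr_ge0// mulr_ge0// !addr_ge0// ltW.
have M1 : 0 < M + 1 by rewrite ltr_wpDl.
have near e : 0 < e -> exists2 de, 0 < de & forall t s, `|t| < de ->
    `|s - s0| < de -> `|Y t s - y0| < e.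
  move=> e0; have [|de de0 /= /and4P[d1 dt dM _]] :=
    @small_pos R [:: 1; tau; e / (M + 1)].
    by rewrite /= ltr01 tau0 divr_gt0.
  exists de => // t s td sd.
  apply: le_lt_trans (Y_dist d1 (lt_le_trans td dt) (ltW td) (ltW sd)) _.
  by move: dM; rewrite ler_pdivlMr// mulrDr mulr1 -/M; lra.
have [bE|nbE] := pselect (boundary E y0); last first.
  have : \forall z \near y0, (~` boundary E) z.
    apply: open_nbhs_nbhs; split=> //; apply: closed_openC.
    exact: boundary_closed.
  move=> /near_normP[e e0 He]; have [de de0 Hde] := near e e0.
  exists de, set0; split; [exact: de0|exact: thin_set0|].
  by move=> t s td sd _ bY; case: (He _ (Hde t s td sd)).
have [g [d [L [ch Hg]]]] := H bE.
have [qg sg Hch] := ch; have [d0 L0 Q1 Q2] := qg.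
have [de1 de10 Hde1] := near d d0.
have recenter t s : `|t| < de1 -> `|s - s0| < de1 ->
    dotv (grad g (Y t s)) (u + t *: b) != 0 -> transversal E (Y t s) (u + t *: b).
  move=> td sd ne; exists g, (d - `|Y t s - y0|), L; split=> //.
  by apply: boundary_chart_recenter ch _; exact: Hde1.
case: Hg => [Nu|[Nb s0r]].
  set c := `|dotv (grad g y0) u|.
  have c0 : 0 < c by rewrite normr_gt0.
  pose W := L * (`|u| + `|b|) + 1.
  have W0 : 0 < W by rewrite ltr_wpDl// mulr_ge0// addr_ge0.
  have cW : 0 < c / (2 * W) by rewrite divr_gt0// mulr_gt0.
  have [de2 de20 Hde2] := near _ cW.
  have [|de de0 /= /and5P[d1 d2 d3 d4 _]] :=
    @small_pos R [:: 1; de1; de2; c / (2 * (`|dotv (grad g y0) b| + 1))].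
    by rewrite /= ltr01 de10 de20 divr_gt0// mulr_gt0// ltr_wpDl.
  exists de, set0; split; [exact: de0|exact: thin_set0|].
  move=> t s td sd _ _; apply: recenter; [exact: lt_le_trans td d2|
    exact: lt_le_trans sd d2|].
  apply/eqP => E0.
  have B := Q2 y0 (Y t s) (u + t *: b).
  rewrite subrr normr0 E0 sub0r normrN in B.
  have {}B := B d0 (Hde1 t s (lt_le_trans td d2) (lt_le_trans sd d2)).
  have ut : `|u + t *: b| <= `|u| + `|b|.
    apply: le_trans (ler_normD _ _) _; rewrite lerD2l normrZ ler_piMl//.
    by apply: le_trans (ltW td) _.
  have h1 : L * `|Y t s - y0| * `|u + t *: b| < c / 2.
    have := Hde2 t s (lt_le_trans td d3) (lt_le_trans sd d3).
    rewrite ltr_pdivlMr ?mulr_gt0// => h.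
    apply: (@le_lt_trans _ _ (`|Y t s - y0| * W)); last by lra.
    rewrite [L * _]mulrC -mulrA ler_wpM2l// /W.
    have : L * `|u + t *: b| <= L * (`|u| + `|b|) by rewrite ler_wpM2l.
    lra.
  have h2 : `|t * dotv (grad g y0) b| < c / 2.
    rewrite normrM; have := lt_le_trans td d4.
    have b1 : 0 < `|dotv (grad g y0) b| + 1 by rewrite ltr_wpDl.
    rewrite ltr_pdivlMr ?mulr_gt0//.
    by have := normr_ge0 t; lra.
  move: B; rewrite dotvDr dotvZr => B.
  have := ler_normB (dotv (grad g y0) u + t * dotv (grad g y0) b)
    (t * dotv (grad g y0) b).
  by rewrite addrK -/c; lra.
have [de2 [K [de20 K0 HK]]] := tangency_quadratic qg Nb s0r.
have [|de de0 /= /and3P[d1 d2 _]] := @small_pos R [:: de1; de2].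
  by rewrite /= de10 de20.
pose Bad t s := [/\ `|t| < de, g (Y t s) = 0 &
  dotv (grad g (Y t s)) (u + t *: b) = 0].
exists de, [set t | exists2 s, s0 - de <= s <= s0 + de & Bad t s]; split; [exact: de0| |].
  apply: (@thin_quadratic R Bad (s0 - de) (s0 + de) K) => //; first by lra.
  move=> t s t' s'; rewrite -!ler_distl => sd sd' [td gy Gy] [td' gy' _].
  by apply: HK => //; [exact: lt_le_trans d2|exact: lt_le_trans d2|
    exact: le_trans d2|exact: le_trans d2].
move=> t s td sd nA bY; apply: recenter; [exact: lt_le_trans d1|
  exact: lt_le_trans d1|].
apply/eqP => E0; apply: nA; exists s; first by rewrite -ler_distl ltW.
split=> //.
have [_ _ bz] := Hch _ (Hde1 t s (lt_le_trans td d1) (lt_le_trans sd d1)).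
exact/bz.
Qed.

Lemma generic_tangency_segment E a c : a <= c ->
  (forall s0, a <= s0 -> s0 <= c -> boundary E (x + s0 *: u) -> exists g d L,
     boundary_chart E g (x + s0 *: u) d L /\
     (dotv (grad g (x + s0 *: u)) u != 0 \/
      dotv (grad g (x + s0 *: u)) b != 0 /\ 2 * r < `|s0|)) ->
  exists de (A : set R), [/\ 0 < de, thin A & forall t s, `|t| < de ->
    a <= s <= c -> ~ A t -> boundary E (Y t s) ->
    transversal E (Y t s) (u + t *: b)].
Proof.
move=> ac H.
pose P a c := exists de (A : set R), [/\ 0 < de, thin A & forall t s, `|t| < de ->
    a <= s <= c -> ~ A t -> boundary E (Y t s) ->
    transversal E (Y t s) (u + t *: b)].
apply: (@segment_gluing R P) => //.
- move=> p q s pq qs [d1 [A1 [d10 t1 H1]]] [d2 [A2 [d20 t2 H2]]].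
  exists (Num.min d1 d2), (A1 `|` A2); split; first by rewrite lt_min d10.
    exact: thin_setU.
  move=> t z; rewrite lt_min => /andP[td1 td2] /andP[pz zs] /not_orP[n1 n2].
  have [zq|qz] := leP z q; first by apply: H1 => //; rewrite pz.
  by apply: H2 => //; rewrite zs ltW.
- move=> s0 as0 s0c; have [de [A [de0 tA HA]]] := generic_tangency_local (H s0 as0 s0c).
  exists de => // p q ap pq qc pd qd; exists de, A; split=> // t s td /andP[ps sq].
  apply: HA => //; move: pd qd; rewrite !ltr_norml => /andP[? ?] /andP[? ?].
  by apply/andP; split; lra.
Qed.

End generic_tangency.

Lemma bounded_family (R : realType) (n : nat) (I : finType) (E : I -> set 'rV[R]_n) :
  (forall i, compact (E i)) ->
  exists2 M, 0 < M & forall i y, E i y -> `|y| <= M.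
Proof.
move=> cE; have H i : exists m : R, forall y, E i y -> `|y| <= m.
  have [m [_ Hm]] := compact_bounded (cE i).
  by exists (m + 1) => y Ey; apply: Hm => //; rewrite ltrDl.
have [m Hm] := boolp.choice H.
exists (1 + \sum_i `|m i|); first by rewrite ltr_pwDl// sumr_ge0.
move=> i y /Hm le; apply: le_trans le _.
apply: le_trans (ler_norm _) _.
have := @ler_single_sum R I (fun i => `|m i|) i (fun j => normr_ge0 (m j)).
by lra.
Qed.

Lemma thin_family (R : realType) (I : finType) (P : I -> R -> Prop) :
  (forall i, exists de A, [/\ 0 < de, thin A &
    forall t, `|t| < de -> ~ A t -> P i t]) ->
  exists de A, [/\ 0 < de, thin A & forall t, `|t| < de -> ~ A t -> forall i, P i t].
Proof.
move=> H.
suff [de [A [de0 tA HA]]] : exists de A, [/\ 0 < de, thin A &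
    forall t, `|t| < de -> ~ A t -> forall i, i \in enum I -> P i t].
  by exists de, A; split=> // t td nA i; apply: HA; rewrite ?mem_enum.
elim: (enum I) => [|i l [d1 [A1 [d10 t1 H1]]]].
  by exists 1, set0; split=> //; exact: thin_set0.
have [d2 [A2 [d20 t2 H2]]] := H i.
exists (Num.min d1 d2), (A1 `|` A2); split; first by rewrite lt_min d10.
  exact: thin_setU.
move=> t; rewrite lt_min => /andP[td1 td2] /not_orP[n1 n2] j.
by rewrite inE => /orP[/eqP ->|jl]; [exact: H2|exact: H1].
Qed.

Lemma point_gap (R : realType) (n : nat) (x u c : 'rV[R]_n) : u != 0 ->
  exists2 e, 0 < e & forall s, x + s *: u = c -> s = 0 \/ e <= `|s|.
Proof.
move=> un; have [[s [s0 sc]]|no] := pselect (exists s, s != 0 /\ x + s *: u = c); last first.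
  exists 1 => // s sc; left; apply/eqP/negP => /negP s0; apply: no.
  by exists s.
exists `|s|; first by rewrite normr_gt0.
move=> t; rewrite -sc => /addrI/eqP.
by rewrite -subr_eq0 -scalerBl scaler_eq0 (negbTE un) orbF subr_eq0 => /eqP ->; right.
Qed.

(** A generic direction is projected to the orthogonal complement of [u], which vectors orthogonal
    to [u] do not notice; then its sign is adjusted against [v] and its length normalised. *)
Lemma orthonormal_direction (R : realType) (n : nat) (u v : 'rV[R]_n)
    (l : seq 'rV[R]_n) :
  dotv u u = 1 -> v != 0 -> dotv v u = 0 ->
  exists b, [/\ dotv b b = 1, dotv u b = 0, 0 < dotv v b &
    forall N, N \in l -> N != 0 -> dotv N u = 0 -> dotv N b != 0].
Proof.
move=> uu v0 vu.
have [|b0 Hb0] := @generic_direction R n (v :: [seq N <- l | N != 0]).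
  by move=> N; rewrite inE mem_filter => /orP[/eqP ->|/andP[]].
pose b1 := b0 - dotv u b0 *: u.
have Nb1 N : dotv N u = 0 -> dotv N b1 = dotv N b0.
  by move=> Nu; rewrite /b1 dotvDr dotvNr dotvZr Nu mulr0 oppr0 addr0.
have vb0 : dotv v b1 != 0 by rewrite Nb1// Hb0 ?mem_head.
pose b2 := Num.sg (dotv v b1) *: b1.
have vb2 : 0 < dotv v b2 by rewrite /b2 dotvZr -normrEsg normr_gt0.
have b20 : b2 != 0.
  by apply: contraTneq vb2 => ->; rewrite -(scale0r b1) dotvZr mul0r ltxx.
have ub1 : dotv u b1 = 0 by rewrite /b1 dotvDr dotvNr dotvZr uu mulr1 subrr.
have ub2 : dotv u b2 = 0 by rewrite /b2 dotvZr ub1 mulr0.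
have bb := dotv_gt0 b20; set k := Num.sqrt (dotv b2 b2).
have k0 : 0 < k by rewrite sqrtr_gt0.
have kk : k * k = dotv b2 b2 by rewrite -expr2 sqr_sqrtr// ltW.
exists (k^-1 *: b2); split.
- by rewrite dotvZl dotvZr -kk mulKf ?mulVf ?gt_eqF.
- by rewrite dotvZr ub2 mulr0.
- by rewrite dotvZr mulr_gt0// invr_gt0.
- move=> N Nl N0 Nu; have kn : k^-1 != 0 by rewrite invr_eq0 gt_eqF.
  rewrite dotvZr /b2 dotvZr !mulf_neq0 ?sgr_eq0// Nb1//.
  by apply: Hb0; rewrite inE mem_filter N0 Nl orbT.
Qed.

(** The line from which the rays are taken: tangent at [x] to the first region's boundary, and
    transversal to all boundaries of both pairs outside the window [a1 < s < a2]. Inside the window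
    the derivative of [g] across the line, in the direction [b], has a fixed sign and is bounded
    below, so a rotation pushes the whole window to one side. *)
Lemma good_line (R : realType) (n : nat) (S B : set 'rV[R]_n)
    (p1 p2 : activity_attenuation R n) x0 g d L e0 :
  (2 <= n)%N -> admissible_pair B p1 -> geometric_assumptions S B p1 ->
  admissible_pair B p2 -> geometric_assumptions S B p2 ->
  boundary (region p1) x0 -> boundary_chart (region p1) g x0 d L ->
  0 < e0 -> e0 <= d ->
  exists (x w b : 'rV[R]_n) (a1 a2 mu : R) (neg : bool),
    [/\ [/\ dotv w w = 1, dotv b b = 1 & dotv w b = 0],
        [/\ a1 < 0, 0 < a2, 0 < mu, g x = 0 & dotv (grad g x) w = 0],
        forall s, a1 <= s <= a2 -> `|x + s *: w - x0| < e0 /\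
          mu <= (-1) ^+ neg * dotv (grad g (x + s *: w)) b &
        forall s, ~ (a1 < s < a2) ->
          (forall o, boundary (piece (p := p1) o) (x + s *: w) ->
            transversal (piece (p := p1) o) (x + s *: w) w) /\
          (forall o, boundary (piece (p := p2) o) (x + s *: w) ->
            transversal (piece (p := p2) o) (x + s *: w) w)].
Proof.
move=> n2 Hp1 geo1 Hp2 geo2 bx0 ch0 e00 e0d.
have [qg0 sg0 Hg0] := ch0; have [d0 L0 _ _] := qg0.
have e02 : 0 < e0 / 2 by rewrite divr_gt0.
have [x1 [u0 [neg [r00 [x1x0 u0n gx1 r000 pos0]]]]] :=
  isolated_tangent n2 Hp1 geo1 bx0 ch0 e02.
pose k := Num.sqrt (dotv u0 u0).
have k0 : 0 < k by rewrite sqrtr_gt0 dotv_gt0.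
have kk : k * k = dotv u0 u0 by rewrite -expr2 sqr_sqrtr// dotv_ge0.
pose u := k^-1 *: u0.
have uu : dotv u u = 1.
  by rewrite dotvZl dotvZr -kk mulKf ?mulVf ?gt_eqF.
have un : u != 0 by rewrite scaler_eq0 negb_or invr_eq0 gt_eqF.
pose rho := r00 * k.
have rho0 : 0 < rho by rewrite mulr_gt0.
pose sg y := (-1) ^+ neg * g y.
pose sG y := (-1) ^+ neg *: grad g y.
have pos s : s != 0 -> `|s| <= rho -> 0 < sg (x1 + s *: u).
  move=> s0 sr; rewrite /u scalerA; apply: pos0.
    by rewrite mulf_neq0// invr_eq0 gt_eqF.
  by rewrite normrM normfV (gtr0_norm k0) ler_pdivrMr.
clearbody u; have x1d : `|x1 - x0| < d by lra.
pose d1 := d - `|x1 - x0|.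
have d10 : 0 < d1 by rewrite subr_gt0.
have qg1 : quadratic_near sg sG x1 d1 L.
  by apply: quadratic_sub (quadratic_sign neg qg0) _ _; rewrite // /d1; lra.
have sgx1 : sg x1 = 0 by rewrite /sg gx1 mulr0.
have Gu : dotv (sG x1) u = 0.
  apply: (quadratic_min qg1); exists rho => // s sr; rewrite sgx1.
  have [->|s0] := eqVneq s 0; first by rewrite scale0r addr0 sgx1.
  by apply: ltW; apply: pos => //; exact: ltW.
have G0 : sG x1 != 0.
  by rewrite /sG scaler_eq0 signr_eq0 /=; have [] := Hg0 x1 x1d.
(* All pieces of both pairs, handled as one finite family. *)
pose I := (option 'I_(nattn p1) + option 'I_(nattn p2))%type.
pose E (i : I) := match i with inl o => piece (p := p1) o | inr o => piece (p := p2) o end.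
have dE i : compact_smooth_domain (E i).
  by case: i => o; [exact: (piece_domain Hp1)|exact: (piece_domain Hp2)].
have chE (iy : I * 'rV[R]_n) : exists gdL : ('rV[R]_n -> R) * R * R,
    boundary (E iy.1) iy.2 -> boundary_chart (E iy.1) gdL.1.1 iy.2 gdL.1.2 gdL.2.
  have [bE|nbE] := pselect (boundary (E iy.1) iy.2); last by exists (g, d, L).
  have [g' [d' [L' H]]] := boundary_chart_exists (dE _) bE.
  by exists (g', d', L').
have [ch Hch] := boolp.choice chE.
have [a1 [b1 Hab1]] := two_tangents x1 geo1 un.
have [a2 [b2 Hab2]] := two_tangents x1 geo2 un.
(* Every tangency of the base line to either pair is among these points; [b] must be transversal to
   the boundaries there, which [Ns] ensures. *)
pose pts := [:: a1; b1; a2; b2].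
pose Ns := [seq grad (ch (i, y)).1.1 y | i <- enum {: I}, y <- pts].
have [b [bb ub vb Nb]] := @orthonormal_direction R n u (sG x1) Ns uu G0 Gu.
have tangent_pts i y : boundary (E i) y -> (exists t, y = x1 + t *: u) ->
    dotv (grad (ch (i, y)).1.1 y) u = 0 -> y \in pts.
  move=> bE line Nu; have hch := Hch (i, y) bE; have [[dd _ _ _] _ H] := hch.
  have yd : `|y - y| < (ch (i, y)).1.2 by rewrite subrr normr0.
  have [_ _ bz] := H y yd; have gy := bz.1 bE.
  rewrite /pts !inE; case: i {bz} bE Nu hch H yd gy dd => o bE Nu hch H yd gy _.
    have := @chart_line_tangent R n B p1 Hp1 o _ _ _ _ y x1 u hch yd gy Nu line.
    by move=> /Hab1[] ->; rewrite eqxx ?orbT.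
  have := @chart_line_tangent R n B p2 Hp2 o _ _ _ _ y x1 u hch yd gy Nu line.
  by move=> /Hab2[] ->; rewrite eqxx ?orbT.
have gap c : exists2 e, 0 < e & forall s, x1 + s *: u = c -> s = 0 \/ e <= `|s|.
  exact: point_gap.
have [ea ea0 Ha] := gap a1; have [eb eb0 Hb] := gap b1.
have [ec ec0 Hc] := gap a2; have [ed ed0 Hd] := gap b2.
have [em /andP[em0 emd] mono] := quadratic_mono qg1 vb.
set m := dotv (sG x1) b in mono vb.
pose W := `|u| + 2 * `|b| + 1.
have W0 : 0 < W by rewrite ltr_wpDl// addr_ge0// mulr_ge0.
(* With [r] below a quarter of each gap, every tangency of the base line other than [x1] has
   parameter larger than [2 * r]. The last two bounds keep the window in the [e0]-ball and where the
   derivative along [b] is at least [m / 2]. *)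
have [|e1 e10 /= /and5P[ea1 eb1 ec1 ed1 /and3P[ee1 em1 _]]] :=
    @small_pos R [:: ea / 4; eb / 4; ec / 4; ed / 4; e0 / 2 / W; em / W].
  by rewrite /= !divr_gt0.
have [r [tau [C [P [/andP[r0 re1] tau0 C0 lipC HP]]]]] :=
  tangent_family qg1 sgx1 vb rho0 pos e10.
pose Y t s := plane_pt x1 u b s (C t + t * s).
have [M M0 HM] := bounded_family (fun i => let: And3 h _ _ := dE i in h).
(* Beyond this parameter a line of the family meets no piece, so genericity is needed only for
   [r <= |s| <= Rb]. *)
pose Rb := n%:R * (M + `|x1|) * `|u| + r.
have Rbr : r <= Rb by rewrite /Rb lerDr !mulr_ge0// addr_ge0// ltW.
have tang i s0 : r <= `|s0| -> boundary (E i) (x1 + s0 *: u) -> exists g d L,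
     boundary_chart (E i) g (x1 + s0 *: u) d L /\
     (dotv (grad g (x1 + s0 *: u)) u != 0 \/
      dotv (grad g (x1 + s0 *: u)) b != 0 /\ 2 * r < `|s0|).
  move=> rs bE; set y := x1 + s0 *: u.
  have hch := Hch (i, y) bE; have [[dd _ _ _] _ H] := hch.
  exists (ch (i, y)).1.1, (ch (i, y)).1.2, (ch (i, y)).2; split=> //.
  have [Nu|] := eqVneq (dotv (grad (ch (i, y)).1.1 y) u) 0; last by left.
  have yd : `|y - y| < (ch (i, y)).1.2 by rewrite subrr normr0.
  have [Ngr _ _] := H y yd.
  right; have yp := tangent_pts i y bE (ex_intro _ s0 erefl) Nu; split.
    apply: Nb => //; apply/allpairsP; exists (i, y); split=> //=.
    by rewrite mem_enum.
  have s0n : s0 <> 0.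
    by move=> s0E; move: rs r0; rewrite s0E normr0; clear; lra.
  move: yp; rewrite /pts !inE => /or4P[] /eqP yE.
  - by case: (Ha s0 yE) => //; move: re1 ea1 r0; clear; lra.
  - by case: (Hb s0 yE) => //; move: re1 eb1 r0; clear; lra.
  - by case: (Hc s0 yE) => //; move: re1 ec1 r0; clear; lra.
  - by case: (Hd s0 yE) => //; move: re1 ed1 r0; clear; lra.
have [de [A [de0 tA HA]]] : exists de A, [/\ 0 < de, thin A &
    forall t, `|t| < de -> ~ A t -> forall i, forall s, r <= `|s| -> `|s| <= Rb ->
      boundary (E i) (Y t s) -> transversal (E i) (Y t s) (u + t *: b)].
  apply: thin_family => i.
  have [|dp [Ap [dp0 tAp HAp]]] :=
      @generic_tangency_segment R n x1 u b C r tau r0 tau0 C0 lipC (E i) r Rb Rbr.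
    move=> s0 rs _; apply: tang.
    by rewrite ger0_norm//; move: rs r0; clear; lra.
  have Rbr' : - Rb <= - r by rewrite lerN2.
  have [|dm [Am [dm0 tAm HAm]]] :=
      @generic_tangency_segment R n x1 u b C r tau r0 tau0 C0 lipC (E i) (- Rb) (- r) Rbr'.
    move=> s0 _ rs; apply: tang.
    by rewrite ler0_norm; move: rs r0; clear; lra.
  exists (Num.min dp dm), (Ap `|` Am); split; first by rewrite lt_min dp0.
    exact: thin_setU.
  move=> t; rewrite lt_min => /andP[tp tm] /not_orP[np nm] s rs sR.
  have [s0|s0] := leP 0 s.
    by apply: HAp => //; move: rs sR; rewrite !ger0_norm// => -> ->.
  apply: HAm => //; move: rs sR; rewrite !ltr0_norm//; clear => ? ?.
  by apply/andP; split; lra.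
(* Turning [b] into [b'] subtracts [t] times the derivative along [u], which vanishes at [x1] and is
   thus at most [K]; for [|t| <= m / (4 * K)] this costs at most [m / 4]. *)
pose K := L * d1 * `|u| + 1.
have K0 : 0 < K by rewrite ltr_wpDl// !mulr_ge0// ltW.
have [|f f0 /= /and5P[f1 fde ftau fK _]] :=
    @small_pos R [:: 1; de; tau; m / (4 * K)].
  by rewrite /= ltr01 de0 tau0 divr_gt0// mulr_gt0.
have [t tf nA] := thin_not_interval f0 tA.
have t1 : `|t| < 1 by exact: lt_le_trans f1.
have ttau : `|t| < tau by exact: lt_le_trans ftau.
have [Pr gx Gx] := HP t ttau.
pose ka := Num.sqrt (1 + t ^+ 2).
have kp : 0 < 1 + t ^+ 2 by rewrite ltr_pwDl// sqr_ge0.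
have ka0 : 0 < ka by rewrite sqrtr_gt0.
have kaka : ka * ka = 1 + t ^+ 2 by rewrite -expr2 sqr_sqrtr// ltW.
pose w := ka^-1 *: (u + t *: b).
pose b' := ka^-1 *: (b - t *: u).
pose x := plane_pt x1 u b (P t) (C t + t * P t).
have bu : dotv b u = 0 by rewrite dotvC.
have xY s : x + s *: w = Y t (P t + s / ka).
  by rewrite /x /w /Y /plane_pt; apply/rowP => i; rewrite !mxE; ring.
have Ct : `|C t| <= r * `|t|.
  by have := lipC t 0 ttau (_ : `|0| < tau); rewrite normr0 C0 !subr0; apply.
have Ynear s : `|s| <= r -> `|Y t s - x1| < e0 / 2 /\ `|Y t s - x1| < em.
  move=> sr; have h : `|Y t s - x1| <= r * (`|u| + 2 * `|b|).
    apply: le_trans (plane_pt_base _ _ _ _ _) _.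
    rewrite mulrDr; apply: lerD; first by rewrite ler_wpM2r.
    rewrite mulrA ler_wpM2r//; apply: le_trans (ler_normD _ _) _; rewrite normrM.
    have : `|t| * `|s| <= 1 * r by rewrite ler_pM// ltW.
    have : r * `|t| <= r * 1 by rewrite ler_wpM2l// ltW.
    move: Ct; clear; lra.
  have h2 : r * (`|u| + 2 * `|b|) < e1 * W.
    apply: (@le_lt_trans _ _ (r * W)); last by rewrite ltr_pM2r.
    by rewrite ler_wpM2l ?(ltW r0)// /W lerDl.
  move: ee1 em1 h h2; rewrite !ler_pdivlMr//; clear; lra.
(* Parameters are now arclengths measured from the contact point: position [s] on the new line is
   [P t + s / ka] on the old scale, so this is the window of old parameters in [[- r, r]]. The bound
   is [m / 2 - m / 4], rescaled by the length [ka] of [u + t *: b]. *)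
exists x, w, b', ((- r - P t) * ka), ((r - P t) * ka),
  (ka^-1 * (m / 4)), neg.
have ww : dotv (u + t *: b) (u + t *: b) = 1 + t ^+ 2.
  by rewrite !dotvDr !dotvDl !dotvZr !dotvZl uu bb ub bu; ring.
have bb' : dotv (b - t *: u) (b - t *: u) = 1 + t ^+ 2.
  by rewrite !dotvDr !dotvDl !dotvNr !dotvNl !dotvZr !dotvZl uu bb ub bu; ring.
have wb : dotv (u + t *: b) (b - t *: u) = 0.
  by rewrite !dotvDr !dotvDl !dotvNr !dotvZr !dotvZl uu bb ub bu; ring.
have inner s : (- r - P t) * ka <= s <= (r - P t) * ka -> `|P t + s / ka| <= r.
  move=> /andP[]; rewrite -ler_pdivlMr// => h1; rewrite -ler_pdivrMr// => h2.
  by rewrite ler_norml; move: h1 h2; clear => ? ?; apply/andP; split; lra.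
have outer s : ~ ((- r - P t) * ka < s < (r - P t) * ka) -> r <= `|P t + s / ka|.
  move=> no; rewrite leNgt; apply/negP; rewrite ltr_norml => /andP[h1 h2]; apply: no.
  have : - r - P t < s / ka by move: h1; clear; lra.
  have : s / ka < r - P t by move: h2; clear; lra.
  by rewrite ltr_pdivlMr// ltr_pdivrMr// => -> ->.
have kne : ka != 0 by rewrite gt_eqF.
split.
- rewrite !dotvZl !dotvZr ww bb' wb -kaka !mulr0; split=> //; by field.
- move: Pr; rewrite ltr_norml => /andP[P1 P2]; split.
  + by rewrite pmulr_llt0//; move: P1; clear; lra.
  + by rewrite mulr_gt0//; move: P2; clear; lra.
  + by rewrite mulr_gt0 ?invr_gt0// divr_gt0.
  + by move/eqP: gx; rewrite mulf_eq0 signr_eq0 => /eqP.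
  + by rewrite dotvZr (dotv_sign_eq0 Gx) mulr0.
- move=> s /inner sr; rewrite xY; have [h1 h2] := Ynear _ sr; split.
    rewrite -(subrK x1 (Y _ _)) -addrA; apply: le_lt_trans (ler_normD _ _) _.
    by move: h1 x1x0; clear; lra.
  rewrite dotvZr [leRHS]mulrCA -dotvZl -/(sG _) ler_wpM2l ?invr_ge0 ?(ltW ka0)//.
  have [mh _] := mono _ 0 h2.
  rewrite dotvDr dotvNr dotvZr.
  have [_ _ _ Q2] := qg1.
  have := Q2 x1 (Y t (P t + s / ka)) u.
  rewrite subrr normr0 Gu subr0 => /(_ d10 (lt_le_trans h2 emd)) h3.
  have h4 : `|t * dotv (sG (Y t (P t + s / ka))) u| <= m / 4.
    rewrite normrM; have : `|t| <= m / (4 * K) by apply: ltW; exact: lt_le_trans fK.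
    rewrite ler_pdivlMr ?mulr_gt0// => h5.
    have : L * `|Y t (P t + s / ka) - x1| * `|u| <= L * d1 * `|u|.
      by rewrite ler_wpM2r// ler_wpM2l// ltW// (lt_le_trans h2 emd).
    move=> h6.
    have : `|t| * `|dotv (sG (Y t (P t + s / ka))) u| <= `|t| * K.
      by rewrite ler_wpM2l// /K; move: h3 h6; clear; lra.
    by move: h5; clear; lra.
  have := ler_norm (t * dotv (sG (Y t (P t + s / ka))) u).
  by move: mh h4 vb; rewrite -/m; clear; lra.
- move=> s /outer rs; rewrite xY.
  have key i : boundary (E i) (Y t (P t + s / ka)) ->
      transversal (E i) (Y t (P t + s / ka)) w.
    move=> bE.
    have EY : E i (Y t (P t + s / ka)).
      by apply: boundary_sub bE; exact: domain_closed.
    have sR : `|P t + s / ka| <= Rb.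
      set s' := P t + _ in EY *.
      have -> : s' = dotv (Y t s' - x1) u.
        have -> : Y t s' - x1 = s' *: u + (C t + t * s') *: b.
          by rewrite /Y /plane_pt; apply/rowP => j; rewrite !mxE; ring.
        by rewrite dotvDl !dotvZl uu bu mulr0 addr0 mulr1.
      apply: le_trans (dotv_norm _ _) _; rewrite /Rb.
      have : `|Y t s' - x1| <= M + `|x1|.
        by apply: le_trans (ler_normB _ _) _; rewrite lerD2r; exact: HM EY.
      move=> h; have : n%:R * `|Y t s' - x1| * `|u| <= n%:R * (M + `|x1|) * `|u|.
        by rewrite ler_wpM2r// ler_wpM2l.
      by move: r0; clear; lra.
    have [g' [d' [L' [h1 h2]]]] := HA t (lt_le_trans tf fde) nA i _ rs sR bE.
    by exists g', d', L'; split=> //; rewrite dotvZr mulf_neq0 ?invr_neq0.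
  by split=> o; [exact: (key (inl o))|exact: (key (inr o))].
Qed.

(** * Rotating a ray *)

(* The rational parametrisation of the circle avoids trigonometric functions. *)
Definition rotated (R : realType) (n : nat) (w b : 'rV[R]_n) (t : R) : 'rV[R]_n :=
  ((1 - t ^+ 2) / (1 + t ^+ 2)) *: w + (2 * t / (1 + t ^+ 2)) *: b.

Lemma onesqr_gt0 (R : realType) (t : R) : 0 < 1 + t ^+ 2.
Proof. by rewrite ltr_pwDl// sqr_ge0. Qed.

Lemma rotated0 (R : realType) (n : nat) (w b : 'rV[R]_n) : rotated w b 0 = w.
Proof.
rewrite /rotated expr0n /= subr0 addr0 divr1 scale1r mulr0 mul0r scale0r.
by rewrite addr0.
Qed.

Lemma rotated_unit (R : realType) (n : nat) (w b : 'rV[R]_n) t :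
  dotv w w = 1 -> dotv b b = 1 -> dotv w b = 0 ->
  enorm (rotated w b t) = 1.
Proof.
move=> ww bb wb; have bw : dotv b w = 0 by rewrite dotvC.
rewrite /enorm /rotated !dotvDr !dotvDl !dotvZr !dotvZl ww bb wb bw.
rewrite -[RHS]sqrtr1; congr Num.sqrt; field.
by rewrite gt_eqF// onesqr_gt0.
Qed.

Lemma rotated_sub (R : realType) (n : nat) (w b : 'rV[R]_n) t :
  rotated w b t - w =
  (2 * t / (1 + t ^+ 2)) *: b - (2 * t ^+ 2 / (1 + t ^+ 2)) *: w.
Proof.
have k0 : 1 + t ^+ 2 != 0 by rewrite gt_eqF// onesqr_gt0.
rewrite /rotated; apply/rowP => i; rewrite !mxE; field; exact: k0.
Qed.

Lemma rotated_dist (R : realType) (n : nat) (w b : 'rV[R]_n) t :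
  `|t| <= 1 -> `|rotated w b t - w| <= 2 * `|t| * (`|w| + `|b|).
Proof.
move=> t1; rewrite rotated_sub.
apply: le_trans (ler_normB _ _) _; rewrite !normrZ [leLHS]addrC mulrDr.
have k1 : 1 <= 1 + t ^+ 2 by rewrite lerDl sqr_ge0.
have k0 : 0 < 1 + t ^+ 2 := onesqr_gt0 t.
have tt : t ^+ 2 <= `|t|.
  by rewrite -real_normK ?num_real// expr2 ler_piMl.
apply: lerD; rewrite ler_wpM2r//.
  rewrite normfV (gtr0_norm k0) (ger0_norm (ler0n _ 2)) ler_pdivrMr//.
  rewrite -mulrA ler_wpM2l// ler_wpM2l//; exact: le_trans k1.
rewrite normfV (gtr0_norm k0) (ger0_norm (ler0n _ 2)) ler_pdivrMr//.
by rewrite -[leLHS]mulr1 ler_wpM2l// mulr_ge0.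
Qed.

Lemma ray_dist (R : realType) (n : nat) (v w b : 'rV[R]_n) t rho : 0 <= rho -> `|t| <= 1 ->
  `|(v + rho *: rotated w b t) - (v + rho *: w)| <=
    rho * (2 * `|t| * (`|w| + `|b|)).
Proof.
move=> r0 t1; have -> : v + rho *: rotated w b t - (v + rho *: w) =
    rho *: (rotated w b t - w).
  by rewrite opprD addrACA subrr add0r scalerBr.
by rewrite normrZ ger0_norm// ler_wpM2l// rotated_dist.
Qed.

(* Away from J = (a, c), membership in E changes under rotation only within       *)
(* distance O(t) of finitely many parameters.                                     *)
Definition stable_between (R : realType) (n : nat) (v w b : 'rV[R]_n)
    (E : set 'rV[R]_n) (a c y z : R) : Prop :=
  exists (l : seq R) (K de : R), [/\ 0 <= K, 0 < de &
    forall t rho, `|t| < de -> y <= rho <= z -> ~ (a < rho < c) ->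
      (forall i, i \in l -> K * `|t| < `|rho - i|) ->
      (E (v + rho *: rotated w b t) <-> E (v + rho *: w))].

(** Near an interior or exterior point membership is constant, and inside the window nothing is
    claimed. At a transversal crossing [|g|] on the ray is at least [m / 2] times the distance to
    [rho1], whereas the rotation changes [g] by O(t): the sign can flip only within O(t) of
    [rho1]. *)
Lemma stable_between_local (R : realType) (n : nat) (v w b : 'rV[R]_n)
    (E : set 'rV[R]_n) (a c rho1 : R) :
  compact_smooth_domain E -> 0 <= rho1 ->
  (~ (a < rho1 < c) -> boundary E (v + rho1 *: w) ->
     transversal E (v + rho1 *: w) w) ->
  exists2 d, 0 < d & forall y z, 0 <= y -> `|y - rho1| < d -> `|z - rho1| < d ->
    stable_between v w b E a c y z.
Proof.
move=> dE r10 tr; set y1 := v + rho1 *: w in tr.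
have [/andP[ar rc]|nJ] := pselect (a < rho1 < c).
  exists (Num.min (rho1 - a) (c - rho1)); first by rewrite lt_min !subr_gt0 ar.
  move=> y z y0; rewrite !lt_min => /andP[y1' _] /andP[_ z1].
  exists [::], 0, 1; split=> // t rho _ /andP[yr rz] []; apply/andP.
  by move: y1' z1; rewrite !ltr_norml => /andP[? ?] /andP[? ?]; split; lra.
pose W := `|w| + `|b|.
have W0 : 0 <= W by rewrite addr_ge0.
have near e : 0 < e -> exists2 de, 0 < de & de <= 1 /\ forall t rho, 0 <= rho ->
    `|t| < de -> `|rho - rho1| < de ->
    `|v + rho *: rotated w b t - y1| < e /\ `|v + rho *: w - y1| < e.
  move=> e0; pose M := (rho1 + 1) * (2 * W) + `|w| + 1.
  have M0 : 0 < M.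
    by rewrite ltr_wpDl// addr_ge0// mulr_ge0// ?mulr_ge0// addr_ge0.
  have [|de de0 /= /and3P[d1 dM _]] := @small_pos R [:: 1; e / M].
    by rewrite /= ltr01 divr_gt0.
  exists de => //; split=> // t rho rho0 td rd.
  have h1 : `|v + rho *: w - y1| <= de * `|w|.
    have -> : v + rho *: w - y1 = (rho - rho1) *: w.
      by rewrite /y1 opprD addrACA subrr add0r scalerBl.
    by rewrite normrZ ler_wpM2r// ltW.
  have h2 := ray_dist v w b rho0 (le_trans (ltW td) d1).
  have h3 : rho * (2 * `|t| * (`|w| + `|b|)) <= (rho1 + 1) * (2 * de * W).
    rewrite ler_pM// ?mulr_ge0//.
      by move: rd; rewrite ltr_norml => /andP[_]; move: d1; clear; lra.
    by rewrite ler_wpM2r// ler_wpM2l// ltW.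
  have h4 : de * M <= e by rewrite -ler_pdivlMr.
  have h5 : 0 <= (rho1 + 1) * (2 * de * W).
    by rewrite !mulr_ge0 ?addr_ge0// ltW.
  split; last first.
    apply: le_lt_trans h1 _; apply: lt_le_trans h4; rewrite /M.
    by move: de0 h5; clear; lra.
  rewrite -(subrK (v + rho *: w) (v + rho *: rotated _ _ _)) -addrA.
  apply: le_lt_trans (ler_normD _ _) _.
  apply: lt_le_trans h4; rewrite /M.
  by move: h1 h2 h3 de0; clear; lra.
have constant (P : Prop) : (\forall z \near y1, E z <-> P) ->
    exists2 d, 0 < d & forall y z, 0 <= y -> `|y - rho1| < d -> `|z - rho1| < d ->
    stable_between v w b E a c y z.
  move=> /near_normP[e e0 He]; have [de de0 [_ Hde]] := near e e0.
  exists de => // y z y0 yd zd; exists [::], 0, de; split=> // t rho td /andP[yr rz] _ _.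
  have rd : `|rho - rho1| < de.
    move: yd zd; rewrite !ltr_norml => /andP[? ?] /andP[? ?].
    by apply/andP; split; lra.
  have [h1 h2] := Hde t rho (le_trans y0 yr) td rd.
  by rewrite (He _ h1) (He _ h2).
have cE := domain_closed dE.
have [Ey1|nEy1] := pselect (E y1); last first.
  apply: (constant False).
  have : \forall z \near y1, (~` E) z.
    by apply: open_nbhs_nbhs; split=> //; exact: closed_openC.
  by apply: filterS => z nEz; split=> // /nEz.
have [iE|niE] := pselect (interior E y1).
  by apply: (constant True); move: iE; apply: filterS => z Ez; split.
have [g [d [L [[qg sg Hg] gw]]]] := tr nJ (conj (subset_closure Ey1) niE).
have [d0 L0 Q1 _] := qg.
have [Kl Kl0 lip] := quadratic_lipschitz qg.
set m := `|dotv (grad g y1) w|.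
have m0 : 0 < m by rewrite normr_gt0.
have y1d : `|y1 - y1| < d by rewrite subrr normr0.
have gy1 : g y1 = 0.
  have [_ _ bz] := Hg y1 y1d; apply/bz; split=> //; exact: subset_closure.
have [de1 de10 [de11 Hde1]] := near d d0.
pose Q := L * `|w| ^+ 2.
have Q0 : 0 <= Q by rewrite mulr_ge0 ?exprn_ge0.
have [|de de0 /= /and3P[ded deQ _]] := @small_pos R [:: de1; m / (2 * (Q + 1))].
  by rewrite /= de10 divr_gt0// mulr_gt0// ltr_wpDl.
pose K := Kl * ((rho1 + 1) * (2 * W)) / (m / 2).
have K0 : 0 <= K.
  by rewrite /K divr_ge0 ?mulr_ge0 ?addr_ge0 ?(ltW m0).
exists de => // y z y0 yd zd; exists [:: rho1], K, de; split=> // t rho td /andP[yr rz] _.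
move=> /(_ rho1 (mem_head _ _)) far.
have rd : `|rho - rho1| < de.
  move: yd zd; rewrite !ltr_norml => /andP[? ?] /andP[? ?].
  by apply/andP; split; lra.
have rho0 := le_trans y0 yr.
have [h1 h2] := Hde1 t rho rho0 (lt_le_trans td ded) (lt_le_trans rd ded).
have [_ E1 _] := Hg _ h1; have [_ E2 _] := Hg _ h2.
set y' := v + rho *: w in h2 E2 *; set z' := v + _ in h1 E1 *.
have A := Q1 _ _ y1d h2.
have yE : y' - y1 = (rho - rho1) *: w.
  by rewrite /y1 /y' opprD addrACA subrr add0r scalerBl.
rewrite gy1 subr0 yE dotvZr normrZ exprMn in A.
have B : `|rho - rho1| * (m / 2) <= `|g y'|.
  have q1 : L * (`|rho - rho1| ^+ 2 * `|w| ^+ 2) <= `|rho - rho1| * (m / 2).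
    have -> : L * (`|rho - rho1| ^+ 2 * `|w| ^+ 2) =
      `|rho - rho1| * (`|rho - rho1| * Q) by rewrite /Q; ring.
    rewrite ler_wpM2l//; apply: (@le_trans _ _ (de * Q)).
      by rewrite ler_wpM2r// ltW.
    move: deQ; rewrite ler_pdivlMr; last by rewrite mulr_gt0// ltr_wpDl.
    by move: de0; clear; lra.
  have q2 := ler_normB (g y') (g y' - (rho - rho1) * dotv (grad g y1) w).
  have q3 : `|g y' - (g y' - (rho - rho1) * dotv (grad g y1) w)| = `|rho - rho1| * m.
    by rewrite opprB addrC subrK normrM.
  by rewrite q3 in q2; move: q1 q2 A; clear; lra.
have D : `|g z' - g y'| <= K * `|t| * (m / 2).
  apply: le_trans (lip _ _ h2 h1) _.
  have -> : K * `|t| * (m / 2) = Kl * ((rho1 + 1) * (2 * `|t| * W)).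
    by rewrite /K; field; rewrite gt_eqF.
  rewrite ler_wpM2l//; apply: le_trans (ray_dist _ _ _ rho0 _) _.
    by apply: ltW; exact: lt_le_trans td (le_trans ded de11).
  rewrite ler_wpM2r ?mulr_ge0//.
  by move: rd ded de11; rewrite ltr_norml => /andP[_]; clear; lra.
have F : `|g z' - g y'| < `|g y'|.
  apply: le_lt_trans D _; apply: lt_le_trans B.
  by rewrite ltr_pM2r// divr_gt0.
rewrite E1 E2; move: F; rewrite ltr_norml => /andP[F1 F2].
have [gy|gy] := leP (g y') 0; [rewrite ler0_norm// in F1 F2|rewrite gtr0_norm// in F1 F2].
  by split=> // _; move: F1 F2; clear; lra.
split=> [gz|//].
by move: gz F1 F2; clear; lra.
Qed.

Lemma stable_between_ray (R : realType) (n : nat) (v w b : 'rV[R]_n)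
    (E : set 'rV[R]_n) (a c r : R) :
  compact_smooth_domain E -> 0 <= r ->
  (forall rho, 0 <= rho -> rho <= r -> ~ (a < rho < c) -> boundary E (v + rho *: w) ->
     transversal E (v + rho *: w) w) ->
  stable_between v w b E a c 0 r.
Proof.
move=> dE r0 tr; apply: segment_gluing => //.
- move=> x y z xy yz [l1 [K1 [d1 [K10 d10 H1]]]] [l2 [K2 [d2 [K20 d20 H2]]]].
  exists (l1 ++ l2), (Num.max K1 K2), (Num.min d1 d2).
  split; [by rewrite le_max K10|by rewrite lt_min d10|].
  move=> t rho; rewrite lt_min => /andP[t1 t2] /andP[xr rz] nJ far.
  have lem K i : K <= Num.max K1 K2 -> Num.max K1 K2 * `|t| < `|rho - i| ->
      K * `|t| < `|rho - i|.
    by move=> KK; apply: le_lt_trans; rewrite ler_wpM2r.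
  have [ry|yr] := leP rho y.
    apply: H1 => //; first by rewrite xr.
    by move=> i il; apply: lem; [rewrite le_max lexx|apply: far; rewrite mem_cat il].
  apply: H2 => //; first by rewrite ltW.
  by move=> i il; apply: lem; [rewrite le_max lexx orbT|
    apply: far; rewrite mem_cat il orbT].
- move=> rho1 p0 pr; have [d d0 Hd] := stable_between_local b dE p0 (tr rho1 p0 pr).
  by exists d => // y z y0 _ _ yd zd; exact: Hd.
Qed.

(** To first order the rotation moves the point by [2 * rho * t] in the direction [b], so on the
    whole window it raises or lowers [g] by at least [rho * |t| * (mu / 2)], according to the sign.
    Near the tangency [g] is quadratically small in [rho - rho0]: within order sqrt |t| this shift
    overrides it and decides membership. *)
Lemma tangency_window (R : realType) (n : nat) (v w b : 'rV[R]_n)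
    (E : set 'rV[R]_n) x0 g d L e a c rho0 mu (neg : bool) :
  boundary_chart E g x0 d L -> e < d -> 0 < a -> a < rho0 < c -> 0 < mu ->
  (forall rho, a <= rho <= c -> `|v + rho *: w - x0| < e /\
     mu <= (-1) ^+ neg * dotv (grad g (v + rho *: w)) b) ->
  g (v + rho0 *: w) = 0 -> dotv (grad g (v + rho0 *: w)) w = 0 ->
  exists de ka, [/\ 0 < de, 0 < ka & forall t rho, `|t| < de -> a <= rho <= c ->
    [/\ 0 < (-1) ^+ neg * t -> E (v + rho *: rotated w b t) -> E (v + rho *: w),
        (-1) ^+ neg * t < 0 -> E (v + rho *: w) -> E (v + rho *: rotated w b t) &
        (rho - rho0) ^+ 2 <= ka * `|t| ->
          (0 < (-1) ^+ neg * t -> ~ E (v + rho *: rotated w b t)) /\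
          ((-1) ^+ neg * t < 0 -> E (v + rho *: rotated w b t))]].
Proof.
move=> [qg _ Hg] ed a0 /andP[ar rc] mu0 Hac g0 Gw.
have [d0 L0 Q1 Q2] := qg; set s : R := (-1) ^+ neg.
have ss : s * s = 1 by rewrite -expr2 sqrr_sign.
have c0 : 0 < c by lra.
pose W := `|w| + `|b|.
have W0 : 0 <= W by rewrite addr_ge0.
pose Gb := n%:R * `|grad g x0| * `|w| + L * d * `|w|.
have Gb0 : 0 <= Gb by rewrite addr_ge0 ?mulr_ge0// ltW.
(* [V] collects the second-order effects of the rotation: the component along [w] and the error of
   the expansion of [g]. For [|t| < de] they use up at most half of [mu]. *)
pose V := 2 * Gb + 8 * L * c * W ^+ 2.
have V0 : 0 <= V by rewrite addr_ge0 ?mulr_ge0 ?exprn_ge0// ltW.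
have cW : 0 <= c * (2 * W) by rewrite !mulr_ge0// ltW.
have [|de de0 /= /and4P[de1 ded deV _]] :=
  @small_pos R [:: 1; (d - e) / (c * (2 * W) + 1); mu / (2 * (V + 1))].
  by rewrite /= ltr01 !divr_gt0 ?subr_gt0 ?mulr_gt0 ?ltr_wpDl.
(* Chosen so that [|g| <= L * |w|^2 * (rho - rho0)^2] is at most [a * |t| * (mu / 4)], strictly less
   than the shift when [t] is nonzero. *)
pose ka := a * mu / (4 * (L * `|w| ^+ 2 + 1)).
have Lw : 0 <= L * `|w| ^+ 2 by rewrite mulr_ge0 ?exprn_ge0.
have ka0 : 0 < ka by rewrite divr_gt0 ?mulr_gt0// ltr_wpDl.
exists de, ka; split=> // t rho td rac.
have [yx Gy] := Hac rho rac.
have [ar' rc'] := andP rac.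
have rho00 : 0 < rho by exact: lt_le_trans ar'.
have t1 : `|t| <= 1 by apply: ltW; exact: lt_le_trans de1.
set y := v + rho *: w in yx Gy *; set z := v + rho *: rotated w b t.
have zy : `|z - y| <= rho * (2 * `|t| * W) by apply: ray_dist => //; exact: ltW.
have yd : `|y - x0| < d by exact: lt_trans ed.
have zd : `|z - x0| < d.
  rewrite -(subrK y z) -addrA; apply: le_lt_trans (ler_normD _ _) _.
  have : rho * (2 * `|t| * W) <= `|t| * (c * (2 * W)).
    have -> : rho * (2 * `|t| * W) = rho * (2 * W * `|t|) by ring.
    have -> : `|t| * (c * (2 * W)) = c * (2 * W * `|t|) by ring.
    by rewrite ler_wpM2r ?mulr_ge0.
  have : `|t| * (c * (2 * W)) <= de * (c * (2 * W)) by rewrite ler_wpM2r// ltW.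
  move: ded; rewrite ler_pdivlMr ?ltr_wpDl//.
  by move: zy yx de0; clear; lra.
have [_ Ey _] := Hg y yd; have [_ Ez _] := Hg z zd.
have Gyw : `|dotv (grad g y) w| <= Gb.
  have x0d : `|x0 - x0| < d by rewrite subrr normr0.
  have h := Q2 _ _ w x0d yd.
  have h2 : L * `|y - x0| * `|w| <= L * d * `|w|.
    by rewrite ler_wpM2r// ler_wpM2l// ltW.
  have h3 := dotv_norm (grad g x0) w.
  rewrite -(subrK (dotv (grad g x0) w) (dotv _ w)).
  apply: le_trans (ler_normD _ _) _; rewrite /Gb.
  by move: h h2 h3; clear; lra.
have k0 : 0 < 1 + t ^+ 2 := onesqr_gt0 t.
have k2 : 1 + t ^+ 2 <= 2.
  by rewrite -real_normK ?num_real//; have : `|t| ^+ 2 <= 1; [rewrite expr_le1|clear; lra].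
have zyE : z - y = rho *: ((2 * t / (1 + t ^+ 2)) *: b - (2 * t ^+ 2 / (1 + t ^+ 2)) *: w).
  by rewrite -rotated_sub /z /y opprD addrACA subrr add0r scalerBr.
have A := Q1 _ _ yd zd.
have err : L * `|z - y| ^+ 2 <= rho * `|t| * (4 * L * c * W ^+ 2 * `|t|).
  have -> : rho * `|t| * (4 * L * c * W ^+ 2 * `|t|) =
    L * (rho * (2 * `|t| * W)) * (c * (2 * `|t| * W)) by ring.
  have zyc : `|z - y| <= c * (2 * `|t| * W).
    by apply: le_trans zy _; rewrite ler_wpM2r ?mulr_ge0.
  have -> : L * `|z - y| ^+ 2 = L * `|z - y| * `|z - y| by ring.
  exact: (ler_pM (mulr_ge0 L0 (normr_ge0 _)) (normr_ge0 _) (ler_wpM2l L0 zy) zyc).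
have t0V : `|t| * (V + 1) <= mu / 2.
  move: deV; rewrite ler_pdivlMr; last by rewrite mulr_gt0// ltr_wpDl.
  move=> h; have : `|t| * (V + 1) <= de * (V + 1).
    by apply: ler_wpM2r; [exact: addr_ge0|exact: ltW].
  by move: h; clear; lra.
have dz : dotv (grad g y) (z - y) = rho * (2 / (1 + t ^+ 2)) *
    (s * t * (s * dotv (grad g y) b) - t ^+ 2 * dotv (grad g y) w).
  rewrite zyE dotvZr dotvDr dotvNr !dotvZr mulrACA ss mul1r.
  by field; rewrite gt_eqF.
have k12 : 1 <= 2 / (1 + t ^+ 2) by rewrite ler_pdivlMr// mul1r.
have t2G : `|t ^+ 2 * dotv (grad g y) w| <= `|t| * (`|t| * Gb).
  by rewrite normrM normrX expr2 -mulrA ler_wpM2l// ler_wpM2l.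
have V2 : `|t| * Gb + 4 * L * c * W ^+ 2 * `|t| <= mu / 2.
  have -> : `|t| * Gb + 4 * L * c * W ^+ 2 * `|t| = `|t| * V / 2.
    by rewrite /V; field.
  have : 0 <= `|t| * V by rewrite mulr_ge0.
  by move: t0V; rewrite mulrDr; have := normr_ge0 t; clear; lra.
have rt0 : 0 <= rho * `|t| by rewrite mulr_ge0// ltW.
have err0 : 0 <= 4 * L * c * W ^+ 2 * `|t|.
  by rewrite !mulr_ge0// ltW.
have up : 0 < s * t -> rho * `|t| * (mu / 2) <= g z - g y.
  move=> st; have stE : s * t = `|t|.
    by rewrite -(gtr0_norm st) normrM /s normr_sign mul1r.
  have h : `|t| * (mu - `|t| * Gb) <= s * t * (s * dotv (grad g y) b) -
      t ^+ 2 * dotv (grad g y) w.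
    rewrite stE mulrBr lerB//; first by rewrite ler_wpM2l.
    by apply: le_trans t2G; exact: ler_norm.
  have h0 : 0 <= mu - `|t| * Gb by move: V2 err0 mu0; clear; lra.
  have h1 : rho * (`|t| * (mu - `|t| * Gb)) <= dotv (grad g y) (z - y).
    rewrite dz -mulrA ler_pM2l//.
    apply: (le_trans h); rewrite ler_peMl//.
    by apply: le_trans h; rewrite mulr_ge0.
  have h2 : rho * `|t| * (mu / 2) <=
      rho * (`|t| * (mu - `|t| * Gb)) - rho * `|t| * (4 * L * c * W ^+ 2 * `|t|).
    have -> : rho * (`|t| * (mu - `|t| * Gb)) - rho * `|t| * (4 * L * c * W ^+ 2 * `|t|)
      = rho * `|t| * (mu - (`|t| * Gb + 4 * L * c * W ^+ 2 * `|t|)) by ring.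
    by rewrite ler_wpM2l//; move: V2; clear; lra.
  by move: A; rewrite ler_norml => /andP[A1 _]; move: A1 h1 h2 err; clear; lra.
have down : s * t < 0 -> g z - g y <= - (rho * `|t| * (mu / 2)).
  move=> st; have stE : s * t = - `|t|.
    by rewrite -[LHS]opprK -(ltr0_norm st) normrM /s normr_sign mul1r.
  have h : s * t * (s * dotv (grad g y) b) - t ^+ 2 * dotv (grad g y) w <=
      - (`|t| * (mu - `|t| * Gb)).
    rewrite stE mulrBr opprB addrC mulNr lerB//; last by rewrite ler_wpM2l.
    by apply: le_trans t2G; rewrite -normrN; exact: ler_norm.
  have h0 : 0 <= mu - `|t| * Gb by move: V2 err0 mu0; clear; lra.
  have h1 : dotv (grad g y) (z - y) <= - (rho * (`|t| * (mu - `|t| * Gb))).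
    rewrite dz -mulrA -[leRHS]mulrN ler_pM2l//.
    apply: (le_trans _ h); rewrite ler_neMl//.
    by apply: le_trans h _; rewrite oppr_le0 mulr_ge0.
  have h2 : rho * `|t| * (mu / 2) <=
      rho * (`|t| * (mu - `|t| * Gb)) - rho * `|t| * (4 * L * c * W ^+ 2 * `|t|).
    have -> : rho * (`|t| * (mu - `|t| * Gb)) - rho * `|t| * (4 * L * c * W ^+ 2 * `|t|)
      = rho * `|t| * (mu - (`|t| * Gb + 4 * L * c * W ^+ 2 * `|t|)) by ring.
    by rewrite ler_wpM2l//; move: V2; clear; lra.
  by move: A; rewrite ler_norml => /andP[_ A1]; move: A1 h1 h2 err; clear; lra.
have rm0 : 0 <= rho * `|t| * (mu / 2) by rewrite mulr_ge0// divr_ge0// ltW.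
split.
- by move=> /up h /Ez gz; apply/Ey; move: h gz rm0; clear; lra.
- by move=> /down h /Ey gy; apply/Ez; move: h gy rm0; clear; lra.
- move=> win.
  have gy : `|g y| <= a * `|t| * (mu / 4).
    set y0 := v + rho0 *: w in g0 Gw.
    have [|y0x _] := Hac rho0; first by rewrite !ltW.
    have B := Q1 _ _ (lt_trans y0x ed) yd.
    have yy0 : y - y0 = (rho - rho0) *: w.
      by rewrite /y /y0 opprD addrACA subrr add0r scalerBl.
    rewrite g0 subr0 yy0 dotvZr Gw mulr0 subr0 normrZ exprMn in B.
    rewrite real_normK ?num_real// in B.
    apply: le_trans B _; rewrite mulrCA.
    apply: (@le_trans _ _ (ka * `|t| * (L * `|w| ^+ 2))); first by rewrite ler_wpM2r.
    have -> : a * `|t| * (mu / 4) = ka * `|t| * (L * `|w| ^+ 2 + 1).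
      by rewrite /ka; field; rewrite gt_eqF// ltr_wpDl.
    by apply: ler_wpM2l; [rewrite mulr_ge0// ltW|rewrite lerDl].
  have gyr : t != 0 -> `|g y| < rho * `|t| * (mu / 2).
    move=> t0; have tp : 0 < `|t| by rewrite normr_gt0.
    apply: le_lt_trans gy _.
    apply: (@le_lt_trans _ _ (rho * `|t| * (mu / 4))).
      by rewrite ler_wpM2r ?divr_ge0 ?(ltW mu0)// ler_wpM2r.
    rewrite ltr_pM2l ?mulr_gt0//; by move: mu0; clear; lra.
  split=> st; have t0 : t != 0 by apply: contraTneq st => ->; rewrite mulr0 ltxx.
    move=> /Ez gz; move: (gyr t0) (up st) gz; rewrite ltr_norml => /andP[].
    by clear; lra.
  apply/Ez; move: (gyr t0) (down st); rewrite ltr_norml => /andP[].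
  by clear; lra.
Qed.

(** * Integrals along rays *)

Section interval_integrals.
Context (R : realType).
Implicit Types (f g : R -> R) (r : R).
Local Notation leb := (@lebesgue_measure R).

Lemma itv0_measure r : 0 <= r -> leb `[0, r]%classic = r%:E.
Proof.
move=> r0; rewrite lebesgue_measure_itv /= lte_fin; case: ifPn => [_|].
  by rewrite -EFinB subr0.
by rewrite -leNgt => r0'; congr EFin; apply/eqP; rewrite eq_le r0.
Qed.

Lemma bounded_integrable r f M : measurable_fun setT f ->
  (forall x, 0 <= x <= r -> `|f x| <= M) -> leb.-integrable `[0, r] (EFin \o f).
Proof.
move=> mf bf; apply: measurable_bounded_integrable => //.
- change (leb `[0%R, r]%classic < +oo)%E.
  by rewrite lebesgue_measure_itv /=; case: ifP => _; rewrite ?sube0 ltry.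
- exact: measurable_funS mf.
- exists M; split; first exact: num_real.
  by move=> N MN x /=; rewrite in_itv /= => /bf /le_trans; apply; exact: ltW.
Qed.

Lemma le_bounded_Rintegral r f g M N :
  measurable_fun setT f -> measurable_fun setT g ->
  (forall x, 0 <= x <= r -> `|f x| <= M) -> (forall x, 0 <= x <= r -> `|g x| <= N) ->
  (forall x, 0 <= x <= r -> f x <= g x) ->
  \int[leb]_(x in `[0, r]) f x <= \int[leb]_(x in `[0, r]) g x.
Proof.
move=> mf mg bf bg fg; apply: le_Rintegral => //.
- exact: bounded_integrable mf bf.
- exact: bounded_integrable mg bg.
Qed.

Lemma Rintegral_indic r c (W : set R) : measurable W -> W `<=` `[0, r]%classic ->
  \int[leb]_(x in `[0, r]) (c * \1_W x) = c * fine (leb W).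
Proof.
move=> mW Wr; rewrite RintegralZl//.
  by rewrite /Rintegral integral_indic// setIidl.
apply: (@bounded_integrable _ _ 1); first exact: measurable_indic.
by move=> x _; rewrite indicE; case: (_ \in _); rewrite ?normr1 ?normr0.
Qed.

Lemma Rintegral_itv_cst r c : 0 <= r -> \int[leb]_(x in `[0, r]) c = c * r.
Proof.
move=> r0; rewrite Rintegral_cst//; congr (_ * _).
by rewrite -[RHS]/(fine r%:E) -(itv0_measure r0).
Qed.

(** A step function that is at least 1 within [h] of the points of [l] and has integral O(h): the
    price of finitely many moving jumps. *)
Definition bump (l : seq R) (h x : R) : R :=
  \sum_(c <- l) \1_(`[c - h, c + h]%classic) x.

Lemma bump_ge0 l h x : 0 <= bump l h x.
Proof. by apply: sumr_ge0 => c _; rewrite indicE ler0n. Qed.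

Lemma bump_le l h x : bump l h x <= (size l)%:R.
Proof.
rewrite /bump; elim: l => [|c l IH]; first by rewrite big_nil.
rewrite big_cons /= -natr1 addrC lerD//.
Qed.

Lemma bump_ge1 l h x c : c \in l -> `|x - c| <= h -> 1 <= bump l h x.
Proof.
move=> cl xc; rewrite /bump (big_rem c)//= indicE mem_set; last first.
  by rewrite /= in_itv /= -ler_distl.
by rewrite lerDl; apply: sumr_ge0 => i _; rewrite indicE ler0n.
Qed.

Lemma measurable_bump l h : measurable_fun setT (bump l h).
Proof.
apply: measurable_sum => c; exact: measurable_indic.
Qed.

Lemma bump_norm l h x : `|bump l h x| <= (size l)%:R.
Proof. by rewrite ger0_norm ?bump_ge0// bump_le. Qed.

Lemma Rintegral_bump r l h : 0 <= r -> 0 <= h ->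
  \int[leb]_(x in `[0, r]) bump l h x <= (size l)%:R * (2 * h).
Proof.
move=> r0 h0; elim: l => [|c l IH].
  rewrite (_ : bump [::] h = cst 0); first by rewrite Rintegral_cst// mul0r mul0r.
  by apply/funext => x; rewrite /bump big_nil.
have -> : bump (c :: l) h = fun x => \1_(`[c - h, c + h]%classic) x + bump l h x.
  by apply/funext => x; rewrite /bump big_cons.
rewrite RintegralD//; last 2 first.
- apply: (@bounded_integrable _ _ 1); first exact: measurable_indic.
  by move=> x _; rewrite indicE; case: (_ \in _); rewrite ?normr1 ?normr0.
- by apply: bounded_integrable (measurable_bump _ _) _ => x _; exact: bump_norm.
rewrite /= -natr1 mulrDl mul1r addrC lerD//.
rewrite /Rintegral integral_indic//.
have le : (leb (`[(c - h)%R, (c + h)%R]%classic `&` `[0%R, r]%classic) <= (2 * h)%:E)%E.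
  apply: (@le_trans _ _ (leb `[(c - h)%R, (c + h)%R]%classic)).
    by apply: le_measure; rewrite ?inE//; exact: measurableI.
  rewrite lebesgue_measure_itv /=; case: ifPn => _.
    by rewrite -EFinB lee_fin; move: h0; lra.
  by rewrite lee_fin mulr_ge0.
rewrite -lee_fin fineK//; apply: fin_real.
rewrite (lt_le_trans _ (measure_ge0 _ _))//= ?ltNye//.
by apply: le_lt_trans le _; rewrite ltry.
Qed.

(** Serves two purposes: with [s = 0] it gives Lipschitz bounds, and with [s] a multiple of an
    indicator it gives the lower bound for the growth of the singular beam. *)
Lemma Rintegral_compare r (f g s : R -> R) (e M h Mf Mg Ms : R) (l : seq R) :
  0 <= r -> 0 <= h -> 0 <= M ->
  measurable_fun setT f -> measurable_fun setT g -> measurable_fun setT s ->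
  (forall x, 0 <= x <= r -> `|f x| <= Mf) ->
  (forall x, 0 <= x <= r -> `|g x| <= Mg) ->
  (forall x, 0 <= x <= r -> `|s x| <= Ms) ->
  (forall x, 0 <= x <= r -> s x - (e + M * bump l h x) <= f x - g x) ->
  \int[leb]_(x in `[0, r]) s x - (e * r + M * ((size l)%:R * (2 * h))) <=
  \int[leb]_(x in `[0, r]) f x - \int[leb]_(x in `[0, r]) g x.
Proof.
move=> r0 h0 M0 mf mg ms bf bg bs H.
have if_ := bounded_integrable mf bf.
have ig := bounded_integrable mg bg.
have is_ := bounded_integrable ms bs.
have ib : leb.-integrable `[0, r] (EFin \o bump l h).
  by apply: bounded_integrable (measurable_bump _ _) _ => x _; exact: bump_norm.
have mbM : measurable_fun setT (fun x => M * bump l h x).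
  by apply: measurable_funM => //; exact: measurable_bump.
have ibM : leb.-integrable `[0, r] (EFin \o (fun x => M * bump l h x)).
  apply: (@bounded_integrable _ _ (M * (size l)%:R)) => // x _.
  by rewrite normrM (ger0_norm M0) ler_wpM2l// bump_norm.
have ie : leb.-integrable `[0, r] (EFin \o (fun _ => e)).
  by apply: (@bounded_integrable _ _ `|e|).
have ieb : leb.-integrable `[0, r] (EFin \o (fun x => e + M * bump l h x)).
  apply: (@bounded_integrable _ _ (`|e| + M * (size l)%:R)).
    by apply: measurable_funD.
  move=> x _; apply: le_trans (ler_normD _ _) _; rewrite lerD2l.
  by rewrite normrM (ger0_norm M0) ler_wpM2l// bump_norm.
have E1 : \int[leb]_(x in `[0, r]) (f x - g x) =
    \int[leb]_(x in `[0, r]) f x - \int[leb]_(x in `[0, r]) g x.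
  by rewrite RintegralB.
have E2 : \int[leb]_(x in `[0, r]) (s x - (e + M * bump l h x)) =
    \int[leb]_(x in `[0, r]) s x -
     (e * r + M * \int[leb]_(x in `[0, r]) bump l h x).
  by rewrite RintegralB// RintegralD// RintegralZl// Rintegral_itv_cst.
rewrite -E1; apply: (@le_trans _ _ (\int[leb]_(x in `[0, r]) (s x - (e + M * bump l h x)))).
  by rewrite E2 lerD2l lerN2 lerD2l ler_wpM2l// Rintegral_bump.
apply: (@le_bounded_Rintegral _ _ _ (Ms + (`|e| + M * (size l)%:R)) (Mf + Mg)) => //.
- by apply: measurable_funB => //; apply: measurable_funD.
- exact: measurable_funB.
- move=> x xr; apply: le_trans (ler_normB _ _) _; apply: lerD; first exact: bs.
  apply: le_trans (ler_normD _ _) _; rewrite lerD2l.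
  by rewrite normrM (ger0_norm M0) ler_wpM2l// bump_norm.
- by move=> x xr; apply: le_trans (ler_normB _ _) _; rewrite lerD ?bf ?bg.
Qed.

Lemma Rintegral_ray_cut r f : 0 <= r -> (forall x, r < x -> f x = 0) ->
  \int[leb]_(x in `[0, +oo[) f x = \int[leb]_(x in `[0, r]) f x.
Proof.
move=> r0 fr; rewrite Rintegral_mkcond [RHS]Rintegral_mkcond; congr Rintegral.
apply/funext => x; rewrite !patchE; case: ifPn; case: ifPn => //.
  rewrite notin_setE inE /= !in_itv /= andbT => /negP + x0.
  by rewrite x0 /= -ltNge => /fr.
by rewrite inE notin_setE /= !in_itv /= andbT => /andP[x0 _] [].
Qed.

Lemma le_Rintegral_itv r r' f M : measurable_fun setT f -> (forall x, 0 <= f x) ->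
  (forall x, f x <= M) -> r <= r' ->
  \int[leb]_(x in `[0, r]) f x <= \int[leb]_(x in `[0, r']) f x.
Proof.
move=> mf f0 fM rr.
have fb x : `|f x| <= M by rewrite ger0_norm.
have i1 := bounded_integrable mf (fun x (_ : 0 <= x <= r) => fb x).
have i2 := bounded_integrable mf (fun x (_ : 0 <= x <= r') => fb x).
rewrite /Rintegral; apply: fine_le; [exact: integrable_fin_num|exact: integrable_fin_num|].
apply: ge0_subset_integral => //.
- by apply/measurable_EFinP; exact: measurable_funS mf.
- by move=> x _; rewrite lee_fin.
- by move=> x /=; rewrite !in_itv /= => /andP[-> /le_trans]; apply.
Qed.

Lemma expR_neg_lipschitz (x y : R) : 0 <= x -> 0 <= y ->
  `|expR (- x) - expR (- y)| <= `|x - y|.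
Proof.
move=> x0 y0; wlog xy : x y x0 y0 / x <= y.
  move=> H; have [|/ltW] := leP x y; first exact: H.
  by move=> yx; rewrite distrC [`|x - y|]distrC; exact: H.
have h1 : expR (- y) = expR (- x) * expR (x - y).
  by rewrite -expRD; congr expR; ring.
have h2 : expR (- x) <= 1 by rewrite -expR0 ler_expR oppr_le0.
have h3 := expR_ge1Dx (x - y).
have h4 : 0 <= expR (- x) by exact: expR_ge0.
have h5 : expR (x - y) <= 1 by rewrite -expR0 ler_expR subr_le0.
rewrite ger0_norm; last by rewrite h1 -[X in X - _]mulr1 -mulrBr mulr_ge0// subr_ge0.
rewrite ler0_norm ?subr_le0// h1 -[X in X - _]mulr1 -mulrBr.
apply: (@le_trans _ _ (1 * (1 - expR (x - y)))).
  by rewrite ler_wpM2r// subr_ge0.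
by move: h3; lra.
Qed.

End interval_integrals.

(** * Bounds on compact sets and functions along a ray *)

Lemma sup_ball_compact (R : realType) (n : nat) (M : R) :
  compact [set y : 'rV[R]_n | `|y| <= M].
Proof.
have [M0|M0] := ltP M 0.
  have -> : [set y : 'rV[R]_n | `|y| <= M] = set0; last exact: compact0.
  by apply/seteqP; split=> // y /= /(le_lt_trans)/(_ M0); rewrite ltNge normr_ge0.
have -> : [set y : 'rV[R]_n | `|y| <= M] =
    [set y | forall i, `[- M, M]%classic (y ord0 i)].
  apply/seteqP; split=> y /= H => [i|].
    by rewrite in_itv /= -ler_norml; apply: le_trans H; exact: rV_coord_le.
  by apply: rV_norm_le => // i; have := H i; rewrite in_itv /= -ler_norml.
by apply: (@rV_compact R n (fun=> `[- M, M]%classic)) => i; exact: segment_compact.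
Qed.

Lemma continuous_compact_bounded (R : realType) (n : nat) (g : 'rV[R]_n -> R)
    (K : set 'rV[R]_n) :
  compact K -> continuous g -> exists2 M, 0 <= M & forall y, K y -> `|g y| <= M.
Proof.
move=> cK cg; have [K0|/set0P/negP/negPn/eqP ->] := pselect (K !=set0); last by exists 0.
have cng : continuous (fun y => `|g y|) 
  by move=> y; apply: continuous_comp; [exact: cg|exact: norm_continuous].
have [c _ Hc] := @EVT_max_rV R n _ K K0 cK (continuous_subspaceT cng).
exists `|g c| => // y Ky; apply: Hc; by rewrite inE.
Qed.

Lemma smooth_lipschitz (R : realType) (n : nat) (g : 'rV[R]_n -> R) (M : R) :
  smooth_on setT g -> exists2 K, 0 <= K &
    forall y z, `|y| < M -> `|z| < M -> `|g z - g y| <= K * `|z - y|.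
Proof.
move=> sg; have /= [_ H] := sg 1%N.
have bd (i : 'I_n) : exists C, 0 <= C /\ forall y, `|y| <= M ->
    `|'D_(delta_mx 0 i) g y| <= C.
  have [_ [ci _]] := H i.
  have cD : continuous ('D_(delta_mx 0 i) g : 'rV[R]_n -> R) by move=> y; exact: ci.
  have [C C0 HC] := continuous_compact_bounded (@sup_ball_compact R n M) cD.
  by exists C.
have [C HC] := boolp.choice bd.
exists (\sum_i C i); first by apply: sumr_ge0 => i _; have [] := HC i.
move=> y z yM zM.
have [||| xi [Hxi ->]] := @mvt_coordinates R n g 0 y z M.
- by move=> w _ i; have [+ _] := H i; apply.
- by rewrite subr0.
- by rewrite subr0.
apply: le_trans (ler_norm_sum _ _ _) _; rewrite mulr_suml.
apply: ler_sum => i _; rewrite normrM ler_pM ?rV_coord_le//.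
have [C0 HCi] := HC i; apply: HCi.
by have [[]] := Hxi i; rewrite subr0 => /ltW.
Qed.

Lemma smooth_continuous (R : realType) (n : nat) (g : 'rV[R]_n -> R) :
  smooth_on setT g -> continuous g.
Proof. by move=> sg x; have [H _] := sg 0%N; exact: H. Qed.

Lemma bump_sub (R : realType) (l l' : seq R) (h h' x : R) : h <= h' ->
  bump l h x <= bump (l ++ l') h' x /\ bump l' h x <= bump (l ++ l') h' x.
Proof.
move=> hh; have mono m : bump m h x <= bump m h' x.
  rewrite /bump; apply: ler_sum => c _; rewrite !indicE ler_nat.
  case: (boolP (x \in `[c - h, c + h]%classic)) => //.
  rewrite inE /= in_itv /= -ler_distl => xc.
  by rewrite mem_set//= in_itv /= -ler_distl (le_trans xc).
rewrite {2 4}/bump big_cat /= -!/(bump _ _ _).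
have := mono l; have := mono l'.
have := bump_ge0 l h' x; have := bump_ge0 l' h' x.
by move=> ? ? ? ?; split; lra.
Qed.

(* The bumps account for the jumps of F along the ray, which move by O(t). *)
Definition steady (R : realType) (n : nat) (v w b : 'rV[R]_n) (a c r : R)
    (F : 'rV[R]_n -> R) : Prop :=
  exists (C M K de : R) (l : seq R), [/\ 0 <= C, 0 <= M, 0 <= K, 0 < de &
    forall t rho, `|t| < de -> 0 <= rho <= r -> ~ (a < rho < c) ->
      `|F (v + rho *: rotated w b t) - F (v + rho *: w)| <=
      C * `|t| + M * bump l (K * `|t|) rho].

Lemma steady_sum (R : realType) (n : nat) (v w b : 'rV[R]_n) (a c r : R)
    (I : Type) (s : seq I) (F : I -> 'rV[R]_n -> R) :
  (forall i, steady v w b a c r (F i)) ->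
  steady v w b a c r (fun y => \sum_(i <- s) F i y).
Proof.
move=> H; elim: s => [|i s [C [M [K [de [l [C0 M0 K0 de0 HF]]]]]]].
  exists 0, 0, 0, 1, [::]; split=> // t rho _ _ _.
  by rewrite !big_nil subrr normr0 !mul0r addr0.
have [C' [M' [K' [de' [l' [C0' M0' K0' de0' HF']]]]]] := H i.
exists (C' + C), (M' + M), (Num.max K' K), (Num.min de' de), (l' ++ l).
split; rewrite ?addr_ge0 ?le_max ?K0' ?lt_min ?de0' ?de0// => t rho.
rewrite lt_min => /andP[t1 t2] rr nJ; rewrite !big_cons opprD addrACA.
apply: le_trans (ler_normD _ _) _.
apply: le_trans (lerD (HF' t rho t1 rr nJ) (HF t rho t2 rr nJ)) _.
have h1 : K' * `|t| <= Num.max K' K * `|t| by rewrite ler_wpM2r// le_max lexx.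
have h2 : K * `|t| <= Num.max K' K * `|t| by rewrite ler_wpM2r// le_max lexx orbT.
have [b1 _] := bump_sub l' l rho h1.
have [_ b2] := bump_sub l' l rho h2.
have := ler_wpM2l M0' b1; have := ler_wpM2l M0 b2; rewrite !mulrDl; clear; lra.
Qed.

(** Away from the exceptional parameters both points lie on the same side of the boundary of [E] and
    the Lipschitz bound of [F] applies; near them the trivial bound is charged to the bump. *)
Lemma steady_indic (R : realType) (n : nat) (v w b : 'rV[R]_n) (a c r : R)
    (E : set 'rV[R]_n) (F : 'rV[R]_n -> R) :
  0 <= r -> stable_between v w b E a c 0 r ->
  (forall M, exists2 K, 0 <= K &
    forall y z, `|y| < M -> `|z| < M -> `|F z - F y| <= K * `|z - y|) ->
  steady v w b a c r (fun y => F y * \1_E y).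
Proof.
move=> r0 [l [K [de [K0 de0 H]]]] lip.
pose W := `|w| + `|b|.
have W0 : 0 <= W by rewrite addr_ge0.
(* A ball containing the relevant part of the ray and of all its rotations with [|t| <= 1]. *)
pose M := `|v| + r * (`|w| + 2 * W) + 1.
have M0 : 0 < M by rewrite ltr_wpDl// addr_ge0// mulr_ge0// addr_ge0// mulr_ge0.
have [KF KF0 HF] := lip M.
pose MF := `|F 0| + KF * M.
have MF0 : 0 <= MF by rewrite addr_ge0// mulr_ge0// ltW.
have FM y : `|y| < M -> `|F y| <= MF.
  move=> yM; have zM : `|0 : 'rV[R]_n| < M by rewrite normr0.
  have := HF 0 y zM yM; rewrite subr0 => h.
  rewrite -(subrK (F 0) (F y)); apply: le_trans (ler_normD _ _) _.
  rewrite addrC lerD2l; apply: le_trans h _.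
  by rewrite ler_wpM2l// ltW.
exists (KF * (r * (2 * W))), (2 * MF), K, (Num.min de 1), l.
split; rewrite ?mulr_ge0 ?lt_min ?de0 ?ltr01// => t rho.
rewrite lt_min => /andP[t1 t2] /andP[rho0 rr] nJ.
set z := v + _; set y := v + rho *: w.
have zy : `|z - y| <= rho * (2 * `|t| * W) by apply: ray_dist => //; exact: ltW.
have h1 : rho * (2 * `|t| * W) <= r * (2 * 1 * W).
  by rewrite ler_pM ?mulr_ge0// ler_wpM2r// ler_wpM2l// ltW.
have yM : `|y| <= `|v| + r * `|w|.
  apply: le_trans (ler_normD _ _) _; rewrite lerD2l normrZ ger0_norm//.
  by rewrite ler_wpM2r.
have yM' : `|y| < M.
  apply: le_lt_trans yM _; rewrite /M.
  by have : 0 <= r * (2 * W); [rewrite !mulr_ge0|clear; lra].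
have zM : `|z| < M.
  rewrite -(subrK y z); apply: le_lt_trans (ler_normD _ _) _; rewrite /M.
  by move: zy h1 yM; clear; lra.
have B0 := bump_ge0 l (K * `|t|) rho.
have [far|/existsNP[i /not_implyP[il near]]] :=
    pselect (forall i, i \in l -> K * `|t| < `|rho - i|).
  have Ezy := H t rho t1 (_ : 0 <= rho <= r) nJ far.
  have {}Ezy : E z <-> E y by apply: Ezy; rewrite rho0.
  have -> : \1_E z = \1_E y :> R.
    by rewrite !indicE; congr (_%:R); congr nat_of_bool; apply/idP/idP;
      rewrite !inE; case: Ezy.
  rewrite -mulrBl normrM.
  have i1 : `|\1_E y : R| <= 1 by rewrite indicE; case: (_ \in _); rewrite ?normr1 ?normr0.
  apply: (@le_trans _ _ (KF * (r * (2 * W)) * `|t|)); last first.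
    by rewrite lerDl !mulr_ge0.
  rewrite -[leRHS]mulr1; apply: ler_pM => //.
  apply: le_trans (HF _ _ yM' zM) _; rewrite -mulrA ler_wpM2l//.
  apply: le_trans zy _.
  have -> : r * (2 * W) * `|t| = r * (2 * `|t| * W) by ring.
  by rewrite ler_wpM2r// !mulr_ge0.
have B1 : 1 <= bump l (K * `|t|) rho.
  by apply: bump_ge1 il _; rewrite leNgt; apply/negP.
have i1 y' : `|F y'| <= MF -> `|F y' * \1_E y'| <= MF.
  move=> h; rewrite normrM indicE; case: (_ \in _); rewrite ?normr1 ?mulr1//.
  by rewrite normr0 mulr0.
apply: le_trans (ler_normB _ _) _.
have := i1 _ (FM _ zM); have := i1 _ (FM _ yM').
have : 2 * MF * 1 <= 2 * MF * bump l (K * `|t|) rho by rewrite ler_wpM2l// mulr_ge0.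
have : 0 <= KF * (r * (2 * W)) * `|t| by rewrite !mulr_ge0.
clear; lra.
Qed.

Section ray_functions.
Context (R : realType) (n : nat) (B : set 'rV[R]_n) (p : activity_attenuation R n).
Context (Hp : admissible_pair B p).
Local Notation leb := (@lebesgue_measure R).

Lemma attenuation_ge0 y : 0 <= attenuation p y.
Proof.
have [_ _ H _ _] := Hp; apply: sumr_ge0 => k _.
by rewrite mulr_ge0 ?indicE ?ler0n// ltW//; have [_] := H k; apply.
Qed.

Lemma attenuation_bounded : exists2 M, 0 <= M & forall y, attenuation p y <= M.
Proof.
have [_ _ H H' _] := Hp.
have bd k : exists C, 0 <= C /\ forall y, attn_region p k y ->
    `|attn_density p k y| <= C.
  have [[cE _ _] _] := H' k; have [sk _] := H k.
  by have [C C0 HC] := continuous_compact_bounded cE (smooth_continuous sk); exists C.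
have [C HC] := boolp.choice bd.
exists (\sum_k C k); first by apply: sumr_ge0 => k _; have [] := HC k.
move=> y; apply: ler_sum => k _; have [C0 HCk] := HC k.
rewrite indicE; case: (boolP (y \in _)); last by rewrite mulr0.
by rewrite inE mulr1 => /HCk; apply: le_trans; exact: ler_norm.
Qed.

Lemma source_itv y : 0 <= source p y <= intensity p.
Proof.
have [I0 _ _ _ _] := Hp; rewrite /source indicE.
by case: (_ \in _); rewrite ?mulr1 ?mulr0 ?lexx ?(ltW I0).
Qed.

Lemma measurable_ray_indic (E : set 'rV[R]_n) v w : closed E ->
  measurable_fun setT (fun rho : R => \1_E (v + rho *: w) : R).
Proof.
move=> cE; have mE : measurable [set rho : R | E (v + rho *: w)].
  apply: closed_measurable; apply: preimage_closed cE => rho _.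
  exact: line_continuous.
rewrite (_ : (fun _ => _) = \1_[set rho : R | E (v + rho *: w)]).
  exact: measurable_indic.
apply/funext => rho; rewrite !indicE; congr (_%:R); congr nat_of_bool.
Qed.

Lemma measurable_ray_continuous (g : 'rV[R]_n -> R) v w : continuous g ->
  measurable_fun setT (fun rho : R => g (v + rho *: w)).
Proof.
move=> cg; apply: continuous_measurable_fun => rho.
apply: continuous_comp; first exact: line_continuous.
exact: cg.
Qed.

Lemma measurable_ray_attenuation v w :
  measurable_fun setT (fun rho : R => attenuation p (v + rho *: w)).
Proof.
have [_ _ H _ _] := Hp; apply: measurable_sum => k; apply: measurable_funM.
  by apply: measurable_ray_continuous; apply: smooth_continuous; have [] := H k.
by apply: measurable_ray_indic; exact: domain_closed (piece_domain Hp (Some k)).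
Qed.

Lemma measurable_ray_source v w :
  measurable_fun setT (fun rho : R => source p (v + rho *: w)).
Proof.
apply: measurable_funM; first exact: measurable_cst.
by apply: measurable_ray_indic; exact: domain_closed (piece_domain Hp None).
Qed.

Definition depth (v w : 'rV[R]_n) (rho : R) : R :=
  \int[leb]_(r in `[0, rho]) attenuation p (v + r *: w).

Definition beam_integrand (k : nat) (v w : 'rV[R]_n) (rho : R) : R :=
  rho ^+ k * source p (v + rho *: w) * expR (- depth v w rho).

Lemma depth_ge0 v w rho : 0 <= depth v w rho.
Proof. by apply: Rintegral_ge0 => r _; exact: attenuation_ge0. Qed.

Lemma depth_mono v w : {homo depth v w : x y / x <= y}.
Proof.
have [M M0 HM] := attenuation_bounded => x y xy.
apply: (@le_Rintegral_itv _ _ _ _ M) => //; first exact: measurable_ray_attenuation.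
by move=> r; exact: attenuation_ge0.
Qed.

Lemma measurable_depth v w : measurable_fun setT (depth v w).
Proof. by apply: nondecreasing_measurable => //; exact: depth_mono. Qed.

Lemma depth_le v w rho M : (forall y, attenuation p y <= M) -> 0 <= rho ->
  depth v w rho <= M * rho.
Proof.
move=> HM r0; rewrite -Rintegral_itv_cst//.
have ma := measurable_ray_attenuation v w.
have aM x : 0 <= x <= rho -> `|attenuation p (v + x *: w)| <= M.
  by move=> _; rewrite ger0_norm ?attenuation_ge0.
apply: (@le_bounded_Rintegral _ _ _ _ M `|M|) => //.
Qed.

Lemma measurable_beam_integrand k v w : measurable_fun setT (beam_integrand k v w).
Proof.
apply: measurable_funM.
  apply: measurable_funM; last exact: measurable_ray_source.
  by apply: measurable_funX; exact: measurable_id.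
apply: (measurableT_comp (@measurable_expR R)).
by apply: measurable_funN; exact: measurable_depth.
Qed.

Lemma beam_integrand_itv k v w r rho : 0 <= rho <= r ->
  0 <= beam_integrand k v w rho <= r ^+ k * intensity p.
Proof.
move=> /andP[r0 rr]; have /andP[s0 sI] := source_itv (v + rho *: w).
have e0 : 0 <= expR (- depth v w rho) by exact: expR_ge0.
have e1 : expR (- depth v w rho) <= 1.
  by rewrite -expR0 ler_expR oppr_le0 depth_ge0.
have k0 : 0 <= rho ^+ k by rewrite exprn_ge0.
apply/andP; split; first exact: (mulr_ge0 (mulr_ge0 k0 s0) e0).
rewrite /beam_integrand -[leRHS]mulr1.
have kr : rho ^+ k <= r ^+ k by rewrite lerXn2r ?nnegrE// (le_trans r0).
exact: (ler_pM (mulr_ge0 k0 s0) e0 (ler_pM k0 s0 kr sI) e1).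
Qed.

(** The radius depends on the vertex only, so that one interval of integration serves for all
    rotated rays. *)
Lemma ray_exit v : exists2 r, 0 < r & forall w rho o, dotv w w = 1 -> r < rho ->
  ~ piece (p := p) o (v + rho *: w).
Proof.
have [|M M0 HM] := @bounded_family R n _ (piece (p := p)).
  by move=> o; have [] := piece_domain Hp o.
exists (n%:R * (M + `|v|) + 1).
  by rewrite ltr_wpDl// mulr_ge0// addr_ge0// ltW.
move=> w rho o ww rr /HM zM.
have w1 : `|w| <= 1.
  apply: rV_norm_le => // i; rewrite -(@ler_sqr _ `|w 0 i| 1) ?nnegrE//.
  rewrite expr1n real_normK ?num_real// -ww /dotv expr2.
  apply: (@ler_single_sum R _ (fun i => w 0 i * w 0 i) i) => j.
  by rewrite -expr2 sqr_ge0.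
have : rho = dotv ((v + rho *: w) - v) w.
  by rewrite addrAC subrr add0r dotvZl ww mulr1.
move=> E; have := dotv_norm ((v + rho *: w) - v) w; rewrite -E => h.
have h2 : `|v + rho *: w - v| <= M + `|v|.
  by apply: le_trans (ler_normB _ _) _; rewrite lerD2r.
have h3 : n%:R * `|v + rho *: w - v| * `|w| <= n%:R * (M + `|v|) * 1.
  by rewrite ler_pM ?mulr_ge0// ler_wpM2l.
have := ler_norm rho; lra.
Qed.

Lemma divergent_beam_cut k v w r : 0 <= r ->
  (forall rho, r < rho -> ~ region p (v + rho *: w)) ->
  divergent_beam k (source p) (attenuation p) v w =
  \int[leb]_(rho in `[0, r]) beam_integrand k v w rho.
Proof.
move=> r0 out; rewrite /divergent_beam (Rintegral_ray_cut r0)// => x /out nx.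
by rewrite /source indicE memNset// mulr0 mulr0 mul0r.
Qed.

End ray_functions.

(** * Growth of the beam under rotation *)

(** The interval [0 < rho < 0] in [steady] is empty, so the estimate holds on the whole ray; bumps
    of width O(t) integrate to O(t). *)
Lemma depth_lipschitz (R : realType) (n : nat) (B : set 'rV[R]_n)
    (p : activity_attenuation R n) v w b r :
  admissible_pair B p -> 0 <= r ->
  steady v w b 0 0 r (attenuation p) ->
  exists C de, [/\ 0 <= C, 0 < de & forall t rho, `|t| < de -> 0 <= rho <= r ->
    `|depth p v (rotated w b t) rho - depth p v w rho| <= C * `|t|].
Proof.
move=> Hp r0 [C [M [K [de [l [C0 M0 K0 de0 H]]]]]].
have [Ma Ma0 HMa] := attenuation_bounded Hp.
pose C' := C * r + M * ((size l)%:R * (2 * K)).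
have C'0 : 0 <= C' by rewrite addr_ge0// !mulr_ge0.
exists C', de; split=> // t rho td /andP[rho0 rr].
have ab w' x : 0 <= x <= rho -> `|attenuation p (v + x *: w')| <= Ma.
  by move=> _; rewrite ger0_norm ?(attenuation_ge0 Hp).
have mt := measurable_ray_attenuation Hp v (rotated w b t).
have m0 := measurable_ray_attenuation Hp v w.
have h0 : 0 <= K * `|t| by rewrite mulr_ge0.
have ptw x : 0 <= x <= rho ->
    `|attenuation p (v + x *: rotated w b t) - attenuation p (v + x *: w)| <=
      C * `|t| + M * bump l (K * `|t|) x.
  move=> /andP[x0 xr]; apply: H => //; first by rewrite x0 (le_trans xr).
  by move=> /andP[]; lra.
have z0 : \int[lebesgue_measure]_(x in `[0, rho]) (fun=> 0) x = 0 :> R.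
  by rewrite Rintegral_itv_cst// mul0r.
have cmp (f g : R -> R) : measurable_fun setT f -> measurable_fun setT g ->
    (forall x, 0 <= x <= rho -> `|f x| <= Ma) ->
    (forall x, 0 <= x <= rho -> `|g x| <= Ma) ->
    (forall x, 0 <= x <= rho -> `|f x - g x| <= C * `|t| + M * bump l (K * `|t|) x) ->
    - (C' * `|t|) <= \int[lebesgue_measure]_(x in `[0, rho]) f x -
                     \int[lebesgue_measure]_(x in `[0, rho]) g x.
  move=> mf mg bf bg fg.
  have := @Rintegral_compare R rho f g (fun=> 0) (C * `|t|) M (K * `|t|) Ma Ma 0 l
    rho0 h0 M0 mf mg (@measurable_cst _ _ _ _ _ _) bf bg.
  rewrite z0 sub0r => H'; apply: le_trans (H' _ _); last first.
  - by move=> x xr /=; rewrite sub0r; have := fg x xr; rewrite ler_norml => /andP[].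
  - by move=> x _; rewrite normr0.
  - rewrite lerN2 /C' mulrDl.
    have : C * `|t| * rho <= C * `|t| * r by rewrite ler_wpM2l// mulr_ge0.
    by lra.
rewrite ler_norml; apply/andP; split.
  by apply: cmp => //; [exact: ab|exact: ab].
rewrite -lerN2 opprB; apply: cmp => //; [exact: ab|exact: ab|].
by move=> x xr; rewrite distrC; exact: ptw.
Qed.

(** Separates the effect of the source, which may jump, from that of the attenuation, which enters
    through the depth and is Lipschitz. *)
Lemma beam_integrand_diff (R : realType) (n : nat) (B : set 'rV[R]_n)
    (p : activity_attenuation R n) k v w w' r rho D :
  admissible_pair B p -> 0 <= rho <= r ->
  `|depth p v w' rho - depth p v w rho| <= D ->
  `|beam_integrand p k v w' rho - beam_integrand p k v w rho -
    rho ^+ k * (source p (v + rho *: w') - source p (v + rho *: w)) *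
      expR (- depth p v w' rho)| <= r ^+ k * intensity p * D.
Proof.
move=> Hp /andP[r0 rr] dD; rewrite /beam_integrand.
set s' := source _ _; set s := source p (v + rho *: w).
set e' := expR _; set e := expR (- depth p v w rho).
have -> : rho ^+ k * s' * e' - rho ^+ k * s * e - rho ^+ k * (s' - s) * e' =
  rho ^+ k * s * (e' - e) by ring.
have /andP[s0 sI] := source_itv Hp (v + rho *: w).
have k0 : 0 <= rho ^+ k by rewrite exprn_ge0.
have kr : rho ^+ k <= r ^+ k by rewrite lerXn2r ?nnegrE// (le_trans r0).
rewrite normrM ger0_norm; last exact: mulr_ge0.
apply: ler_pM => //; first exact: mulr_ge0.
  exact: (ler_pM k0 s0 kr sI).
by apply: le_trans (expR_neg_lipschitz _ _) dD; exact: (depth_ge0 Hp).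
Qed.

Lemma beam_lipschitz (R : realType) (n : nat) (B : set 'rV[R]_n)
    (p : activity_attenuation R n) k v w b r :
  admissible_pair B p -> 0 <= r ->
  steady v w b 0 0 r (attenuation p) -> steady v w b 0 0 r (source p) ->
  exists C de, [/\ 0 <= C, 0 < de & forall t, `|t| < de ->
    `|\int[lebesgue_measure]_(x in `[0, r]) beam_integrand p k v (rotated w b t) x -
      \int[lebesgue_measure]_(x in `[0, r]) beam_integrand p k v w x| <= C * `|t|].
Proof.
move=> Hp r0 sa [C1 [M [K [de1 [l [C10 M0 K0 de10 Hs]]]]]].
have [C2 [de2 [C20 de20 Hd]]] := depth_lipschitz Hp r0 sa.
have [I0 _ _ _ _] := Hp.
have rk0 : 0 <= r ^+ k by rewrite exprn_ge0.
pose C3 := r ^+ k * C1 + r ^+ k * intensity p * C2.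
have C30 : 0 <= C3 by rewrite addr_ge0 ?mulr_ge0// ltW.
have M30 : 0 <= r ^+ k * M by rewrite mulr_ge0.
pose C := C3 * r + r ^+ k * M * ((size l)%:R * (2 * K)).
have C0 : 0 <= C.
  by apply: addr_ge0; apply: mulr_ge0 => //; rewrite !mulr_ge0.
exists C, (Num.min de1 de2); split=> //; first by rewrite lt_min de10.
move=> t; rewrite lt_min => /andP[t1 t2].
have ptw x : 0 <= x <= r ->
    `|beam_integrand p k v (rotated w b t) x - beam_integrand p k v w x| <=
      C3 * `|t| + r ^+ k * M * bump l (K * `|t|) x.
  move=> xr; have := beam_integrand_diff k Hp xr (Hd t x t2 xr).
  have nJ : ~ (0 < x < 0) by move=> /andP[]; lra.
  have := Hs t x t1 xr nJ; case/andP: (xr) => x0 xr'.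
  set S := source _ _ - _; set D := beam_integrand _ _ _ _ _ - _ => hS hD.
  have hP : `|x ^+ k * S * expR (- depth p v (rotated w b t) x)| <= r ^+ k * `|S|.
    rewrite !normrM (ger0_norm (expR_ge0 _)) (ger0_norm (exprn_ge0 _ x0)).
    have e1 : expR (- depth p v (rotated w b t) x) <= 1.
      by rewrite -expR0 ler_expR oppr_le0 (depth_ge0 Hp).
    have kr : x ^+ k <= r ^+ k by rewrite lerXn2r ?nnegrE.
    rewrite -[leRHS]mulr1.
    exact: (ler_pM (mulr_ge0 (exprn_ge0 _ x0) (normr_ge0 _)) (expR_ge0 _)
      (ler_wpM2r (normr_ge0 _) kr) e1).
  have hS' : r ^+ k * `|S| <= r ^+ k * (C1 * `|t| + M * bump l (K * `|t|) x).
    by rewrite ler_wpM2l.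
  rewrite -(subrK (x ^+ k * S * expR (- depth p v (rotated w b t) x)) D).
  apply: le_trans (ler_normD _ _) _; rewrite /C3.
  by move: hD hP hS'; clear; lra.
have h0 : 0 <= K * `|t| by rewrite mulr_ge0.
have bb w' x : 0 <= x <= r -> `|beam_integrand p k v w' x| <= r ^+ k * intensity p.
  by move=> /(beam_integrand_itv Hp k v w')/andP[b0 b1]; rewrite ger0_norm.
have z0 : \int[lebesgue_measure]_(x in `[0, r]) (fun=> 0) x = 0 :> R.
  by rewrite Rintegral_itv_cst// mul0r.
have cmp w1 w2 :
    (forall x, 0 <= x <= r -> `|beam_integrand p k v w1 x - beam_integrand p k v w2 x|
       <= C3 * `|t| + r ^+ k * M * bump l (K * `|t|) x) ->
    - (C * `|t|) <= \int[lebesgue_measure]_(x in `[0, r]) beam_integrand p k v w1 x -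
                     \int[lebesgue_measure]_(x in `[0, r]) beam_integrand p k v w2 x.
  move=> fg.
  have := @Rintegral_compare R r _ _ (fun=> 0) (C3 * `|t|) (r ^+ k * M) (K * `|t|)
    _ _ 0 l r0 h0 M30 (measurable_beam_integrand Hp k v w1)
    (measurable_beam_integrand Hp k v w2) (@measurable_cst _ _ _ _ _ _)
    (bb w1) (bb w2).
  rewrite z0 sub0r => H'; apply: le_trans (H' _ _); last first.
  - by move=> x xr /=; rewrite sub0r; have := fg x xr; rewrite ler_norml => /andP[].
  - by move=> x _; rewrite normr0.
  - by rewrite lerN2; apply: eq_imp_le; rewrite /C; ring.
rewrite ler_norml; apply/andP; split; first exact: cmp.
rewrite -lerN2 opprB; apply: cmp.
by move=> x xr; rewrite distrC; exact: ptw.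
Qed.

(** The window has length [2 * q], so [A] or its complement fills at least half of it. *)
Lemma window_measure (R : realType) (A : set R) (x q : R) : measurable A -> 0 <= q ->
  let W := `[x - q, x + q]%classic in
  q <= fine (lebesgue_measure (W `&` A)) \/ q <= fine (lebesgue_measure (W `\` A)).
Proof.
move=> mA q0 W.
have mW : measurable W by exact: measurable_itv.
have mWA : measurable (W `&` A) by exact: measurableI.
have mWD : measurable (W `\` A) by exact: measurableD.
have lW : lebesgue_measure W = (2 * q)%:E.
  rewrite /W lebesgue_measure_itv /= lte_fin; case: ifPn => [_|].
    by rewrite -EFinB; congr EFin; ring.
  by rewrite -leNgt => ?; congr EFin; lra.
have fin A' : measurable A' -> A' `<=` W -> lebesgue_measure A' \is a fin_num.
  move=> mA' A'W; rewrite ge0_fin_numE//.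
  apply: (@le_lt_trans _ _ (lebesgue_measure W)); last by rewrite lW ltry.
  by apply: le_measure; rewrite ?inE.
have fI : lebesgue_measure (W `&` A) \is a fin_num by apply: fin => // ? [].
have fD : lebesgue_measure (W `\` A) \is a fin_num by apply: fin => // ? [].
have : (2 * q)%:E = (lebesgue_measure (W `\` A) + lebesgue_measure (W `&` A))%E.
  by rewrite -lW; exact: (measureDI (@lebesgue_measure R) mW mA).
rewrite -(fineK fI) -(fineK fD) -EFinD => -[E].
have [h|h] := leP q (fine (lebesgue_measure (W `&` A))); first by left.
by right; move: E h; rewrite !fineK//=; lra.
Qed.

(* The hypothesis on [rotated] is the conclusion of tangency_window.  According   *)
(* to whether the ray is mostly inside or outside the region on the window of     *)
(* length of order q = sqrt |t|, one sign of t or the other changes the beam.     *)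
Lemma beam_singular (R : realType) (n : nat) (B : set 'rV[R]_n)
    (p : activity_attenuation R n) k v w b r a c rho0 (neg : bool) de0 ka :
  admissible_pair B p -> 0 < a -> a < rho0 < c -> c <= r ->
  steady v w b 0 0 r (attenuation p) -> steady v w b a c r (source p) ->
  0 < de0 -> 0 < ka ->
  (forall t rho, `|t| < de0 -> a <= rho <= c ->
    [/\ 0 < (-1) ^+ neg * t -> region p (v + rho *: rotated w b t) ->
          region p (v + rho *: w),
        (-1) ^+ neg * t < 0 -> region p (v + rho *: w) ->
          region p (v + rho *: rotated w b t) &
        (rho - rho0) ^+ 2 <= ka * `|t| ->
          (0 < (-1) ^+ neg * t -> ~ region p (v + rho *: rotated w b t)) /\
          ((-1) ^+ neg * t < 0 -> region p (v + rho *: rotated w b t))]) ->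
  exists c0 C de, [/\ 0 < c0, 0 <= C, 0 < de & forall q, 0 < q -> q < de ->
    exists2 t, `|t| = q ^+ 2 & c0 * q - C * q ^+ 2 <=
    `|\int[lebesgue_measure]_(x in `[0, r]) beam_integrand p k v (rotated w b t) x -
      \int[lebesgue_measure]_(x in `[0, r]) beam_integrand p k v w x|].
Proof.
move=> Hp a0 /andP[ar rc] cr sa [C1 [M [K [de1 [l [C10 M0 K0 de10 Hs]]]]]] de00 ka0 Hw.
have r0 : 0 <= r by lra.
have [C2 [de2 [C20 de20 Hd]]] := depth_lipschitz Hp r0 sa.
have [I0 _ _ _ _] := Hp.
have [Ma Ma0 HMa] := attenuation_bounded Hp.
have rk0 : 0 <= r ^+ k by rewrite exprn_ge0.
pose C3 := r ^+ k * C1 + r ^+ k * intensity p * C2.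
have C30 : 0 <= C3 by rewrite addr_ge0 ?mulr_ge0// ltW.
have M30 : 0 <= r ^+ k * M by rewrite mulr_ge0.
pose C := C3 * r + r ^+ k * M * ((size l)%:R * (2 * K)).
have C0 : 0 <= C.
  by apply: addr_ge0; apply: mulr_ge0 => //; rewrite !mulr_ge0.
(* A lower bound for the beam integrand on the window when the point is in the region: there
   [rho >= a], and the depth is at most [Ma * r]. *)
pose c1 := a ^+ k * intensity p * expR (- (Ma * r)).
have c10 : 0 < c1 by rewrite !mulr_gt0 ?exprn_gt0 ?expR_gt0.
pose ks := Num.sqrt ka.
have ks0 : 0 < ks by rewrite sqrtr_gt0.
have [|de dep /= /and5P[d1 d2 d3 d4 /and3P[d5 d6 _]]] :=
  @small_pos R [:: 1; de0; de1; de2; (rho0 - a) / ks; (c - rho0) / ks].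
  by rewrite /= ltr01 de00 de10 de20 !divr_gt0// subr_gt0.
exists (c1 * ks), C, de; split=> //; first by rewrite mulr_gt0.
move=> q q0 qd.
have q1 : q <= 1 by apply: ltW; exact: lt_le_trans d1.
have qq : q ^+ 2 <= q by rewrite expr2 ler_piMl// ltW.
have q2 : 0 < q ^+ 2 by rewrite exprn_gt0.
pose E := [set x : R | region p (v + x *: w)].
have cE : closed (region p) by exact: domain_closed (piece_domain Hp None).
have mE : measurable E.
  apply: closed_measurable; apply: preimage_closed cE => x _.
  exact: line_continuous.
pose Q := ks * q.
have Q0 : 0 < Q by rewrite mulr_gt0.
have QQ : Q ^+ 2 = ka * q ^+ 2 by rewrite exprMn sqr_sqrtr// ltW.
have Qa : Q < rho0 - a.
  have : q < (rho0 - a) / ks by exact: lt_le_trans d5.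
  by rewrite ltr_pdivlMr// mulrC.
have Qc : Q < c - rho0.
  have : q < (c - rho0) / ks by exact: lt_le_trans d6.
  by rewrite ltr_pdivlMr// mulrC.
set W := `[rho0 - Q, rho0 + Q]%classic.
have WJ x : W x -> a <= x <= c /\ (x - rho0) ^+ 2 <= ka * q ^+ 2.
  rewrite /W /= in_itv /= => /andP[x1 x2]; split.
    by apply/andP; split; [move: x1 Qa|move: x2 Qc]; clear; lra.
  rewrite -QQ -real_normK ?num_real// ler_sqr ?nnegrE ?(ltW Q0)//.
  by rewrite ler_distl x1.
have bb w' x : 0 <= x <= r -> `|beam_integrand p k v w' x| <= r ^+ k * intensity p.
  by move=> /(beam_integrand_itv Hp k v w')/andP[b0 b1]; rewrite ger0_norm.
(* [w1], [w2] are the rotated and the base direction, in the order for which the *)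
(* chord near [rho0] grows from [w2] to [w1] on [A].                            *)
have main t w1 w2 A : `|t| = q ^+ 2 -> measurable A -> A `<=` W ->
    (w1 = rotated w b t /\ w2 = w) \/ (w1 = w /\ w2 = rotated w b t) ->
    (forall x, a <= x <= c -> region p (v + x *: w2) -> region p (v + x *: w1)) ->
    (forall x, A x -> region p (v + x *: w1) /\ ~ region p (v + x *: w2)) ->
    c1 * fine (lebesgue_measure A) - C * q ^+ 2 <=
      \int[lebesgue_measure]_(x in `[0, r]) beam_integrand p k v w1 x -
      \int[lebesgue_measure]_(x in `[0, r]) beam_integrand p k v w2 x.
  move=> tq mA AW ww sub onA.
  have tde : `|t| < de by rewrite tq; exact: le_lt_trans qd.
  have t1 := lt_le_trans tde d3; have t2 := lt_le_trans tde d4.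
  have h0 : 0 <= K * `|t| by rewrite mulr_ge0.
  have dd x : 0 <= x <= r -> `|depth p v w1 x - depth p v w2 x| <= C2 * `|t|.
    by move=> xr; case: ww => -[-> ->]; [|rewrite distrC]; exact: Hd.
  have ds x : 0 <= x <= r -> ~ (a < x < c) ->
      `|source p (v + x *: w1) - source p (v + x *: w2)| <=
        C1 * `|t| + M * bump l (K * `|t|) x.
    by move=> xr nJ; case: ww => -[-> ->]; [|rewrite distrC]; exact: Hs.
  have Ar : A `<=` `[0, r]%classic.
    move=> x /AW/WJ[/andP[x1 x2] _]; rewrite /= in_itv /=.
    by rewrite (le_trans (ltW a0) x1) (le_trans x2 cr).
  have mid : measurable_fun setT (fun x => c1 * \1_A x).
    by apply: measurable_funM => //; exact: measurable_indic.
  rewrite -(Rintegral_indic c1 mA Ar).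
  have bA x : 0 <= x <= r -> `|c1 * \1_A x| <= c1.
    move=> _; rewrite indicE; case: (_ \in _); rewrite ?mulr1 ?mulr0 ?normr0.
      by rewrite gtr0_norm.
    exact: ltW.
  apply: le_trans (@Rintegral_compare R r _ _ (fun x => c1 * \1_A x) (C3 * `|t|)
    (r ^+ k * M) (K * `|t|) _ _ _ l r0 h0 M30 (measurable_beam_integrand Hp k v w1)
    (measurable_beam_integrand Hp k v w2) mid (bb w1) (bb w2) bA _).
    by rewrite lerD2l lerN2; apply: eq_imp_le; rewrite /C -tq; ring.
  move=> x xr; have := beam_integrand_diff k Hp xr (dd x xr).
  have /andP[x0 xr'] := xr.
  set S := source _ _ - _; set D := beam_integrand _ _ _ _ _ - _.
  have B0 : 0 <= bump l (K * `|t|) x by exact: bump_ge0.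
  have e0 : 0 <= expR (- depth p v w1 x) by exact: expR_ge0.
  have e1 : expR (- depth p v w1 x) <= 1.
    by rewrite -expR0 ler_expR oppr_le0 (depth_ge0 Hp).
  have kr : x ^+ k <= r ^+ k by rewrite lerXn2r ?nnegrE.
  have k0 : 0 <= x ^+ k by rewrite exprn_ge0.
  rewrite ler_norml => /andP[hD _].
  have [J|nJ] := pselect (a < x < c); last first.
    have nA : \1_A x = 0 :> R.
      rewrite indicE memNset// => /AW; rewrite /W /= in_itv /= => /andP[x1 x2].
      apply: nJ; apply/andP.
      by split; [move: x1 Qa|move: x2 Qc]; clear; lra.
    have hS := ds x xr nJ.
    have hP : `|x ^+ k * S * expR (- depth p v w1 x)| <= r ^+ k * `|S|.
      rewrite !normrM (ger0_norm e0) (ger0_norm k0) -[leRHS]mulr1.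
      exact: (ler_pM (mulr_ge0 k0 (normr_ge0 _)) e0 (ler_wpM2r (normr_ge0 _) kr) e1).
    have hS' : r ^+ k * `|S| <= r ^+ k * (C1 * `|t| + M * bump l (K * `|t|) x).
      by rewrite ler_wpM2l.
    move: hP; rewrite ler_norml => /andP[hP _].
    by rewrite nA mulr0 /C3; move: hD hP hS'; clear; lra.
  have xac : a <= x <= c by case/andP: J => ? ?; rewrite !ltW.
  have SA : intensity p * \1_A x <= S.
    rewrite /S /source -mulrBr ler_wpM2l ?(ltW I0)//.
    have [Ax|nAx] := pselect (A x).
      have [h1 h2] := onA x Ax.
      by rewrite !indicE (mem_set Ax) (mem_set h1) (memNset h2) subr0.
    rewrite [X in X <= _]indicE memNset//= subr_ge0 !indicE ler_nat.
    case: (boolP (v + x *: w2 \in region p)) => //.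
    by rewrite inE => /(sub x xac) h; rewrite mem_set.
  have xA : c1 * \1_A x <= x ^+ k * S * expR (- depth p v w1 x).
    have -> : c1 * \1_A x = a ^+ k * (intensity p * \1_A x) * expR (- (Ma * r)).
      by rewrite /c1; ring.
    have iA : 0 <= intensity p * \1_A x by rewrite mulr_ge0 ?indicE ?ler0n// ltW.
    have ka' : a ^+ k <= x ^+ k.
      by case/andP: xac => ? _; rewrite lerXn2r ?nnegrE// ltW.
    have ak0 : 0 <= a ^+ k by rewrite exprn_ge0// ltW.
    have dr : expR (- (Ma * r)) <= expR (- depth p v w1 x).
      rewrite ler_expR lerN2; apply: le_trans (depth_le Hp v w1 HMa x0) _.
      by rewrite ler_wpM2l.
    exact: (ler_pM (mulr_ge0 ak0 iA) (expR_ge0 _) (ler_pM ak0 iA ka' SA) dr).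
  have : 0 <= r ^+ k * M * bump l (K * `|t|) x by rewrite mulr_ge0.
  have : 0 <= r ^+ k * C1 * `|t| by rewrite !mulr_ge0.
  by rewrite /C3; move: hD xA; clear; lra.
have sgn : (-1) ^+ neg * (-1) ^+ neg = 1 :> R by rewrite -expr2 sqrr_sign.
have mW : measurable W by exact: measurable_itv.
have win := window_measure rho0 mE (ltW Q0); rewrite -/W in win.
have qde0 : q ^+ 2 < de0 by apply: le_lt_trans qq (lt_le_trans qd d2).
case: win => big.
- pose t : R := (-1) ^+ neg * q ^+ 2.
  have tq : `|t| = q ^+ 2 by rewrite /t normrM normr_sign mul1r gtr0_norm.
  have st : 0 < (-1) ^+ neg * t by rewrite /t mulrA sgn mul1r.
  exists t => //; rewrite distrC.
  have := main t w (rotated w b t) (W `&` E) tq (measurableI _ _ mW mE)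
    (@subIsetl _ _ _) (or_intror (conj erefl erefl)).
  move=> mn; apply: le_trans (ler_norm _); apply: le_trans (mn _ _).
  + rewrite lerD2r /Q in big *; rewrite -mulrA ler_pM2l//.
  + by move=> x xac; have [|h _ _] := Hw t x _ xac; [rewrite tq|exact: h].
  + move=> x [Wx Ex]; split=> //; have [xac win] := WJ x Wx.
    have [|_ _ h] := Hw t x _ xac; first by rewrite tq.
    by have [|+ _] := h; [rewrite tq|apply].
- pose t : R := - ((-1) ^+ neg * q ^+ 2).
  have tq : `|t| = q ^+ 2 by rewrite /t normrN normrM normr_sign mul1r gtr0_norm.
  have st : (-1) ^+ neg * t < 0 by rewrite /t mulrN mulrA sgn mul1r oppr_lt0.
  exists t => //.
  have := main t (rotated w b t) w (W `\` E) tq (measurableD mW mE)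
    (@subDsetl _ _ _) (or_introl (conj erefl erefl)).
  move=> mn; apply: le_trans (ler_norm _); apply: le_trans (mn _ _).
  + rewrite lerD2r /Q in big *; rewrite -mulrA ler_pM2l//.
  + by move=> x xac; have [|_ h _] := Hw t x _ xac; [rewrite tq|exact: h].
  + move=> x [Wx nEx]; split=> //; have [xac win] := WJ x Wx.
    have [|_ _ h] := Hw t x _ xac; first by rewrite tq.
    by have [|_ +] := h; [rewrite tq|apply].
Qed.

(** * Comparison of the boundaries *)

Lemma steady_attenuation (R : realType) (n : nat) (B : set 'rV[R]_n)
    (p : activity_attenuation R n) v w b r :
  admissible_pair B p -> 0 <= r ->
  (forall k rho, 0 <= rho -> boundary (attn_region p k) (v + rho *: w) ->
     transversal (attn_region p k) (v + rho *: w) w) ->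
  steady v w b 0 0 r (attenuation p).
Proof.
move=> Hp r0 H; apply: steady_sum => k; apply: steady_indic => //.
  apply: stable_between_ray => //; first exact: (piece_domain Hp (Some k)).
  by move=> rho rho0 _ _; exact: H.
move=> M; apply: smooth_lipschitz.
by have [_ _ Hk _ _] := Hp; have [] := Hk k.
Qed.

Lemma steady_source (R : realType) (n : nat) (B : set 'rV[R]_n)
    (p : activity_attenuation R n) v w b a c r :
  admissible_pair B p -> 0 <= r ->
  (forall rho, 0 <= rho -> ~ (a < rho < c) -> boundary (region p) (v + rho *: w) ->
     transversal (region p) (v + rho *: w) w) ->
  steady v w b a c r (source p).
Proof.
move=> Hp r0 H; apply: (@steady_indic R n v w b a c r _ (fun=> intensity p)) => //.
  apply: stable_between_ray => //; first exact: (piece_domain Hp None).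
  by move=> rho rho0 _; exact: H.
by move=> M; exists 0 => // y z _ _; rewrite subrr normr0 mul0r.
Qed.

(** With [|t| = q ^+ 2] the two estimates give [c1 * q <= (C1 + C2) * q ^+ 2], which fails for small
    [q]. *)
Lemma root_growth_not_lipschitz (R : realType) (J1 J2 : R -> R) (j1 j2 : R)
    (c1 C1 de1 C2 de2 : R) :
  0 < c1 -> 0 <= C1 -> 0 < de1 ->
  (forall q, 0 < q -> q < de1 ->
    exists2 t, `|t| = q ^+ 2 & c1 * q - C1 * q ^+ 2 <= `|J1 t - j1|) ->
  0 <= C2 -> 0 < de2 -> (forall t, `|t| < de2 -> `|J2 t - j2| <= C2 * `|t|) ->
  (forall t, J1 t = J2 t) -> j1 = j2 -> False.
Proof.
move=> c10 C10 de10 H1 C20 de20 H2 same same0.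
have C12 : 0 < C1 + C2 + 1 by rewrite ltr_wpDl// addr_ge0.
have [|q q0 /= /and5P[q1 q2 q3 q4 _]] :=
    @small_pos R [:: 1 / 2; de1 / 2; de2 / 2; c1 / (C1 + C2 + 1) / 2].
  by rewrite /= !divr_gt0.
have qde1 : q < de1 by lra.
have [t tq low] := H1 q q0 qde1.
have qq : q ^+ 2 <= q by rewrite expr2 ler_piMl ?(ltW q0)//; lra.
have td : `|t| < de2 by rewrite tq; lra.
have bad : c1 * q - C1 * q ^+ 2 <= C2 * q ^+ 2.
  by apply: le_trans low _; rewrite same same0 -tq; exact: H2.
have : q * (q * (C1 + C2 + 1)) <= q * (c1 / 2).
  rewrite ler_pM2l//; apply: le_trans (ler_wpM2r (ltW C12) q4) _.
  by apply: eq_imp_le; field; rewrite gt_eqF.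
have : 0 < q * c1 by rewrite mulr_gt0.
have : 0 < q ^+ 2 by rewrite exprn_gt0.
by move: bad; clear; lra.
Qed.

Lemma singular_ray_contradiction (R : realType) (n k : nat) (B : set 'rV[R]_n)
    (p1 p2 : activity_attenuation R n) v w b a c rho0 mu e x0 g d L (neg : bool) :
  admissible_pair B p1 -> admissible_pair B p2 ->
  (forall w', enorm w' = 1 ->
     divergent_beam k (source p1) (attenuation p1) v w' =
     divergent_beam k (source p2) (attenuation p2) v w') ->
  dotv w w = 1 -> dotv b b = 1 -> dotv w b = 0 ->
  boundary_chart (region p1) g x0 d L -> e < d ->
  0 < a -> a < rho0 < c -> 0 < mu ->
  (forall rho, a <= rho <= c -> `|v + rho *: w - x0| < e /\
     mu <= (-1) ^+ neg * dotv (grad g (v + rho *: w)) b) ->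
  g (v + rho0 *: w) = 0 -> dotv (grad g (v + rho0 *: w)) w = 0 ->
  (forall rho, ~ (a < rho < c) -> boundary (region p1) (v + rho *: w) ->
     transversal (region p1) (v + rho *: w) w) ->
  (forall i rho, boundary (attn_region p1 i) (v + rho *: w) ->
     transversal (attn_region p1 i) (v + rho *: w) w) ->
  (forall o rho, boundary (piece (p := p2) o) (v + rho *: w) ->
     transversal (piece (p := p2) o) (v + rho *: w) w) ->
  False.
Proof.
move=> Hp1 Hp2 eqD ww bb wb ch ed a0 arc mu0 Hac g0 Gw tr1 tra tr2.
have [r1 r10 out1] := ray_exit Hp1 v; have [r2 r20 out2] := ray_exit Hp2 v.
pose r := Num.max c (Num.max r1 r2).
have [rc rr1 rr2] : [/\ c <= r, r1 <= r & r2 <= r].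
  by rewrite !le_max !lexx !orbT.
have r0 : 0 <= r by apply: le_trans (ltW r10) rr1.
have [de0 [ka [de00 ka0 win]]] := tangency_window ch ed a0 arc mu0 Hac g0 Gw.
have sa1 : steady v w b 0 0 r (attenuation p1).
  by apply: (steady_attenuation _ Hp1 r0) => i rho _; exact: tra.
have sa2 : steady v w b 0 0 r (attenuation p2).
  by apply: (steady_attenuation _ Hp2 r0) => i rho _; exact: (tr2 (Some i)).
have ss1 : steady v w b a c r (source p1).
  by apply: (steady_source _ Hp1 r0) => rho _; exact: tr1.
have ss2 : steady v w b 0 0 r (source p2).
  by apply: (steady_source _ Hp2 r0) => rho _ _; exact: (tr2 None).
have [c1 [C1 [de1 [c10 C10 de10 H1]]]] :=
  beam_singular k Hp1 a0 arc rc sa1 ss1 de00 ka0 win.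
have [C2 [de2 [C20 de20 H2]]] := beam_lipschitz k Hp2 r0 sa2 ss2.
have same t : \int[lebesgue_measure]_(x in `[0, r]) beam_integrand p1 k v (rotated w b t) x =
    \int[lebesgue_measure]_(x in `[0, r]) beam_integrand p2 k v (rotated w b t) x.
  have unit_t := rotated_unit t ww bb wb.
  have dt : dotv (rotated w b t) (rotated w b t) = 1.
    by rewrite -(sqr_sqrtr (dotv_ge0 _)) -/(enorm _) unit_t expr1n.
  have := eqD _ unit_t.
  rewrite (divergent_beam_cut _ r0); last first.
    by move=> rho rrho; apply: (out1 _ rho None dt); exact: le_lt_trans rrho.
  rewrite (divergent_beam_cut _ r0)// => rho rrho.
  by apply: (out2 _ rho None dt); exact: le_lt_trans rrho.
have same0 : \int[lebesgue_measure]_(x in `[0, r]) beam_integrand p1 k v w x =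
    \int[lebesgue_measure]_(x in `[0, r]) beam_integrand p2 k v w x.
  by have := same 0; rewrite rotated0.
exact: (root_growth_not_lipschitz c10 C10 de10 H1 C20 de20 H2 same same0).
Qed.

(** A point off the second region's boundary and off the second pair's attenuating regions has a
    neighbourhood free of every boundary of the second pair. The window is placed in it, so the
    second beam sees only transversal crossings on the whole line. *)
Lemma boundary_region_sub (R : realType) (n : nat) (S B : set 'rV[R]_n)
    (p1 p2 : activity_attenuation R n) x0 :
  (2 <= n)%N -> open B -> B `&` S = set0 ->
  admissible_pair B p1 -> geometric_assumptions S B p1 ->
  admissible_pair B p2 -> geometric_assumptions S B p2 ->
  (forall v w, S v -> enorm w = 1 ->
     divergent_beam (n - 2) (source p1) (attenuation p1) v w =
     divergent_beam (n - 2) (source p2) (attenuation p2) v w) ->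
  boundary (region p1) x0 -> (forall k, ~ attn_region p2 k x0) ->
  boundary (region p2) x0.
Proof.
move=> n2 oB BS Hp1 geo1 Hp2 geo2 eqD bx0 nA; apply: contrapT => nb2.
have [g [d [L ch]]] := boundary_chart_exists (piece_domain Hp1 None) bx0.
have [[d0 _ _ _] _ _] := ch.
have x0r : region p1 x0.
  by apply: boundary_sub bx0; exact: domain_closed (piece_domain Hp1 None).
have [e1 e10 iso1] := piece_isolated Hp1 (o := None) x0r.
have : \forall z \near x0, forall o, ~ boundary (piece (p := p2) o) z.
  have := @filter_forall _ _ (fun o z => ~ boundary (piece (p := p2) o) z) (nbhs x0) _.
  apply=> o; have op : open (~` boundary (piece (p := p2) o)).
    by apply: closed_openC; exact: boundary_closed.
  have nbo : (~` boundary (piece (p := p2) o)) x0.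
    case: o {op} => [k|//] /= bk; apply: (nA k).
    by apply: boundary_sub bk; exact: domain_closed (piece_domain Hp2 (Some k)).
  exact: open_nbhs_nbhs.
move=> /near_normP[e2 e20 iso2].
have Bx0 : B x0 by apply: (@piece_sub _ _ _ _ Hp1 None).
have : \forall z \near x0, B z by apply: open_nbhs_nbhs.
move=> /near_normP[e3 e30 inB].
have [|e e_0 /= /and5P[ee1 ee2 ee3 ed _]] := @small_pos R [:: e1; e2; e3; d / 2].
  by rewrite /= e10 e20 e30 divr_gt0.
have edd : e < d by lra.
have [x [w [b [a1 [a2 [mu [neg [[ww bb wb] [a10 a20 mu0 gx Gx] seg tr]]]]]]]] :=
  good_line n2 Hp1 geo1 Hp2 geo2 bx0 ch e_0 (ltW edd).
have segB s : a1 <= s <= a2 -> B (x + s *: w).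
  by move=> /seg[h _]; apply: inB; exact: lt_le_trans ee3.
have wn : w != 0.
  apply: contra_eq_neq ww => ->; rewrite -(scale0r (0 : 'rV[R]_n)) dotvZl mul0r.
  by rewrite eq_sym oner_eq0.
have Bx : B x by have := segB 0; rewrite scale0r addr0 !ltW//; apply.
(* The vertex lies outside [B] whereas the window lies inside, so [tau] is not in [[a1, a2]]: the
   vertex is strictly before or strictly behind the window. *)
have [tau Sv] : exists t, S (x + t *: w) by have [_ _ _ H _] := geo1; exact: H.
have nBv : ~ B (x + tau *: w).
  by move=> Bv; have /seteqP[/(_ (x + tau *: w)) + _] := BS; apply.
(* Inside the window the only boundary of the first pair is that of its region, so the attenuating
   regions are crossed transversally everywhere. *)
have iso1' s k : a1 < s < a2 -> ~ boundary (attn_region p1 k) (x + s *: w).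
  move=> /andP[s1 s2] bk; have [|h _] := seg s; first by rewrite !ltW.
  have bz : boundary (region p1) (x + s *: w).
    apply/(iso1 _ (lt_le_trans h ee1)); apply/singular_setE; exists (Some k).
    exact: bk.
  suff E : Some k = None :> option 'I_(nattn p1) by [].
  apply: (@piece_disjoint _ _ _ _ Hp1 (Some k) None (x + s *: w)).
    by apply: boundary_sub bk; exact: domain_closed (piece_domain Hp1 (Some k)).
  by apply: boundary_sub bz; exact: domain_closed (piece_domain Hp1 None).
have trr s : ~ (a1 < s < a2) -> boundary (region p1) (x + s *: w) ->
    transversal (region p1) (x + s *: w) w.
  by move=> /tr[h _]; exact: (h None).
have tra i s : boundary (attn_region p1 i) (x + s *: w) ->
    transversal (attn_region p1 i) (x + s *: w) w.
  have [/iso1' h|/tr[h _]] := pselect (a1 < s < a2); first by move=> /h.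
  exact: (h (Some i)).
have tr2 o s : boundary (piece (p := p2) o) (x + s *: w) ->
    transversal (piece (p := p2) o) (x + s *: w) w.
  have [/andP[s1 s2]|/tr[_ h]] := pselect (a1 < s < a2); last exact: h.
  have [|h _] := seg s; first by rewrite !ltW.
  by move=> /(iso2 _ (lt_le_trans h ee2)).
have eqDv w' : enorm w' = 1 ->
    divergent_beam (n - 2) (source p1) (attenuation p1) (x + tau *: w) w' =
    divergent_beam (n - 2) (source p2) (attenuation p2) (x + tau *: w) w'.
  exact: eqD.
(* If the vertex comes before the window the ray has direction [w]; otherwise it runs backwards,
   with direction [- w], and the ends of the window are exchanged. *)
have [ta|at_] := ltP tau a1.
  have E rho : x + tau *: w + rho *: w = x + (tau + rho) *: w.
    by rewrite scalerDl addrA.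
  apply: (singular_ray_contradiction (rho0 := - tau) Hp1 Hp2 eqDv ww bb wb ch edd
    (a := a1 - tau) (c := a2 - tau) (mu := mu) (neg := neg)).
  - by rewrite subr_gt0.
  - by apply/andP; split; [move: a10|move: a20]; clear; lra.
  - exact: mu0.
  - move=> rho /andP[h1 h2]; rewrite E; apply: seg.
    by apply/andP; split; [move: h1|move: h2]; clear; lra.
  - by rewrite E subrr scale0r addr0.
  - by rewrite E subrr scale0r addr0.
  - move=> rho nJ; rewrite E; apply: trr => /andP[h1 h2]; apply: nJ.
    by apply/andP; split; [move: h1|move: h2]; clear; lra.
  - by move=> i rho; rewrite E; exact: tra.
  - by move=> o rho; rewrite E; exact: tr2.
have ta2 : a2 < tau.
  by rewrite ltNge; apply/negP => h; apply: nBv; apply: segB; rewrite at_.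
have E rho : x + tau *: w + rho *: (- w) = x + (tau - rho) *: w.
  by rewrite scalerN scalerBl addrA.
have trN (E' : set 'rV[R]_n) y : transversal E' y w -> transversal E' y (- w).
  move=> [g' [d' [L' [h1 h2]]]]; exists g', d', L'; split=> //.
  by rewrite dotvNr oppr_eq0.
have wwN : dotv (- w) (- w) = 1 by rewrite dotvNl dotvNr opprK.
have wbN : dotv (- w) b = 0 by rewrite dotvNl wb oppr0.
apply: (singular_ray_contradiction (rho0 := tau) Hp1 Hp2 eqDv wwN bb wbN ch edd
    (a := tau - a2) (c := tau - a1) (mu := mu) (neg := neg)).
- by rewrite subr_gt0.
- by apply/andP; split; [move: a20|move: a10]; clear; lra.
- exact: mu0.
- move=> rho /andP[h1 h2]; rewrite E; apply: seg.
  by apply/andP; split; [move: h2|move: h1]; clear; lra.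
- by rewrite E subrr scale0r addr0.
- by rewrite E subrr scale0r addr0 dotvNr Gx oppr0.
- move=> rho nJ; rewrite E => bz; apply: trN; apply: trr bz => /andP[h1 h2]; apply: nJ.
  by apply/andP; split; [move: h2|move: h1]; clear; lra.
- by move=> i rho; rewrite E => bz; apply: trN; exact: tra.
- by move=> o rho; rewrite E => bz; apply: trN; exact: tr2.
Qed.

(** * Lines avoiding a compact set *)

Lemma connected_closed_cover (T : topologicalType) (D A A' : set T) :
  connected D -> closed A -> closed A' -> D `<=` A `|` A' ->
  (forall x, A x -> ~ A' x) -> D `&` A !=set0 -> D `<=` A.
Proof.
move=> cD cA cA' DA AA' DA0.
have -> : D = D `&` A; last exact: subIsetr.
apply/esym; apply: cD DA0 _ _; last by exists A.
exists (~` A'); first by rewrite openC.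
apply/seteqP; split=> x [Dx H]; split=> //; first exact: AA'.
by case: (DA x Dx).
Qed.

(** The set is the projection of a compact subset of [K * I]. *)
Lemma compact_slice_closed (T U V : topologicalType) (K : set T) (I : set U)
    (E : set V) (F : T * U -> V) :
  hausdorff_space T -> compact K -> compact I -> closed E -> continuous F ->
  closed [set y | K y /\ exists2 s, I s & E (F (y, s))].
Proof.
move=> hT cK cI cE cF.
have -> : [set y | K y /\ exists2 s, I s & E (F (y, s))] =
    fst @` ((K `*` I) `&` F @^-1` E).
  apply/seteqP; split=> [y [Ky [s Is Es]]|_ [[y s] [[Ky Is] Es] <-]].
    by exists (y, s).
  by split=> //; exists s.
apply: (compact_closed hT); apply: continuous_compact.
  by apply: continuous_subspaceT => z; exact: cvg_fst.
have cP : closed (F @^-1` E) by apply: preimage_closed cE => z _; exact: cF.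
exact: (compact_closedI (compact_setX cK cI) cP).
Qed.

Lemma convex_hull_between (R : realType) (n : nat) (E : set 'rV[R]_n) x d s s' :
  0 <= s -> 0 <= s' -> 0 < s + s' -> E (x + s *: d) -> E (x - s' *: d) ->
  convex_hull E x.
Proof.
move=> s0 s'0 ss E1 E2 C [cC EC]; set l := s' / (s + s').
have l0 : 0 <= l by rewrite divr_ge0// ltW.
have l1 : l <= 1 by rewrite ler_pdivrMr// mul1r lerDr.
have := cC (x + s *: d) (x - s' *: d) (Itv01 l0 l1) (mem_set (EC _ E1))
  (mem_set (EC _ E2)).
rewrite inE; suff -> : conv (Itv01 l0 l1) (x + s *: d : convex_lmodType _)
    (x - s' *: d) = x by [].
change (l *: (x + s *: d) + (1 - l) *: (x - s' *: d) = x).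
have -> : 1 - l = s / (s + s') by rewrite /l; field; rewrite gt_eqF.
rewrite !scalerDr addrACA -scalerDl scalerN !scalerA.
have -> : l + s / (s + s') = 1 by rewrite /l; field; rewrite gt_eqF.
by rewrite /l mulrAC [s / _ * _]mulrAC [s' * s]mulrC subrr scale1r addr0.
Qed.

(** If every line through [x] met [E], one of the two disjoint closed sets of turning parameters
    would fill [0, 1] by connectedness. Since [d 1 = - d 0], the two half-lines are exchanged at the
    end of the turn, so the other set contains 1 as well. *)
Lemma free_line (R : realType) (n : nat) (E : set 'rV[R]_n) x :
  (2 <= n)%N -> compact E -> ~ convex_hull E x ->
  exists2 u, u != 0 & forall t : R, ~ E (x + t *: u).
Proof.
case: n E x => [|[|n]] // E x _ cE nx; apply: contrapT => nou.
pose i0 : 'I_n.+2 := ord0; pose i1 : 'I_n.+2 := ord_max.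
(* d turns from e_0 to - e_0; the parameters l for which the half-line from x in  *)
(* direction d l, respectively - d l, meets E form closed sets covering [0, 1],   *)
(* disjoint since x is not in the convex hull.                                    *)
pose d (l : R) : 'rV[R]_n.+2 :=
  (1 - 2 * l) *: delta_mx 0 i0 + (l * (1 - l)) *: delta_mx 0 i1.
(* If [|1 - 2 * l| < 1 / 5] then [l * (1 - l) = (1 - (1 - 2 * l) ^+ 2) / 4] exceeds 1 / 5. The bound
   confines the parameters of points of [E] to [[- T, T]]. *)
have dn l : 1 / 5 <= `|d l|.
  have := rV_coord_le (d l) i0; have := rV_coord_le (d l) i1.
  rewrite !mxE /= !mulr0 !mulr1 addr0 add0r eqxx mulr1 => /(le_trans (ler_norm _)) k1.
  move=> h2; have k2 := le_trans (ler_norm _) h2.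
  have := ler_norm (- (1 - 2 * l)); rewrite normrN => /le_trans/(_ h2) k3.
  have k4 : 0 <= (`|d l| - (1 - 2 * l)) * (`|d l| - - (1 - 2 * l)).
    by rewrite mulr_ge0// subr_ge0.
  move: k1 k4 (normr_ge0 (d l)); move: `|d l| => m; clear => k1 k4 m0.
  rewrite leNgt; apply/negP => m5.
  have : m * m <= m * (1 / 5) by rewrite ler_wpM2l// ltW.
  by move: k1 m0 k4 m5; lra.
have [M M0 HM] := @bounded_family R _ unit (fun=> E) (fun=> cE).
pose T := 5 * (M + `|x|).
have bT l s : E (x + s *: d l) -> `|s| <= T.
  move=> /(HM tt) h; have : `|s *: d l| <= M + `|x|.
    have -> : s *: d l = (x + s *: d l) - x by rewrite addrAC subrr add0r.
    by apply: le_trans (ler_normB _ _) _; rewrite lerD2r.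
  rewrite normrZ => h'; have := ler_wpM2l (normr_ge0 s) (dn l).
  by rewrite /T; move: h'; clear; lra.
have cF : continuous (fun z : R * R => x + z.2 *: d z.1).
  move=> z; apply: cvgD; first exact: cvg_cst.
  apply: cvgZ; first exact: cvg_snd.
  apply: cvgD; apply: cvgZr_tmp.
    by apply: cvgB; [exact: cvg_cst|apply: cvgM; [exact: cvg_cst|exact: cvg_fst]].
  by apply: cvgM; [exact: cvg_fst|apply: cvgB; [exact: cvg_cst|exact: cvg_fst]].
pose A (a b : R) := [set l | `[0, 1]%classic l /\
  exists2 s, `[a, b]%classic s & E (x + s *: d l)].
have cA a b : closed (A a b).
  exact: (compact_slice_closed (@Rhausdorff R) (@segment_compact _ _ _)
    (@segment_compact _ _ _) (compact_closed (@norm_hausdorff _ _) cE) cF).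
have cover l : `[0, 1]%classic l -> A 0 T l \/ A (- T) 0 l.
  move=> l01; have dl0 : d l != 0.
    by rewrite -normr_gt0; apply: lt_le_trans (dn l); lra.
  have [s Es] : exists s, E (x + s *: d l).
    apply: contrapT => H; apply: nou; exists (d l) => // t Et.
    by apply: H; exists t.
  have := bT _ _ Es; rewrite ler_norml => /andP[s1 s2].
  have [s0|/ltW s0] := leP 0 s; [left|right]; split=> //; exists s => //=;
    by rewrite in_itv /= ?s1 ?s2 s0.
have nEx : ~ E x by move=> Ex; apply: nx => C [_ EC]; exact: EC.
have disj l : A 0 T l -> ~ A (- T) 0 l.
  move=> [_ [s + Es]] [_ [s' + Es']]; rewrite /= !in_itv /= => /andP[s0 _] /andP[_ s'0].
  apply: nx; apply: (@convex_hull_between _ _ E x (d l) s (- s')) => //.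
  - by rewrite oppr_ge0.
  - rewrite lt_neqAle addr_ge0// ?oppr_ge0// andbT; apply/eqP => ss.
    have sz : s = 0 by move: ss s0 s'0; clear; lra.
    by apply: nEx; move: Es; rewrite sz scale0r addr0.
  - by rewrite scaleNr opprK.
have flip : d 1 = - d 0.
  by rewrite /d mulr0 mulr1 mul0r subr0 subrr mulr0 !scale0r !addr0 -scaleNr;
    congr (_ *: _); ring.
have i01 : `[0, 1]%classic (0 : R) by rewrite /= in_itv /= lexx ler01.
have i11 : `[0, 1]%classic (1 : R) by rewrite /= in_itv /= lexx ler01.
have seg := @segment_connected R 0 1.
have fl1 : A 0 T 0 -> A (- T) 0 1.
  move=> [_ [s + Es]]; rewrite /= in_itv /= => /andP[s0 sT]; split=> //.
  by exists (- s); rewrite ?flip ?scalerN ?scaleNr ?opprK//= in_itv /= lerN2 sT oppr_le0.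
have fl2 : A (- T) 0 0 -> A 0 T 1.
  move=> [_ [s + Es]]; rewrite /= in_itv /= => /andP[s0 sT]; split=> //.
  exists (- s); rewrite ?flip ?scalerN ?scaleNr ?opprK//= in_itv /= oppr_ge0 sT.
  by rewrite lerNl.
have [h|h] := cover 0 i01.
- apply: (disj 1); last exact: fl1.
  apply: (connected_closed_cover seg (cA 0 T) (cA (- T) 0) cover disj) i11.
  by exists 0.
- apply: (disj 1); first exact: fl2.
  have disj' l : A (- T) 0 l -> ~ A 0 T l by move=> h1 h2; exact: (disj l).
  have cover' l : `[0, 1]%classic l -> A (- T) 0 l \/ A 0 T l.
    by move=> /cover[]; [right|left].
  apply: (connected_closed_cover seg (cA (- T) 0) (cA 0 T) cover' disj') i11.
  by exists 0.
Qed.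

(** For base points in a bounded set only a compact range of [t] can reach [E], so the base points
    of parallel lines meeting [E] form a closed set there. *)
Lemma free_lines_near (R : realType) (n : nat) (E : set 'rV[R]_n) x u :
  compact E -> u != 0 -> (forall t : R, ~ E (x + t *: u)) ->
  exists2 e, 0 < e & forall y (t : R), `|y - x| < e -> ~ E (y + t *: u).
Proof.
move=> cE u0 nE; have [M M0 HM] := @bounded_family R _ unit (fun=> E) (fun=> cE).
have u0' : 0 < `|u| by rewrite normr_gt0.
pose T := (M + (`|x| + 1)) / `|u|.
have bT y s : `|y| <= `|x| + 1 -> E (y + s *: u) -> `|s| <= T.
  move=> yx /(HM tt) h; rewrite /T ler_pdivlMr// -normrZ.
  have -> : s *: u = (y + s *: u) - y by rewrite addrAC subrr add0r.
  by apply: le_trans (ler_normB _ _) _; exact: lerD.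
have cF : continuous (fun z : 'rV[R]_n * R => z.1 + z.2 *: u).
  move=> z; apply: cvgD; first exact: cvg_fst.
  by apply: cvgZr_tmp; exact: cvg_snd.
have cl := compact_slice_closed (@norm_hausdorff _ _)
  (@sup_ball_compact R n (`|x| + 1)) (@segment_compact R (- T) T)
  (compact_closed (@norm_hausdorff _ _) cE) cF.
have /near_normP[e e0 He] : \forall y \near x, ~ (`|y| <= `|x| + 1 /\
    exists2 s, `[- T, T]%classic s & E (y + s *: u)).
  by apply: (closed_openC cl); move=> [_ [s _]]; exact: nE.
exists (Num.min e 1); first by rewrite lt_min e0 ltr01.
move=> y t; rewrite lt_min => /andP[ye y1] Ey; apply: (He y ye).
have yx : `|y| <= `|x| + 1.
  have -> : y = x + (y - x) by rewrite addrCA subrr addr0.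
  by apply: le_trans (ler_normD _ _) _; rewrite lerD2l ltW.
by split=> //; exists t => //=; rewrite in_itv /= -ler_norml (bT y).
Qed.

Lemma beam_gt0 (R : realType) (n : nat) (B : set 'rV[R]_n)
    (p : activity_attenuation R n) k (v w : 'rV[R]_n) (rho0 : R) :
  admissible_pair B p -> dotv w w = 1 -> 0 < rho0 ->
  (region p)° (v + rho0 *: w) ->
  0 < divergent_beam k (source p) (attenuation p) v w.
Proof.
move=> Hp ww r0 inr; have [r rp Hr] := ray_exit Hp v.
have [I0 _ _ _ _] := Hp.
have [M M0 HM] := attenuation_bounded Hp.
rewrite (@divergent_beam_cut _ _ _ _ _ _ _ (ltW rp)); last first.
  by move=> rho rr; exact: (Hr w rho None ww rr).
have rr0 : rho0 <= r.
  rewrite leNgt; apply/negP => h; apply: (Hr w rho0 None ww h).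
  exact: interior_subset inr.
have : \forall s \near rho0, region p (v + s *: w).
  exact: (@line_continuous _ _ v w rho0 _ inr).
move=> /near_normP[e e0 He].
(* The interval [[rho0 - h, rho0]] stays in the region and, because [h <= rho0 / 2], away from 0,
   where the weight [rho ^+ k] may vanish. *)
pose h := Num.min (e / 2) (rho0 / 2).
have h0 : 0 < h by rewrite lt_min !divr_gt0.
have he : h < e by rewrite gt_min; apply/orP; left; move: e0; clear; lra.
have hr : h <= rho0 / 2 by rewrite ge_min lexx orbT.
pose W := `[rho0 - h, rho0]%classic.
have mW : measurable W by exact: measurable_itv.
have Wr : W `<=` `[0, r]%classic.
  move=> x; rewrite /W /= !in_itv /= => /andP[x1 x2]; apply/andP.
  by split; [move: x1 hr r0|move: x2 rr0]; clear; lra.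
pose c := (rho0 - h) ^+ k * intensity p * expR (- (M * r)).
have rh0 : 0 < rho0 - h by move: hr r0; clear; lra.
have c0 : 0 < c by rewrite /c !mulr_gt0 ?exprn_gt0 ?expR_gt0.
have mes : fine (lebesgue_measure W) = h.
  rewrite lebesgue_measure_itv /= lte_fin ifT; last by move: h0; clear; lra.
  by rewrite -EFinB /=; ring.
apply: (@lt_le_trans _ _ (c * h)); first exact: mulr_gt0.
rewrite -{1}mes -(Rintegral_indic c mW Wr).
apply: (@le_bounded_Rintegral _ _ _ _ c (r ^+ k * intensity p)).
- apply: measurable_funM; first exact: measurable_cst.
  exact: measurable_indic.
- exact: measurable_beam_integrand Hp k v w.
- move=> x _; rewrite indicE; case: (_ \in _); rewrite ?mulr1 ?mulr0 ?normr0 ?(ltW c0)//.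
  by rewrite gtr0_norm.
- move=> x /(beam_integrand_itv Hp k v w)/andP[b0 b1].
  by rewrite ger0_norm.
- move=> x xr; have /andP[b0 _] := beam_integrand_itv Hp k v w xr.
  have [Wx|nWx] := pselect (W x); last by rewrite indicE memNset// mulr0.
  rewrite indicE mem_set// mulr1.
  have Rx : region p (v + x *: w).
    apply: He; move: Wx; rewrite /W /= in_itv /= => /andP[x1 x2].
    by rewrite ltr_norml; move: x1 x2 he e0; clear; lra.
  rewrite /beam_integrand /source indicE mem_set// mulr1 /c.
  have /andP[x0 xr'] := xr.
  have xk : (rho0 - h) ^+ k <= x ^+ k.
    move: Wx; rewrite /W /= in_itv /= => /andP[x1 _].
    by rewrite lerXn2r ?nnegrE// ltW.
  have dr : expR (- (M * r)) <= expR (- depth p v w x).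
    rewrite ler_expR lerN2; apply: le_trans (depth_le Hp v w HM x0) _.
    by rewrite ler_wpM2l.
  have k0 : 0 <= (rho0 - h) ^+ k by rewrite exprn_ge0// ltW.
  exact: (ler_pM (mulr_ge0 k0 (ltW I0)) (expR_ge0 _) (ler_wpM2r (ltW I0) xk) dr).
Qed.

Lemma beam_eq0 (R : realType) (n : nat) (p : activity_attenuation R n) k (v w : 'rV[R]_n) :
  (forall rho, ~ region p (v + rho *: w)) ->
  divergent_beam k (source p) (attenuation p) v w = 0.
Proof.
move=> out; rewrite /divergent_beam.
transitivity (\int[@lebesgue_measure R]_(rho in `[0, +oo[) (0 : R)).
  apply: eq_Rintegral => rho _.
  by rewrite /source indicE memNset ?mulr0 ?mul0r//; exact: out.
by rewrite Rintegral_cst// mul0r.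
Qed.

(** For a vertex [y + t *: u], this is the unit direction along the line that leads back to [y],
    with the distance [rho]. *)
Lemma unit_toward (R : realType) (n : nat) (u : 'rV[R]_n) (t : R) :
  u != 0 -> t != 0 -> exists w rho,
    [/\ enorm w = 1, dotv w w = 1, 0 < rho, rho *: w = - (t *: u) &
      exists c : R, w = c *: u].
Proof.
move=> u0 t0; have uu := dotv_gt0 u0.
have e0 : 0 < enorm u by rewrite /enorm sqrtr_gt0.
have ee : enorm u ^+ 2 = dotv u u by rewrite sqr_sqrtr// dotv_ge0.
have r0 : 0 < `|t| * enorm u by rewrite mulr_gt0// normr_gt0.
exists ((- t / (`|t| * enorm u)) *: u), (`|t| * enorm u).
have ww : dotv ((- t / (`|t| * enorm u)) *: u) ((- t / (`|t| * enorm u)) *: u) = 1.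
  rewrite dotvZl dotvZr -ee.
  have -> : - t / (`|t| * enorm u) * (- t / (`|t| * enorm u) * enorm u ^+ 2) =
    t ^+ 2 / `|t| ^+ 2 by field; rewrite normr_eq0 t0 (gt_eqF e0).
  by rewrite real_normK ?num_real// divff// sqrf_eq0.
split=> //; last by eexists.
- by rewrite /enorm ww sqrtr1.
- by rewrite scalerA mulrCA divff ?gt_eqF// mulr1 scaleNr.
Qed.

Lemma region_attenuation_disjoint (R : realType) (n : nat) (S B : set 'rV[R]_n)
    (p1 p2 : activity_attenuation R n) m x k :
  (2 <= n)%N -> B `&` S = set0 -> admissible_pair B p1 ->
  admissible_pair B p2 -> geometric_assumptions S B p2 ->
  (forall v w, S v -> enorm w = 1 ->
     divergent_beam m (source p1) (attenuation p1) v w =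
     divergent_beam m (source p2) (attenuation p2) v w) ->
  region p1 x -> ~ attn_region p2 k x.
Proof.
move=> n2 BS Hp1 Hp2 [_ sh _ lines _] eqD Rx Ax.
have [_ [dom1 R1B _] _ _ _] := Hp1; have [_ [dom2 _ _] dens _ _] := Hp2.
have nh : ~ convex_hull (region p2) x.
  move=> hx; have /seteqP[/(_ x) + _] := sh; apply; split=> //.
  apply: subset_closure => /=; rewrite gt_eqF//.
  apply: (@lt_le_trans _ _ (attn_density p2 k x * \1_(attn_region p2 k) x)).
    by rewrite indicE mem_set// mulr1; have [_] := dens k; exact.
  rewrite /attenuation.
  apply: (ler_single_sum (F := fun k => attn_density p2 k x * \1_(attn_region p2 k) x)) => j.
  by rewrite mulr_ge0 ?indicE ?ler0n// ltW//; have [_] := dens j; exact.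
have [c2 _ _] := dom2; have [u u0 nu] := free_line n2 c2 nh.
have [e e0 ne] := free_lines_near c2 u0 nu.
have [_ [D [oD _ _ RD]] _] := dom1.
(* [x] may be a boundary point of the first region; an interior point nearby makes the first beam
   positive, while its parallel line still misses the second region. *)
have [y [Dy yx]] : exists y, D y /\ `|y - x| < e.
  have : closure D x by rewrite -RD.
  move=> /(_ [set y | `|y - x| < e])[|y [Dy yx]]; last by exists y.
  by apply: open_nbhs_nbhs; split; [exact: open_norm_ball|rewrite /= subrr normr0].
have Ry : (region p1)° y.
  apply: (@filterS _ (nbhs y) _ D); last exact: open_nbhs_nbhs.
  by rewrite RD; exact: subset_closure.
have By : B y by apply: R1B; exact: interior_subset Ry.
have [t St] := lines y u By u0.
have t0 : t != 0.
  apply/eqP => t0; have /seteqP[/(_ y) + _] := BS; apply; split=> //.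
  by rewrite t0 scale0r addr0 in St.
have [w [rho [ew ww rho0 wr [c wc]]]] := unit_toward u0 t0.
have := eqD _ w St ew; rewrite [RHS]beam_eq0.
  apply/eqP; rewrite gt_eqF//; apply: (@beam_gt0 _ _ B p1 _ _ _ rho) => //.
  by rewrite wr addrK.
by move=> s; rewrite wc scalerA -addrA -scalerDl; exact: ne.
Qed.

(** * Domains with the same boundary *)

Lemma delta_norm_le (R : realType) (n : nat) (i : 'I_n) :
  `|delta_mx 0 i : 'rV[R]_n| <= 1.
Proof.
apply: rV_norm_le => // j; rewrite mxE eqxx /=; case: (_ == _).
  by rewrite normr1.
by rewrite normr0.
Qed.

Lemma dotv_delta (R : realType) (n : nat) (a : 'rV[R]_n) (i : 'I_n) :
  dotv a (delta_mx 0 i) = a 0 i.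
Proof.
rewrite /dotv (bigD1 i)//= big1 => [|j ji]; first by rewrite addr0 mxE !eqxx mulr1.
by rewrite mxE (negbTE ji) mulr0.
Qed.

Lemma coordinate_max (R : realType) (n : nat) (E : set 'rV[R]_n) (i : 'I_n) :
  compact E -> E !=set0 ->
  exists2 x, boundary E x & forall y, E y -> y 0 i <= x 0 i.
Proof.
move=> cE E0.
have [x Ex Hx] := @EVT_max_rV R n (fun y => y 0 i) E E0 cE
  (continuous_subspaceT (@coord_continuous _ _ _ 0 i)).
have Ex' : E x by rewrite inE in Ex.
have Hx' y : E y -> y 0 i <= x 0 i by move=> Ey; apply: Hx; rewrite inE.
exists x => //; split; first exact: subset_closure.
move=> /near_normP[d d0 Hd].
have d2 : 0 < d / 2 by rewrite divr_gt0.
have : E (x + (d / 2) *: delta_mx 0 i).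
  apply: Hd; rewrite addrAC subrr add0r normrZ gtr0_norm//.
  have := ler_wpM2l (ltW d2) (@delta_norm_le R n i).
  by move: d0; clear; lra.
move=> /Hx'; rewrite !mxE !eqxx mulr1; move: d2; clear; lra.
Qed.

(** Otherwise a small step along the opposite of [grad g x - e], where [e] is the i-th unit vector,
    would lower [g] and raise the i-th coordinate, leading to a point of [E] higher than [x]. *)
Lemma outer_gradient (R : realType) (n : nat) (E : set 'rV[R]_n) g x d L (i : 'I_n) :
  boundary_chart E g x d L -> g x = 0 -> (forall y, E y -> y 0 i <= x 0 i) ->
  0 < dotv (grad g x) (delta_mx 0 i).
Proof.
move=> [qg _ H] gx Hx; set G := grad g x; set e : 'rV[R]_n := delta_mx 0 i.
have [d0 _ _ _] := qg; have xd : `|x - x| < d by rewrite subrr normr0.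
have [G0 _ _] := H x xd.
have Ge : dotv G e = G 0 i by exact: dotv_delta.
rewrite ltNge; apply/negP => Gle.
have Gb : 0 < dotv G (G - e).
  by rewrite dotvDr dotvNr; move: (dotv_gt0 G0) Gle; rewrite -/G; clear; lra.
have [a /andP[a0 ad] Ha] := quadratic_mono qg Gb.
have B0 : 0 < `|G - e| + 1 by rewrite ltr_wpDl.
pose s := a / 2 / (`|G - e| + 1).
have s0 : 0 < s by rewrite !divr_gt0.
pose y := x - s *: (G - e).
have ya : `|y - x| < a.
  rewrite /y addrAC subrr add0r normrN normrZ gtr0_norm//.
  have : s * (`|G - e| + 1) = a / 2 by rewrite /s divfK// gt_eqF.
  by move: s0 a0; clear; lra.
have [_ hy] := Ha y s ya.
have : E y.
  have [_ [_ Ey] _] := H y (lt_le_trans ya ad); apply: Ey; rewrite -gx ltW//.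
  have yx : y + s *: (G - e) = x by rewrite /y subrK.
  by move: hy; rewrite yx; apply=> //; rewrite subrr normr0.
have yi (G' : 'rV[R]_n) : (x - s *: (G' - e)) 0 i = x 0 i + s * (1 - G' 0 i).
  by rewrite !mxE !eqxx /=; ring.
rewrite Ge in Gle; have s1 : 0 < s * (1 - G 0 i).
  by rewrite mulr_gt0//; move: Gle; clear; lra.
by move=> /Hx; rewrite /y yi; move: s1; clear; lra.
Qed.

(** [D] consists of interior points of [E], so it avoids the boundary of [E']; hence the trace of
    [E'] on the connected set [D] is open and closed. *)
Lemma domain_dichotomy (R : realType) (n : nat) (D E E' : set 'rV[R]_n) :
  open D -> connected D -> E = closure D -> closed E' ->
  boundary E' `<=` boundary E -> D `<=` E' \/ D `&` E' = set0.
Proof.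
move=> oD cD ED cE' bE.
have DE x : D x -> E° x.
  move=> Dx; apply: (@filterS _ (nbhs x) _ D); last exact: open_nbhs_nbhs.
  by rewrite ED; exact: subset_closure.
have nb x : D x -> E' x -> E'° x.
  move=> Dx E'x; apply: contrapT => nI.
  have [_] : boundary E x by apply: bE; split=> //; exact: subset_closure.
  by apply; exact: DE.
have [D0|D0] := pselect (D `&` E' !=set0); [left|right]; last first.
  by apply/seteqP; split=> // x Dx; case: D0; exists x.
have -> : D = D `&` E'; last exact: subIsetr.
apply/esym; apply: cD D0 _ _; last by exists E'.
exists E'°; first exact: open_interior.
apply/seteqP; split=> x [Dx H]; split=> //; first exact: nb.
exact: interior_subset H.
Qed.

Lemma domain_boundary_inj (R : realType) (n : nat) (E1 E2 : set 'rV[R]_n) (i : 'I_n) :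
  compact_smooth_domain E1 -> compact_smooth_domain E2 ->
  boundary E1 = boundary E2 -> E1 = E2.
Proof.
have absurd (a b c : R) : - c < a - b -> a + c <= b -> False by clear; lra.
move=> dom1 dom2 bE; have cl1 := domain_closed dom1; have cl2 := domain_closed dom2.
have [c1 [D1 [oD1 [x1 Dx1] cD1 ED1]] _] := dom1.
have [c2 [D2 [oD2 [x2 Dx2] cD2 ED2]] _] := dom2.
have S1 : D1 `<=` E1 by rewrite ED1; exact: subset_closure.
have S2 : D2 `<=` E2 by rewrite ED2; exact: subset_closure.
(* Excludes the mixed cases: a point of the open set [D] lying in the closure of [D'] would force
   [D] to meet [D']. *)
have mix (D D' E E' : set 'rV[R]_n) z : open D -> D z -> D `<=` E -> E' = closure D' ->
    D `<=` E' -> D' `&` E = set0 -> False.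
  move=> oD Dz DE ED' DE' /seteqP[D'E _].
  have : closure D' z by rewrite -ED'; exact: DE'.
  move=> /(_ D)[|y [D'y Dy]]; first exact: open_nbhs_nbhs.
  by apply: (D'E y); split=> //; exact: DE.
have b12 : boundary E2 `<=` boundary E1 by rewrite bE.
have b21 : boundary E1 `<=` boundary E2 by rewrite bE.
have [i12|n12] := domain_dichotomy oD1 cD1 ED1 cl2 b12;
have [i21|n21] := domain_dichotomy oD2 cD2 ED2 cl1 b21.
- by apply/seteqP; split; [rewrite {1}ED1|rewrite {1}ED2];
    rewrite closureE => x; apply.
- by case: (mix _ _ _ _ _ oD1 Dx1 S1 ED2 i12 n21).
- by case: (mix _ _ _ _ _ oD2 Dx2 S2 ED1 i21 n12).
(* What remains is that each interior misses the other region. The height is maximal at boundary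
   points, so the common boundary gives both regions the same highest level. *)
have [x bx Hx] := coordinate_max i c1 (ex_intro _ _ (S1 _ Dx1)).
have [x' bx' Hx'] := coordinate_max i c2 (ex_intro _ _ (S2 _ Dx2)).
have Hx2 y : E2 y -> y 0 i <= x 0 i.
  move=> /Hx' h; apply: le_trans h _; apply: Hx.
  by apply: (boundary_sub cl1); exact: b12.
have [g [d [L ch]]] := boundary_chart_exists dom1 bx.
have [qg _ H] := ch; have [d0 _ _ _] := qg.
have gx : g x = 0.
  by have [|_ _ [+ _]] := H x; [rewrite subrr normr0|exact].
have [a /andP[a0 ad] Ha] := quadratic_mono qg (outer_gradient ch gx Hx).
(* [y] is within [s] of [x], so raising it by [s] stays in the [a]-ball, yet takes it above the
   level of [x]. *)
pose s := a / 3; have s0 : 0 < s by rewrite divr_gt0.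
have [y [Dy yx]] : exists y, D2 y /\ `|y - x| < s.
  have : closure D2 x.
    by rewrite -ED2; apply: (boundary_sub cl2); exact: b21.
  move=> /(_ [set y | `|y - x| < s])[|y [Dy yx]]; last by exists y.
  by apply: open_nbhs_nbhs; split; [exact: open_norm_ball|rewrite /= subrr normr0].
have nE1 y' : `|y' - x| < a -> 0 < g y' -> ~ E1 y'.
  move=> ya gy; have [_ [h _] _] := H y' (lt_le_trans ya ad).
  by move=> /h; rewrite leNgt gy.
have sa : s < a by rewrite /s; move: a0; clear; lra.
have ya := lt_trans yx sa.
have gy : 0 < g y.
  rewrite ltNge; apply/negP => gy; have [_ [_ h] _] := H y (lt_le_trans ya ad).
  by have /seteqP[/(_ y) + _] := n21; apply; split=> //; exact: h.
(* [g] is positive at [y] and increases upwards, so the vertical segment avoids the first region and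
   with it the common boundary. It starts in the second region and cannot leave it. *)
have up t : 0 <= t -> t <= s -> ~ boundary E2 (y + t *: delta_mx 0 i).
  move=> t0 ts /b12/(boundary_sub cl1); have [t0'|t0'] := eqVneq t 0.
    by rewrite t0' scale0r addr0; exact: nE1.
  have tp : 0 < t by rewrite lt_neqAle eq_sym t0'.
  have za : `|y + t *: delta_mx 0 i - x| < a.
    rewrite addrAC; apply: le_lt_trans (ler_normD _ _) _.
    rewrite normrZ (ger0_norm t0).
    have := ler_wpM2l t0 (@delta_norm_le R n i).
    by move: a0 yx ts; rewrite /s; clear; lra.
  apply: nE1 => //; apply: lt_trans gy _.
  by have [_ +] := Ha y t ya; apply.
have Ez : E2 (y + s *: delta_mx 0 i).
  apply: contrapT => nz; have [t /andP[t0 t1]] := segment_meets_boundary cl2 (S2 _ Dy) nz.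
  rewrite addrAC subrr add0r scalerA; apply: up; first by rewrite mulr_ge0// ltW.
  by rewrite ler_piMl// ltW.
have h1 : y 0 i + s <= x 0 i.
  apply: le_trans (Hx2 _ Ez); rewrite [leRHS]mxE lerD2l [leRHS]mxE [leRHS]mulrC.
  by rewrite mxE !eqxx mul1r.
have h2 : - s < y 0 i - x 0 i.
  have := le_lt_trans (rV_coord_le (y - x) i) yx.
  by rewrite [X in `|X|]mxE [X in _ + X]mxE ltr_norml => /andP[].
by case: (absurd _ _ _ h2 h1).
Qed.

(** * Comparison of the intensities *)

Lemma attenuation_eq0 (R : realType) (n : nat) (p : activity_attenuation R n) y :
  (forall k, ~ attn_region p k y) -> attenuation p y = 0.
Proof.
by move=> out; rewrite /attenuation big1// => k _; rewrite indicE memNset ?mulr0//; exact: out.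
Qed.

Lemma cutoff_bounded (R : realType) (n : nat) (f : 'rV[R]_n -> R) :
  continuous f -> compact (supp f) -> exists2 M, 0 <= M & forall y, f y <= M.
Proof.
move=> cf cs; have [M M0 HM] := continuous_compact_bounded cs cf.
exists M => // y; have [->//|fy] := eqVneq (f y) 0.
by apply: le_trans (ler_norm _) _; apply: HM; exact: subset_closure.
Qed.

(** The cutoff is 1 on the segment from [v] to a point of the region, and its product with the
    attenuation is nowhere negative; so the depth up to that point is at most [X_w1]. *)
Lemma depth_eq0 (R : realType) (n : nat) (S B : set 'rV[R]_n)
    (p : activity_attenuation R n) eps phi (v w : 'rV[R]_n) rho :
  admissible_pair B p -> cutoff_family S (region p) eps phi -> S v ->
  dotv w w = 1 -> X_w1 phi (attenuation p) v w = 0 -> 0 <= rho ->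
  region p (v + rho *: w) -> depth p v w rho = 0.
Proof.
move=> Hp [cut _] Sv ww X0 rho0 Rrho.
have [sphi cphi phi0 phi1 _] := cut v Sv.
have cont := smooth_continuous sphi.
have [Mf Mf0 HMf] := cutoff_bounded cont cphi.
have [M M0 HM] := attenuation_bounded Hp.
have [r r0 Hr] := ray_exit Hp v.
have rr : rho <= r.
  by rewrite leNgt; apply/negP => h; exact: (Hr w rho None ww h).
pose f s := phi v (v + s *: w) * attenuation p (v + s *: w).
have mf : measurable_fun setT f.
  apply: measurable_funM; first exact: measurable_ray_continuous.
  exact: measurable_ray_attenuation Hp v w.
have f0 s : 0 <= f s by rewrite mulr_ge0// (attenuation_ge0 Hp).
have fM s : f s <= Mf * M by rewrite ler_pM// (attenuation_ge0 Hp).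
have Xr : X_w1 phi (attenuation p) v w =
    \int[@lebesgue_measure R]_(s in `[0, r]) f s.
  apply: (Rintegral_ray_cut (ltW r0)) => s rs.
  rewrite attenuation_eq0 ?mulr0// => k.
  exact: (Hr w s (Some k) ww rs).
apply/eqP; rewrite eq_le (depth_ge0 Hp) andbT.
rewrite X0 in Xr; rewrite Xr.
apply: le_trans (le_Rintegral_itv mf f0 fM rr).
rewrite /depth le_eqVlt; apply/orP; left; apply/eqP.
apply: eq_Rintegral => s; rewrite inE /= in_itv /= => /andP[s0 sr].
rewrite /f phi1 ?mul1r//; exists (v + rho *: w), (s / rho).
(* If [rho = 0] the quotient has the default value 0, which is correct because then [s = 0]. *)
have tr : s / rho * rho = s.
  have [rz|rz] := eqVneq rho 0; last by rewrite divfK.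
  by rewrite rz mulr0; apply/eqP; rewrite eq_sym eq_le s0 andbT -rz.
split; first by move=> C [_]; apply.
  rewrite in_itv /= divr_ge0//=; have [rz|rz] := eqVneq rho 0.
    by rewrite rz invr0 mulr0.
  by rewrite ler_pdivrMr ?mul1r// lt_neqAle eq_sym rz.
by rewrite [v + rho *: w - v]addrAC subrr add0r scalerA tr.
Qed.

Lemma source_eq0 (R : realType) (n : nat) (p : activity_attenuation R n) y :
  ~ region p y -> source p y = 0.
Proof. by move=> out; rewrite /source indicE memNset// mulr0. Qed.

Lemma X_w2_cut (R : realType) (n : nat) (p : activity_attenuation R n)
    (v w : 'rV[R]_n) r :
  0 <= r -> (forall rho, r < rho -> ~ region p (v + rho *: w)) ->
  X_w2 (source p) v w = \int[@lebesgue_measure R]_(rho in `[0, r])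
    (rho ^+ (n - 2) * source p (v + rho *: w)).
Proof.
move=> r0 out; apply: (Rintegral_ray_cut r0) => s /out h.
by rewrite source_eq0// mulr0.
Qed.

Lemma divergent_beam_le (R : realType) (n : nat) (B : set 'rV[R]_n)
    (p : activity_attenuation R n) (v w : 'rV[R]_n) r :
  admissible_pair B p -> 0 <= r ->
  (forall rho, r < rho -> ~ region p (v + rho *: w)) ->
  divergent_beam (n - 2) (source p) (attenuation p) v w <= X_w2 (source p) v w.
Proof.
move=> Hp r0 out.
rewrite (@divergent_beam_cut _ _ _ _ _ _ _ r0 out) (X_w2_cut r0 out).
have sI s : 0 <= s <= r ->
    0 <= s ^+ (n - 2) * source p (v + s *: w) <= r ^+ (n - 2) * intensity p.
  move=> /andP[s0 sr]; have /andP[h1 h2] := source_itv Hp (v + s *: w).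
  rewrite mulr_ge0 ?exprn_ge0//= ler_pM ?exprn_ge0//.
  by rewrite lerXn2r ?nnegrE// (le_trans s0).
apply: (@le_bounded_Rintegral _ _ _ _ (r ^+ (n - 2) * intensity p)
  (r ^+ (n - 2) * intensity p)).
- exact: measurable_beam_integrand Hp _ v w.
- apply: measurable_funM; last exact: measurable_ray_source Hp v w.
  by apply: measurable_funX; exact: measurable_id.
- move=> s /(beam_integrand_itv Hp (n - 2) v w)/andP[h1 h2].
  by rewrite ger0_norm.
- by move=> s /sI/andP[h1 h2]; rewrite ger0_norm.
- move=> s /sI/andP[h1 _]; rewrite /beam_integrand ler_piMr//.
  by rewrite -expR0 ler_expR oppr_le0 (depth_ge0 Hp).
Qed.

Lemma X_w2E (R : realType) (n : nat) (B : set 'rV[R]_n)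
    (p : activity_attenuation R n) (v w : 'rV[R]_n) r :
  admissible_pair B p -> 0 <= r ->
  (forall rho, r < rho -> ~ region p (v + rho *: w)) ->
  X_w2 (source p) v w = intensity p *
    \int[@lebesgue_measure R]_(rho in `[0, r])
      (rho ^+ (n - 2) * \1_(region p) (v + rho *: w)).
Proof.
move=> Hp r0 out; rewrite (X_w2_cut r0 out).
rewrite -RintegralZl//; last first.
  apply: (@bounded_integrable _ _ _ (r ^+ (n - 2))).
    apply: measurable_funM; first by apply: measurable_funX; exact: measurable_id.
    by apply: measurable_ray_indic; exact: domain_closed (piece_domain Hp None).
  move=> s /andP[s0 sr]; rewrite normrM normrX (ger0_norm s0).
  apply: (@le_trans _ _ (r ^+ (n - 2) * 1)); last by rewrite mulr1.
  rewrite ler_pM ?exprn_ge0//.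
    by rewrite lerXn2r ?nnegrE// (le_trans s0).
  by rewrite indicE; case: (_ \in _); rewrite ?normr1 ?normr0.
by apply: eq_Rintegral => s _; rewrite /source mulrCA.
Qed.

(** On this ray the first beam equals its unattenuated transform and the second is at most its own.
    Both transforms are the intensity times one geometric integral, which is positive by hypothesis
    and can be cancelled. *)
Lemma intensity_le (R : realType) (n : nat) (S B : set 'rV[R]_n)
    (p1 p2 : activity_attenuation R n) eps phi (v w : 'rV[R]_n) :
  admissible_pair B p1 -> admissible_pair B p2 -> region p1 = region p2 ->
  cutoff_family S (region p1) eps phi -> S v -> enorm w = 1 ->
  0 < X_w2 (source p1) v w -> X_w1 phi (attenuation p1) v w = 0 ->
  divergent_beam (n - 2) (source p1) (attenuation p1) v w =
    divergent_beam (n - 2) (source p2) (attenuation p2) v w ->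
  intensity p1 <= intensity p2.
Proof.
move=> Hp1 Hp2 RR cut Sv ew X2 X1 eqD.
have ww : dotv w w = 1.
  by rewrite -(sqr_sqrtr (dotv_ge0 _)) -/(enorm _) ew expr1n.
have [r r0 Hr] := ray_exit Hp1 v; have r0' := ltW r0.
have out1 rho : r < rho -> ~ region p1 (v + rho *: w).
  by move=> rr; exact: (Hr w rho None ww rr).
have out2 rho : r < rho -> ~ region p2 (v + rho *: w) by rewrite -RR; exact: out1.
have E1 : divergent_beam (n - 2) (source p1) (attenuation p1) v w = X_w2 (source p1) v w.
  rewrite /divergent_beam /X_w2; apply: eq_Rintegral => s.
  rewrite inE /= in_itv /= andbT => s0.
  have [Rs|nRs] := pselect (region p1 (v + s *: w)); last first.
    by rewrite (source_eq0 nRs) mulr0 mul0r.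
  have := depth_eq0 Hp1 cut Sv ww X1 s0 Rs; rewrite /depth => ->.
  by rewrite oppr0 expR0 mulr1.
have E2 : divergent_beam (n - 2) (source p2) (attenuation p2) v w <= X_w2 (source p2) v w.
  exact: (divergent_beam_le Hp2 r0' out2).
move: E2; rewrite -eqD E1 (X_w2E Hp1 r0' out1) (X_w2E Hp2 r0' out2).
move: X2; rewrite (X_w2E Hp1 r0' out1) RR; set G := Rintegral _ _ _.
have [I0 _ _ _ _] := Hp1.
rewrite (pmulr_rgt0 _ I0) => G0; rewrite (ler_pM2r G0); exact: id.
Qed.

Theorem theorem4p1 (R : realType) (n : nat) (S B : set 'rV[R]_n)
    (p1 p2 : activity_attenuation R n)
    (eps1 eps2 : 'rV[R]_n -> R) (phi1 phi2 : 'rV[R]_n -> 'rV[R]_n -> R) :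
  (2 <= n)%N ->
  smooth_hypersurface S ->
  open B -> B !=set0 -> simply_connected B -> B `&` S = set0 ->
  admissible_pair B p1 -> geometric_assumptions S B p1 ->
  admissible_pair B p2 -> geometric_assumptions S B p2 ->
  small_width S p1 eps1 -> cutoff_family S (region p1) eps1 phi1 ->
  small_width S p2 eps2 -> cutoff_family S (region p2) eps2 phi2 ->
  (exists v w, [/\ S v, enorm w = 1, 0 < X_w2 (source p1) v w &
                   X_w1 phi1 (attenuation p1) v w = 0]) ->
  (exists v w, [/\ S v, enorm w = 1, 0 < X_w2 (source p2) v w &
                   X_w1 phi2 (attenuation p2) v w = 0]) ->
  (forall v w, S v -> enorm w = 1 ->
     divergent_beam (n - 2) (source p1) (attenuation p1) v w =
     divergent_beam (n - 2) (source p2) (attenuation p2) v w) ->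
  source p1 = source p2.
Proof.
move=> n2 _ oB _ _ BS Hp1 geo1 Hp2 geo2 _ cut1 _ cut2.
move=> [v1 [w1 [Sv1 ew1 X21 X11]]] [v2 [w2 [Sv2 ew2 X22 X12]]] eqD.
have eqD' v w : S v -> enorm w = 1 ->
    divergent_beam (n - 2) (source p2) (attenuation p2) v w =
    divergent_beam (n - 2) (source p1) (attenuation p1) v w.
  by move=> Sv ew; exact: esym (eqD v w Sv ew).
have dom1 := piece_domain Hp1 None; have dom2 := piece_domain Hp2 None.
have bE : boundary (region p1) = boundary (region p2).
  apply/seteqP; split=> x bx.
  - apply: (boundary_region_sub n2 oB BS Hp1 geo1 Hp2 geo2 eqD bx) => k.
    apply: (region_attenuation_disjoint n2 BS Hp1 Hp2 geo2 eqD).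
    exact: (boundary_sub (domain_closed dom1) bx).
  - apply: (boundary_region_sub n2 oB BS Hp2 geo2 Hp1 geo1 eqD' bx) => k.
    apply: (region_attenuation_disjoint n2 BS Hp2 Hp1 geo1 eqD').
    exact: (boundary_sub (domain_closed dom2) bx).
have RR : region p1 = region p2.
  (* The height may be measured along any coordinate; the one with index 1 exists since [n] is at
     least 2. *)
  exact: (domain_boundary_inj (Ordinal (leq_trans (ltnSn 1) n2)) dom1 dom2 bE).
have II : intensity p1 = intensity p2.
  apply/eqP; rewrite eq_le.
  rewrite (intensity_le Hp1 Hp2 RR cut1 Sv1 ew1 X21 X11 (eqD v1 w1 Sv1 ew1)).
  exact: (intensity_le Hp2 Hp1 (esym RR) cut2 Sv2 ew2 X22 X12 (eqD' v2 w2 Sv2 ew2)).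
by apply/funext => x; rewrite /source RR II.
Qed.
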